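(* Let $f\in\mathcal{S}_G^{\ast}$ and let its inverse have the expansion $f^{-1}(w)=w+A_2w^2+A_3w^3+\cdots$ near $w=0$. Then $$|A_2|\le\frac12,\qquad |A_3|\le\frac5{12},\qquad |A_4|\le\frac{31}{72}.$$ The bounds on $|A_2|$ and $|A_3|$ are sharp.
   Context: Let $\mathcal{U}=\{z\in\mathbb{C}:|z|<1\}$. Let $\mathcal{S}$ denote the class of functions $f$ analytic and univalent in $\mathcal{U}$ normalized by $f(0)=0$, $f'(0)=1$; each such $f$ has an analytic inverse $f^{-1}$ on $|w|<1/4$. For analytic $g,h$ on $\mathcal{U}$, $g\prec h$ means there is an analytic $w$ on $\mathcal{U}$ with $w(0)=0$, $|w(z)|<1$, and $g(z)=h(w(z))$. Let $\Psi(z)=\frac{z}{\ln(1+z)}$ on $\mathcal{U}$ (principal branch, $\Psi(0)=1$). Define $\mathcal{S}_G^{\ast}=\{f\in\mathcal{S}: zf'(z)/f(z)\prec\Psi(z)\}$. ''Sharp'' means the bound is attained by some function in $\mathcal{S}_G^{\ast}$. *)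

(* Defs.v *)
From Stdlib Require Import Reals.
From Coquelicot Require Import Coquelicot.
Open Scope R_scope.

Notation CC := Complex.C.

Definition inU (z : CC) : Prop := Cmod z < 1.

Definition cderiv (f : CC -> CC) (z l : CC) : Prop :=
  @is_derive C_AbsRing C_NormedModule f z l.

Definition analytic_U (f : CC -> CC) : Prop :=
  forall z, inU z -> exists l, cderiv f z l.

Definition univalent_U (f : CC -> CC) : Prop :=
  forall z1 z2, inU z1 -> inU z2 -> f z1 = f z2 -> z1 = z2.

Definition classS (f : CC -> CC) : Prop :=
  analytic_U f /\ univalent_U f /\ f 0%C = 0%C /\ cderiv f 0%C 1%C.

Definition subord (g h : CC -> CC) : Prop :=
  exists w : CC -> CC, analytic_U w /\ w 0%C = 0%C /\
    forall z, inU z -> Cmod (w z) < 1 /\ g z = h (w z).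

(** principal argument in (-PI, PI] and principal logarithm *)
Definition Carg (z : CC) : R :=
  if Rle_dec 0 (snd z) then acos (fst z / Cmod z) else - acos (fst z / Cmod z).
Definition Cln (z : CC) : CC := (ln (Cmod z), Carg z).

Definition Ceq_dec (z w : CC) : {z = w} + {z <> w}.
Proof.
  destruct z as [a b], w as [c d].
  destruct (Req_EM_T a c) as [H1|H1]; destruct (Req_EM_T b d) as [H2|H2];
  [left; subst; reflexivity | right; intro H; inversion H; tauto ..].
Defined.

(** Psi(z) = z / ln(1+z), with Psi(0) = 1 (removable singularity) *)
Definition Psi (z : CC) : CC :=
  if Ceq_dec z 0%C then 1%C else Cdiv z (Cln (Cplus 1%C z)).

(** z f'(z)/f(z) given the derivative f', with its value 1 at z = 0
    (removable singularity, since f(0)=0, f'(0)=1) *)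
Definition starfun (f f' : CC -> CC) (z : CC) : CC :=
  if Ceq_dec z 0%C then 1%C else Cdiv (Cmult z (f' z)) (f z).

Definition SGstar (f : CC -> CC) : Prop :=
  classS f /\
  exists f' : CC -> CC, (forall z, inU z -> cderiv f z (f' z)) /\
    subord (starfun f f') Psi.

Definition inverse_coeffs (f g : CC -> CC) (A : nat -> CC) : Prop :=
  (forall w, Cmod w < /4 -> inU (g w) /\ f (g w) = w) /\
  exists r, 0 < r /\
    forall w, Cmod w < r -> @is_pseries C_AbsRing C_NormedModule A w (g w).

(* Main.v *)
(** If [w] is the Schwarz function with [z f'(z) / f(z) = Psi (w z)] and [w z = c1 z + c2 z^2 + c3 z^3 + ...],
    comparing expansions gives [A2 = - c1 / 2], [A3 = 5/12 c1^2 - c2 / 4] and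
    [A4 = - (c3 - 10/3 c1 c2 + 31/12 c1^3) / 6]. Since [|w| <= 1], the coefficient of [z^n] in [w p^2] is at
    most the mean of [|p|^2] over the unit circle, for every polynomial [p]; [p = 1], [p = 1 + a z] and
    [p = 1 + a z + b z^2] with suitable [a], [b] yield all three bounds. Differentiability is assumed only
    pointwise, so the passage to power series rests on Goursat's lemma and Cauchy's formula.

    The first two bounds are attained for [w z = z], where [f = u exp (Ein u)] with [u = ln (1 + z)] and
    [Ein' = (e^u - 1) / u]. Univalence follows from [Re (z f' / f) = Re (z / u) > 0] by passing to [log f] as
    a function of [log z] on a half-plane; the inverse on [|w| < 1/4] is the fixed point of the contraction
    [u |-> w exp (- Ein u)]. *)

Require Import Defs.
From Stdlib Require Import Reals Lra Lia ClassicalEpsilon.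
From Coquelicot Require Import Coquelicot.
Open Scope R_scope.

(** * Continuity and complex differentiability *)


(** The usual argument manipulates power series, but [cderiv] is a statement at a single point, and
    [starfun] involves a derivative [f'] that is not known to be differentiable. All comparisons are
    therefore made between third-order jets, that is, up to [O(z^4)] at the origin. Cauchy's formula
    supplies jets for analytic functions and, through its differentiated kernel, for [f']. Jets are
    unique, hence independent of the radius used in Cauchy's integrals, so this radius may tend to 1
    in the bounds for [w].

    Sharpness asks for a full member of the class together with an inverse on the whole disc
    [|w| < 1/4], as [inverse_coeffs] demands; a local inverse near 0 would not do. In the coordinate
    [u = ln (1 + z)] both [Psi], which becomes [(e^u - 1) / u], and the extremal function are
    restrictions of entire functions. This leaves a contraction with explicit constants, for which
    rational bounds on [exp] at [1/2] and [2/3] suffice. *)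

Ltac as_C := change (UniformSpace.sort C_UniformSpace) with CC in *; change (AbsRing.sort C_AbsRing) with CC in *.
(** [ring] and [field] recognise the carrier syntactically, so the sorts of Coquelicot's structures
    are first folded back to [CC]. *)
Ltac cring := as_C; ring.
Ltac cfield := as_C; field.

Lemma locally_C_iff (z : CC) (P : CC -> Prop) :
  locally z P <-> exists d, 0 < d /\ forall y, Cmod (y - z) < d -> P y.
Proof.
  split.
  - intros [d H]; exists d; split; [apply cond_pos|].
    intros y Hy; apply H, C_NormedModule_mixin_compat1; exact Hy.
  - intros [d [Hd H]].
    (* Balls of [C] are squares; the square of half-side [d / sqrt 2] lies in the disc of radius
       [d]. *)
    assert (Hd' : 0 < d / sqrt 2) by (apply Rdiv_lt_0_compat; [exact Hd | apply sqrt_lt_R0; lra]).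
    exists (mkposreal _ Hd'); intros y Hy; apply H.
    apply C_NormedModule_mixin_compat2 in Hy; simpl in Hy.
    replace (sqrt 2 * (d / sqrt 2)) with d in Hy; [exact Hy|].
    field; apply Rgt_not_eq, sqrt_lt_R0; lra.
Qed.

(** Stated by components, so that the results on continuity and integration of real functions apply
    directly; [ccont_continuous] and [continuous_ccont] identify it with the limit in [C]. *)
Definition ccont {T : UniformSpace} (f : T -> CC) (x : T) : Prop :=
  continuous (fun t => fst (f t)) x /\ continuous (fun t => snd (f t)) x.

Lemma ccont_continuous {T : UniformSpace} (f : T -> CC) (x : T) :
  ccont f x -> filterlim f (locally x) (locally (f x)).
Proof.
  intros [H1 H2] P [d HP].
  unfold filtermap.
  specialize (H1 (fun u => ball (fst (f x)) d u) (locally_ball _ d)).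
  specialize (H2 (fun u => ball (snd (f x)) d u) (locally_ball _ d)).
  unfold filtermap in H1, H2.
  generalize (filter_and _ _ H1 H2); apply filter_imp.
  intros t [Ha Hb]; apply HP; split; assumption.
Qed.

Lemma continuous_ccont {T : UniformSpace} (f : T -> CC) (x : T) :
  filterlim f (locally x) (locally (f x)) -> ccont f x.
Proof.
  intros H; split; intros P [d HP]; unfold filtermap.
  - apply (H (fun u => P (fst u))).
    exists d; intros y [Hy _]; apply HP, Hy.
  - apply (H (fun u => P (snd u))).
    exists d; intros y [_ Hy]; apply HP, Hy.
Qed.

Lemma ccont_eps {T : UniformSpace} (f : T -> CC) (x : T) :
  ccont f x <-> forall e, 0 < e -> locally x (fun y => Cmod (f y - f x) < e).
Proof.
  split.
  - intros H e He; apply ccont_continuous in H.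
    apply (H (fun u => Cmod (u - f x) < e)).
    apply locally_C_iff; exists e; split; auto.
  - intros H; apply continuous_ccont; intros P HP.
    apply locally_C_iff in HP; destruct HP as [d [Hd HP]].
    unfold filtermap; generalize (H d Hd); apply filter_imp; intros y Hy; apply HP, Hy.
Qed.

Lemma ccont_const {T : UniformSpace} (c : CC) (x : T) : ccont (fun _ => c) x.
Proof. split; apply continuous_const. Qed.

Lemma ccont_id (z : CC) : ccont (fun y : CC => y) z.
Proof. apply continuous_ccont; intros P HP; exact HP. Qed.

Lemma ccont_RtoC {T : UniformSpace} (f : T -> R) (x : T) :
  continuous f x -> ccont (fun t => RtoC (f t)) x.
Proof. intros H; split; simpl; [exact H | apply continuous_const]. Qed.

Lemma ccont_plus {T : UniformSpace} (f g : T -> CC) (x : T) :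
  ccont f x -> ccont g x -> ccont (fun t => f t + g t)%C x.
Proof.
  intros [H1 H2] [H3 H4]; split; simpl.
  - exact (continuous_plus (V := R_NormedModule) _ _ _ H1 H3).
  - exact (continuous_plus (V := R_NormedModule) _ _ _ H2 H4).
Qed.

Lemma ccont_opp {T : UniformSpace} (f : T -> CC) (x : T) :
  ccont f x -> ccont (fun t => - f t)%C x.
Proof.
  intros [H1 H2]; split; simpl.
  - exact (continuous_opp (V := R_NormedModule) _ _ H1).
  - exact (continuous_opp (V := R_NormedModule) _ _ H2).
Qed.

Lemma ccont_minus {T : UniformSpace} (f g : T -> CC) (x : T) :
  ccont f x -> ccont g x -> ccont (fun t => f t - g t)%C x.
Proof. intros Hf Hg; apply ccont_plus; [exact Hf | apply ccont_opp, Hg]. Qed.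

Lemma ccont_mult {T : UniformSpace} (f g : T -> CC) (x : T) :
  ccont f x -> ccont g x -> ccont (fun t => f t * g t)%C x.
Proof.
  intros [H1 H2] [H3 H4]; split; simpl.
  - apply (continuous_minus (V := R_NormedModule));
      apply (continuous_mult (K := R_AbsRing)); assumption.
  - apply (continuous_plus (V := R_NormedModule));
      apply (continuous_mult (K := R_AbsRing)); assumption.
Qed.

Lemma sum_sqr_neq_0 (z : CC) : z <> 0 -> fst z ^ 2 + snd z ^ 2 <> 0.
Proof.
  intros Hz H; apply Hz; destruct z as [a b]; simpl in *.
  apply injective_projections; simpl; nra.
Qed.

Lemma ccont_inv {T : UniformSpace} (f : T -> CC) (x : T) :
  ccont f x -> f x <> 0 -> ccont (fun t => / f t)%C x.
Proof.
  intros [H1 H2] Hx; apply sum_sqr_neq_0 in Hx; simpl in Hx.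
  assert (Hn : continuous (fun t => / (fst (f t) * (fst (f t) * 1) + snd (f t) * (snd (f t) * 1))) x).
  { apply (continuous_comp _ Rinv); [|apply continuous_Rinv, Hx].
    apply (continuous_plus (V := R_NormedModule));
      repeat (apply (continuous_mult (K := R_AbsRing)); try assumption; try apply continuous_const). }
  split; simpl; unfold Rdiv; apply (continuous_mult (K := R_AbsRing)); try assumption.
  exact (continuous_opp (V := R_NormedModule) _ _ H2).
Qed.

Lemma ccont_div {T : UniformSpace} (f g : T -> CC) (x : T) :
  ccont f x -> ccont g x -> g x <> 0 -> ccont (fun t => f t / g t)%C x.
Proof. intros Hf Hg H; apply ccont_mult; [|apply ccont_inv]; assumption. Qed.

Lemma ccont_pow {T : UniformSpace} (f : T -> CC) (n : nat) (x : T) :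
  ccont f x -> ccont (fun t => f t ^ n)%C x.
Proof.
  intros H; induction n as [|n IH]; simpl; [apply ccont_const|].
  apply ccont_mult; assumption.
Qed.

Lemma ccont_comp {T : UniformSpace} (f : T -> CC) (g : CC -> CC) (x : T) :
  ccont f x -> ccont g (f x) -> ccont (fun t => g (f t)) x.
Proof.
  intros Hf Hg; apply continuous_ccont.
  apply ccont_continuous in Hf; apply ccont_continuous in Hg.
  eapply filterlim_comp; eassumption.
Qed.

Lemma ccont_ext_loc {T : UniformSpace} (f g : T -> CC) (x : T) :
  locally x (fun t => f t = g t) -> ccont f x -> ccont g x.
Proof.
  intros Hl [H1 H2]; split.
  - apply (continuous_ext_loc (fun t => fst (g t)) (fun t => fst (f t))); [|exact H1].
    revert Hl; apply filter_imp; intros t ->; reflexivity.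
  - apply (continuous_ext_loc (fun t => snd (g t)) (fun t => snd (f t))); [|exact H2].
    revert Hl; apply filter_imp; intros t ->; reflexivity.
Qed.

Lemma ccont_neq_0 {T : UniformSpace} (f : T -> CC) (x : T) :
  ccont f x -> f x <> 0 -> locally x (fun t => f t <> 0).
Proof.
  intros Hf Hx.
  assert (Hp : 0 < Cmod (f x)) by (apply Cmod_gt_0; exact Hx).
  rewrite ccont_eps in Hf; generalize (Hf _ Hp); apply filter_imp.
  intros t Ht E; rewrite E in Ht.
  replace (0 - f x)%C with (- f x)%C in Ht by ring.
  rewrite Cmod_opp in Ht; lra.
Qed.

Lemma continuous_Cmod {T : UniformSpace} (f : T -> CC) (x : T) :
  ccont f x -> continuous (fun t => Cmod (f t)) x.
Proof.
  intros [H1 H2]; unfold Cmod.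
  apply (continuous_comp _ sqrt); [|apply continuous_sqrt].
  simpl.
  apply (continuous_plus (V := R_NormedModule));
    repeat (apply (continuous_mult (K := R_AbsRing)); try assumption; try apply continuous_const).
Qed.

Lemma Cmod_sub_sym (a b : CC) : Cmod (a - b) = Cmod (b - a).
Proof. rewrite <- Cmod_opp; f_equal; ring. Qed.

Lemma Cmod_triangle_sub (a b : CC) : Cmod (a - b) <= Cmod a + Cmod b.
Proof. rewrite <- (Cmod_opp b); apply Cmod_triangle. Qed.

Lemma Cmod_triangle_inv (a b : CC) : Cmod a - Cmod b <= Cmod (a - b).
Proof.
  assert (H := Cmod_triangle (a - b) b).
  replace (a - b + b)%C with a in H by ring; lra.
Qed.

Lemma Cmod_triangle_inv' (a b : CC) : Cmod a - Cmod b <= Cmod (a + b).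
Proof.
  assert (H := Cmod_triangle_inv a (- b)); rewrite Cmod_opp in H.
  replace (a - - b)%C with (a + b)%C in H by ring; exact H.
Qed.

(** [is_derive] over [C_AbsRing] quantifies over the neighbourhoods of the norm topology, while [C]
    carries by default the product topology of [R * R]. *)
Lemma locally_norm_topology (z : CC) (P : CC -> Prop) :
  @locally (AbsRing_UniformSpace C_AbsRing) z P <-> locally z P.
Proof.
  rewrite locally_C_iff; split.
  - intros [d H]; exists d; split; [apply cond_pos | exact H].
  - intros [d [Hd H]]; exists (mkposreal d Hd); exact H.
Qed.

Lemma cderiv_eps (f : CC -> CC) (z l : CC) :
  cderiv f z l <-> forall e, 0 < e ->
    locally z (fun y => Cmod (f y - f z - (y - z) * l) <= e * Cmod (y - z)).
Proof.
  split.
  - intros [_ H] e He.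
    specialize (H z (fun P HP => HP) (mkposreal e He)).
    apply locally_norm_topology in H.
    revert H; apply filter_imp; intros y Hy.
    exact Hy.
  - intros H; split; [apply is_linear_scal_l|].
    intros x Hx e.
    apply (is_filter_lim_locally_unique (V := AbsRing_NormedModule C_AbsRing)) in Hx; subst x.
    apply locally_norm_topology; generalize (H e (cond_pos e)); apply filter_imp; intros y Hy.
    exact Hy.
Qed.

(** Carathéodory's form of differentiability, from which the rules of calculus follow by the
    algebra of continuous functions. *)
Lemma cderiv_slope (f : CC -> CC) (z l : CC) :
  cderiv f z l <-> exists p : CC -> CC,
    locally z (fun y => f y = f z + (y - z) * p y)%C /\ p z = l /\ ccont p z.
Proof.
  rewrite cderiv_eps; split.
  - intros H.
    exists (fun y => if Ceq_dec y z then l else ((f y - f z) / (y - z))%C).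
    split; [|split].
    + exists (mkposreal 1 Rlt_0_1); intros y _.
      destruct (Ceq_dec y z) as [->|N]; [cring | cfield; apply Cminus_eq_contra; exact N].
    + destruct (Ceq_dec z z); [reflexivity | contradiction].
    + apply ccont_eps; intros e He.
      assert (He2 : 0 < e / 2) by lra.
      generalize (H _ He2); apply filter_imp; intros y Hy.
      destruct (Ceq_dec z z) as [_|N]; [|contradiction].
      destruct (Ceq_dec y z) as [->|N].
      * replace (l - l)%C with (RtoC 0) by cring; rewrite Cmod_0; exact He.
      * assert (N' := Cminus_eq_contra _ _ N).
        replace ((f y - f z) / (y - z) - l)%C with ((f y - f z - (y - z) * l) / (y - z))%C
          by (cfield; exact N').
        rewrite Cmod_div by exact N'.
        apply Cmod_gt_0 in N'.
        apply Rle_lt_trans with (e / 2); [|lra].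
        apply Rle_div_l; assumption.
  - intros [p [Hp [<- Hc]]] e He.
    rewrite ccont_eps in Hc.
    generalize (filter_and _ _ Hp (Hc e He)); apply filter_imp.
    intros y [Hy Hd]; rewrite Hy.
    replace (f z + (y - z) * p y - f z - (y - z) * p z)%C with ((p y - p z) * (y - z))%C by cring.
    rewrite Cmod_mult; apply Rmult_le_compat_r; [apply Cmod_ge_0 | lra].
Qed.

Lemma cderiv_ccont (f : CC -> CC) (z l : CC) : cderiv f z l -> ccont f z.
Proof.
  intros H; apply cderiv_slope in H; destruct H as [p [Hp [_ Hc]]].
  apply ccont_ext_loc with (fun y => f z + (y - z) * p y)%C.
  - revert Hp; apply filter_imp; intros y ->; reflexivity.
  - apply ccont_plus; [apply ccont_const|]; apply ccont_mult; [|exact Hc].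
    apply ccont_minus; [apply ccont_id | apply ccont_const].
Qed.

Lemma cderiv_ext_loc (f g : CC -> CC) (z l : CC) :
  locally z (fun y => f y = g y) -> cderiv f z l -> cderiv g z l.
Proof.
  intros H; rewrite !cderiv_eps; intros Hf e He.
  assert (E := locally_singleton _ _ H).
  generalize (filter_and _ _ H (Hf e He)); apply filter_imp.
  intros y [Ey Hy]; rewrite <- Ey, <- E; exact Hy.
Qed.

Lemma cderiv_ext (f g : CC -> CC) (z l : CC) :
  (forall y, f y = g y) -> cderiv f z l -> cderiv g z l.
Proof. intros H; apply cderiv_ext_loc, filter_forall, H. Qed.

Lemma cderiv_unique (f : CC -> CC) (z l m : CC) : cderiv f z l -> cderiv f z m -> l = m.
Proof. intros H1 H2; rewrite <- (is_C_derive_unique _ _ _ H1); apply is_C_derive_unique, H2. Qed.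

Lemma cderiv_const (c z : CC) : cderiv (fun _ => c) z 0%C.
Proof.
  apply cderiv_slope; exists (fun _ => 0%C); split; [|split; [reflexivity | apply ccont_const]].
  apply filter_forall; intros y; cring.
Qed.

Lemma cderiv_id (z : CC) : cderiv (fun y => y) z 1%C.
Proof.
  apply cderiv_slope; exists (fun _ => 1%C); split; [|split; [reflexivity | apply ccont_const]].
  apply filter_forall; intros y; cring.
Qed.

Lemma cderiv_plus (f g : CC -> CC) (z l m : CC) :
  cderiv f z l -> cderiv g z m -> cderiv (fun y => f y + g y)%C z (l + m)%C.
Proof.
  rewrite !cderiv_slope; intros [p [Hp [<- Cp]]] [q [Hq [<- Cq]]].
  exists (fun y => p y + q y)%C; split; [|split; [reflexivity | apply ccont_plus; assumption]].
  generalize (filter_and _ _ Hp Hq); apply filter_imp.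
  intros y [E1 E2]; rewrite E1, E2; cring.
Qed.

Lemma cderiv_mult (f g : CC -> CC) (z l m : CC) :
  cderiv f z l -> cderiv g z m -> cderiv (fun y => f y * g y)%C z (l * g z + f z * m)%C.
Proof.
  intros Hf Hg; assert (Cg := cderiv_ccont _ _ _ Hg); revert Hf Hg.
  rewrite !cderiv_slope; intros [p [Hp [<- Cp]]] [q [Hq [<- Cq]]].
  exists (fun y => p y * g y + f z * q y)%C; split; [|split; [reflexivity|]].
  - generalize (filter_and _ _ Hp Hq); apply filter_imp.
    intros y [E1 E2]; rewrite E1, E2; cring.
  - apply ccont_plus; apply ccont_mult; try assumption; apply ccont_const.
Qed.

Lemma cderiv_inv (f : CC -> CC) (z l : CC) :
  cderiv f z l -> f z <> 0 -> cderiv (fun y => / f y)%C z (- l / (f z * f z))%C.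
Proof.
  intros Hf Hz; assert (Cf := cderiv_ccont _ _ _ Hf).
  assert (Hn := ccont_neq_0 _ _ Cf Hz).
  apply cderiv_slope in Hf; destruct Hf as [p [Hp [<- Cp]]].
  apply cderiv_slope; exists (fun y => - p y / (f y * f z))%C; split; [|split; [reflexivity|]].
  - generalize (filter_and _ _ Hp Hn); apply filter_imp.
    intros y [E1 E2].
    assert (E3 : ((y - z) * p y = f y - f z)%C) by (rewrite E1; cring).
    replace (/ f z + (y - z) * (- p y / (f y * f z)))%C
      with (/ f z - ((y - z) * p y) / (f y * f z))%C by (cfield; split; assumption).
    rewrite E3; cfield; split; assumption.
  - apply ccont_div; [apply ccont_opp, Cp | apply ccont_mult; [exact Cf | apply ccont_const] |].
    apply Cmult_neq_0; exact Hz.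
Qed.

Lemma cderiv_comp (f g : CC -> CC) (z l m : CC) :
  cderiv f z l -> cderiv g (f z) m -> cderiv (fun y => g (f y)) z (l * m)%C.
Proof.
  intros Hf Hg; assert (Cf := cderiv_ccont _ _ _ Hf).
  apply cderiv_slope in Hf; destruct Hf as [p [Hp [<- Cp]]].
  apply cderiv_slope in Hg; destruct Hg as [q [Hq [<- Cq]]].
  apply cderiv_slope; exists (fun y => p y * q (f y))%C; split; [|split; [reflexivity|]].
  - assert (Hq' := ccont_continuous _ _ Cf _ Hq); unfold filtermap in Hq'.
    generalize (filter_and _ _ Hp Hq'); apply filter_imp.
    intros y [E1 E2]; rewrite E2.
    replace (f y - f z)%C with ((y - z) * p y)%C by (rewrite E1; cring); cring.
  - apply ccont_mult; [exact Cp | apply (ccont_comp f q); assumption].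
Qed.

(** Composing the slope function of [e] with the continuous [l] and inverting it gives a slope
    function for [l]. Applied to [Cln] and to [extremal_inv]. *)
Lemma cderiv_inverse (e l : CC -> CC) (z d : CC) :
  locally z (fun y => e (l y) = y) -> ccont l z -> cderiv e (l z) d -> d <> 0 ->
  cderiv l z (/ d)%C.
Proof.
  intros Hel Cl He Hd.
  apply cderiv_slope in He; destruct He as [q [Hq [<- Cq]]].
  assert (Cql := ccont_comp l q z Cl Cq).
  apply cderiv_slope; exists (fun y => / q (l y))%C; split; [|split; [reflexivity|]].
  - assert (Hq' := ccont_continuous _ _ Cl _ Hq); unfold filtermap in Hq'.
    assert (Ez := locally_singleton _ _ Hel).
    generalize (filter_and _ _ Hel (filter_and _ _ Hq' (ccont_neq_0 _ _ Cql Hd))); apply filter_imp.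
    intros y [E1 [E2 E3]]; cbv beta in *.
    assert (E4 : (y - z = (l y - l z) * q (l y))%C) by (rewrite <- E1, <- Ez at 1; rewrite E2; cring).
    rewrite E4; cfield; exact E3.
  - apply ccont_inv; assumption.
Qed.

(** * Differentiable curves and the mean value inequality *)

Definition rderiv (f : R -> CC) (t : R) (l : CC) : Prop :=
  is_derive (fun x => fst (f x)) t (fst l) /\ is_derive (fun x => snd (f x)) t (snd l).

Lemma rderiv_ccont (f : R -> CC) (t : R) (l : CC) : rderiv f t l -> ccont f t.
Proof.
  intros [H1 H2]; split; apply (ex_derive_continuous (K := R_AbsRing) (V := R_NormedModule));
    eexists; eassumption.
Qed.

Lemma rderiv_eps (f : R -> CC) (t : R) (l : CC) :
  rderiv f t l <-> forall e, 0 < e ->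
    locally t (fun y => Cmod (f y - f t - (y - t) * l) <= e * Rabs (y - t)).
Proof.
  split.
  - intros [[_ H1] [_ H2]] e He.
    assert (He2 : 0 < e / 2) by lra.
    specialize (H1 t (fun P HP => HP) (mkposreal _ He2)).
    specialize (H2 t (fun P HP => HP) (mkposreal _ He2)).
    generalize (filter_and _ _ H1 H2); apply filter_imp; intros y [Ha Hb].
    change (Rabs (fst (f y) - fst (f t) - (y - t) * fst l) <= e / 2 * Rabs (y - t)) in Ha.
    change (Rabs (snd (f y) - snd (f t) - (y - t) * snd l) <= e / 2 * Rabs (y - t)) in Hb.
    replace (f y - f t - (y - t) * l)%C
      with (RtoC (fst (f y) - fst (f t) - (y - t) * fst l)
            + RtoC (snd (f y) - snd (f t) - (y - t) * snd l) * Ci)%C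
      by (destruct (f y), (f t), l; apply injective_projections; simpl; cring).
    eapply Rle_trans; [apply Cmod_triangle|].
    rewrite Cmod_mult, !Cmod_R, Cmod_Ci; lra.
  - intros H; split; (split; [apply is_linear_scal_l|]);
      intros x Hx e; apply (is_filter_lim_locally_unique (V := R_NormedModule)) in Hx; subst x;
      generalize (H e (cond_pos e)); apply filter_imp; intros y Hy;
      (eapply Rle_trans; [|exact Hy]); (eapply Rle_trans; [|apply Rmax_Cmod]).
    + eapply Rle_trans; [|apply Rmax_l]; right.
      change (Rabs (fst (f y) - fst (f t) - (y - t) * fst l)
        = Rabs (fst (f y - f t - (y - t) * l)%C)).
      f_equal; simpl; cring.
    + eapply Rle_trans; [|apply Rmax_r]; right.
      change (Rabs (snd (f y) - snd (f t) - (y - t) * snd l)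
        = Rabs (snd (f y - f t - (y - t) * l)%C)).
      f_equal; simpl; cring.
Qed.

Lemma rderiv_comp (f : R -> CC) (g : CC -> CC) (t : R) (l m : CC) :
  rderiv f t l -> cderiv g (f t) m -> rderiv (fun x => g (f x)) t (l * m)%C.
Proof.
  intros Hf Hg; assert (Cf := rderiv_ccont _ _ _ Hf).
  apply cderiv_slope in Hg; destruct Hg as [q [Hq [<- Cq]]].
  rewrite rderiv_eps in Hf; apply rderiv_eps; intros e He.
  assert (Cqf := ccont_comp f q t Cf Cq).
  pose (K := Cmod (q (f t)) + 1); pose (L := Cmod l + 1).
  assert (HK : 0 < K) by (unfold K; generalize (Cmod_ge_0 (q (f t))); lra).
  assert (HL : 0 < L) by (unfold L; generalize (Cmod_ge_0 l); lra).
  assert (H1 := Hf _ (Rdiv_lt_0_compat _ _ He (Rmult_lt_0_compat 2 K ltac:(lra) HK))).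
  assert (H2 := proj1 (ccont_eps _ _) Cqf _ (Rmin_pos _ _ Rlt_0_1
     (Rdiv_lt_0_compat _ _ He (Rmult_lt_0_compat 2 L ltac:(lra) HL)))).
  assert (Hq' := ccont_continuous _ _ Cf _ Hq); unfold filtermap in Hq'.
  generalize (filter_and _ _ H1 (filter_and _ _ H2 Hq')); apply filter_imp.
  intros y [Ha [Hb Hc]]; rewrite Hc.
  replace (g (f t) + (f y - f t) * q (f y) - g (f t) - (y - t) * (l * q (f t)))%C
    with ((f y - f t - (y - t) * l) * q (f y) + (y - t) * l * (q (f y) - q (f t)))%C by cring.
  eapply Rle_trans; [apply Cmod_triangle|].
  rewrite !Cmod_mult.
  replace (Cmod (y - t)%C) with (Rabs (y - t)) by (rewrite <- RtoC_minus, Cmod_R; reflexivity).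
  assert (Hb1 : Cmod (q (f y) - q (f t)) < 1) by (eapply Rlt_le_trans; [exact Hb | apply Rmin_l]).
  assert (Hb2 : Cmod (q (f y) - q (f t)) < e / (2 * L))
    by (eapply Rlt_le_trans; [exact Hb | apply Rmin_r]).
  assert (HqK : Cmod (q (f y)) <= K).
  { assert (T := Cmod_triangle_inv (q (f y)) (q (f t))); unfold K; lra. }
  assert (Hab := Rabs_pos (y - t)).
  assert (Hlow := Cmod_ge_0 l).
  assert (T1 : Cmod (f y - f t - (y - t) * l) * Cmod (q (f y)) <= e / 2 * Rabs (y - t)).
  { apply Rle_trans with (e / (2 * K) * Rabs (y - t) * K).
    - apply Rmult_le_compat; try apply Cmod_ge_0; assumption.
    - right; cfield; lra. }
  assert (T2 : Rabs (y - t) * Cmod l * Cmod (q (f y) - q (f t)) <= e / 2 * Rabs (y - t)).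
  { apply Rle_trans with (Rabs (y - t) * L * (e / (2 * L))).
    - apply Rmult_le_compat; try apply Cmod_ge_0; try lra.
      + apply Rmult_le_pos; assumption.
      + apply Rmult_le_compat_l; [exact Hab | unfold L; lra].
    - right; cfield; lra. }
  lra.
Qed.

Lemma rderiv_line (a b : CC) (t : R) : rderiv (fun x => a + x * b)%C t b.
Proof. split; simpl; auto_derive; auto; cring. Qed.

(** Rotation by [u] turns a modulus into a real part, which real mean value theorems and integral
    inequalities can bound. *)
Lemma exists_phase (z : CC) : exists u, Cmod u = 1 /\ (u * z = Cmod z)%C.
Proof.
  destruct (Ceq_dec z 0) as [->|N].
  - exists 1%C; rewrite Cmod_0, Cmod_1; split; [reflexivity | cring].
  - assert (P : 0 < Cmod z) by (apply Cmod_gt_0; exact N).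
    assert (N' : RtoC (Cmod z) <> 0) by (intros E; apply RtoC_inj in E; lra).
    exists (Cconj z / Cmod z)%C; split.
    + rewrite Cmod_div, Cmod_conj, Cmod_R, Rabs_pos_eq by (assumption || lra); cfield; lra.
    + replace (Cconj z / Cmod z * z)%C with (z * Cconj z / Cmod z)%C by (cfield; exact N').
      rewrite <- Cmod2_conj, RtoC_pow; cfield; exact N'.
Qed.

(** The real mean value theorem applied to [Re (u F) - phi] along the segment, where [u] is the
    phase of the increment. Allowing a variable majorant rather than a constant later yields
    [|e^u - 1| <= e^|u| - 1]. *)
Lemma mean_value_majorant (F F' : CC -> CC) (a b : CC) (phi phi' : R -> R) :
  (forall t, 0 <= t <= 1 -> cderiv F (a + t * b)%C (F' (a + t * b)%C)) ->
  (forall t, 0 <= t <= 1 -> is_derive phi t (phi' t)) ->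
  (forall t, 0 <= t <= 1 -> Cmod (F' (a + t * b)%C * b) <= phi' t) ->
  Cmod (F (a + b)%C - F a) <= phi 1 - phi 0.
Proof.
  intros HF Hphi Hb.
  destruct (exists_phase (F (a + b) - F a)%C) as [u [Hu Eu]].
  pose (h := fun t : R => (u * F (a + t * b))%C).
  assert (Hh : forall t, 0 <= t <= 1 -> rderiv h t (b * (u * F' (a + t * b)))%C).
  { intros t Ht; unfold h.
    apply (rderiv_comp (fun t => a + t * b)%C (fun z => u * F z)%C); [apply rderiv_line|].
    replace (u * F' (a + t * b))%C with (0 * F (a + t * b) + u * F' (a + t * b))%C by cring.
    apply cderiv_mult; [apply cderiv_const | apply HF, Ht]. }
  destruct (MVT_gen (fun t => fst (h t) - phi t) 0 1
    (fun t => fst (b * (u * F' (a + t * b)))%C - phi' t)) as [c [Hc E]].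
  - rewrite Rmin_left, Rmax_right by lra; intros t Ht.
    apply (is_derive_minus (V := R_NormedModule)); [apply Hh; lra | apply Hphi; lra].
  - rewrite Rmin_left, Rmax_right by lra; intros t Ht.
    apply continuity_pt_filterlim.
    apply (continuous_minus (V := R_NormedModule) (fun t => fst (h t)) phi).
    + apply (rderiv_ccont _ _ _ (Hh t Ht)).
    + apply (ex_derive_continuous (K := R_AbsRing) (V := R_NormedModule) phi); eexists; exact (Hphi t Ht).
  - rewrite Rmin_left, Rmax_right in Hc by lra.
    specialize (Hb c Hc).
    assert (Hm : fst (b * (u * F' (a + c * b)))%C <= Cmod (F' (a + c * b)%C * b)).
    { eapply Rle_trans; [apply Rle_abs|].
      eapply Rle_trans; [eapply Rle_trans; [apply Rmax_l | apply Rmax_Cmod]|].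
      rewrite !Cmod_mult, Hu; right; cring. }
    assert (E1 : fst (h 1) - fst (h 0) = Cmod (F (a + b)%C - F a)).
    { change (Cmod (F (a + b)%C - F a)) with (fst (RtoC (Cmod (F (a + b)%C - F a)))).
      rewrite <- Eu; unfold h.
      replace (a + 1%R * b)%C with (a + b)%C by cring.
      replace (a + 0%R * b)%C with a by cring.
      simpl; cring. }
    cbv beta in E; nra.
Qed.

Lemma mean_value_ineq (F F' : CC -> CC) (a b : CC) (M : R) :
  (forall t, 0 <= t <= 1 -> cderiv F (a + t * b)%C (F' (a + t * b)%C)) ->
  (forall t, 0 <= t <= 1 -> Cmod (F' (a + t * b)%C) <= M) ->
  Cmod (F (a + b)%C - F a) <= M * Cmod b.
Proof.
  intros HF Hb.
  replace (M * Cmod b) with (M * Cmod b * 1 - M * Cmod b * 0) by cring.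
  apply (mean_value_majorant F F' a b (fun t => M * Cmod b * t) (fun _ => M * Cmod b)); auto.
  - intros t _; auto_derive; auto; cring.
  - intros t Ht; rewrite Cmod_mult; apply Rmult_le_compat_r; [apply Cmod_ge_0 | auto].
Qed.

Lemma cderiv_eq (f : CC -> CC) (z l m : CC) : cderiv f z l -> l = m -> cderiv f z m.
Proof. intros H <-; exact H. Qed.

Lemma cderiv_opp (f : CC -> CC) (z l : CC) : cderiv f z l -> cderiv (fun y => - f y)%C z (- l)%C.
Proof.
  intros H; apply cderiv_eq with (0 * f z + (- (1)) * l)%C; [|ring].
  apply cderiv_ext with (fun y => (- (1)) * f y)%C; [intros y; ring|].
  apply (cderiv_mult (fun _ => - (1))%C f); [apply cderiv_const | exact H].
Qed.

Lemma cderiv_minus (f g : CC -> CC) (z l m : CC) :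
  cderiv f z l -> cderiv g z m -> cderiv (fun y => f y - g y)%C z (l - m)%C.
Proof. intros Hf Hg; apply cderiv_plus; [exact Hf | apply cderiv_opp, Hg]. Qed.

Ltac cderiv_step := match goal with
  | H : cderiv ?f ?z _ |- cderiv ?f ?z _ => exact H
  | |- cderiv (fun _ => ?c) _ _ => apply cderiv_const
  | |- cderiv (fun y => y) _ _ => apply cderiv_id
  | |- cderiv (fun y => Cminus (@?f y) (@?g y)) _ _ => eapply (cderiv_minus f g)
  | |- cderiv (fun y => Cplus (@?f y) (@?g y)) _ _ => eapply (cderiv_plus f g)
  | |- cderiv (fun y => Copp (@?f y)) _ _ => eapply (cderiv_opp f)
  | |- cderiv (fun y => Cdiv (@?f y) (@?g y)) _ _ => eapply (cderiv_mult f (fun y => Cinv (g y)))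
  | |- cderiv (fun y => Cmult (@?f y) (@?g y)) _ _ => eapply (cderiv_mult f g)
  | |- cderiv (fun y => Cinv (@?f y)) _ _ => eapply (cderiv_inv f)
  end.
Ltac cderiv_calc := eapply cderiv_eq; [repeat cderiv_step|].

Lemma ccont_conj {T : UniformSpace} (f : T -> CC) (x : T) : ccont f x -> ccont (fun t => Cconj (f t)) x.
Proof. intros [H1 H2]; split; simpl; [exact H1 | exact (continuous_opp (V := R_NormedModule) _ _ H2)]. Qed.

(** * Contour integrals and Goursat's lemma *)


Definition CI (f : R -> CC) (a b : R) : CC :=
  (RInt (fun t => fst (f t)) a b, RInt (fun t => snd (f t)) a b).

Definition ccont_on (f : R -> CC) (a b : R) : Prop := forall t, a <= t <= b -> ccont f t.

Lemma ccont_on_ex_RInt (f : R -> CC) (a b : R) : a <= b -> ccont_on f a b ->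
  ex_RInt (fun t => fst (f t)) a b /\ ex_RInt (fun t => snd (f t)) a b.
Proof.
  intros Hab Hf; split; apply (ex_RInt_continuous (V := R_CompleteNormedModule));
    rewrite Rmin_left, Rmax_right by lra; intros t Ht; apply (Hf t Ht).
Qed.

Lemma CI_ext (f g : R -> CC) (a b : R) : a <= b ->
  (forall t, a <= t <= b -> f t = g t) -> CI f a b = CI g a b.
Proof.
  intros Hab H; unfold CI; f_equal; apply RInt_ext; rewrite Rmin_left, Rmax_right by lra;
    intros t Ht; rewrite H by lra; reflexivity.
Qed.

Lemma CI_plus (f g : R -> CC) (a b : R) : a <= b -> ccont_on f a b -> ccont_on g a b ->
  CI (fun t => f t + g t)%C a b = (CI f a b + CI g a b)%C.
Proof.
  intros Hab Hf Hg.
  destruct (ccont_on_ex_RInt f a b Hab Hf), (ccont_on_ex_RInt g a b Hab Hg).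
  apply injective_projections; simpl; apply (RInt_plus (V := R_CompleteNormedModule)); assumption.
Qed.

Lemma CI_scal (c : CC) (f : R -> CC) (a b : R) : a <= b -> ccont_on f a b ->
  CI (fun t => c * f t)%C a b = (c * CI f a b)%C.
Proof.
  intros Hab Hf; destruct (ccont_on_ex_RInt f a b Hab Hf) as [H1 H2].
  assert (S : forall (k : R) (u : R -> R), ex_RInt u a b -> ex_RInt (fun t => k * u t) a b)
    by (intros k u Hu; apply (ex_RInt_scal (V := R_NormedModule)), Hu).
  assert (E : forall (k : R) (u : R -> R), ex_RInt u a b ->
      RInt (fun t => k * u t) a b = k * RInt u a b)
    by (intros k u Hu; apply (RInt_scal (V := R_CompleteNormedModule)), Hu).
  apply injective_projections; simpl; rewrite <- !E by assumption.
  - apply (RInt_minus (V := R_CompleteNormedModule)); apply S; assumption.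
  - apply (RInt_plus (V := R_CompleteNormedModule)); apply S; assumption.
Qed.

Lemma CI_const (c : CC) (a b : R) : CI (fun _ => c) a b = (c * (b - a))%C.
Proof.
  unfold CI; rewrite !RInt_const; apply injective_projections; simpl;
    unfold scal; simpl; unfold mult; simpl; ring.
Qed.

Lemma CI_Chasles (f : R -> CC) (a b c : R) : a <= b -> b <= c ->
  ccont_on f a c -> CI f a c = (CI f a b + CI f b c)%C.
Proof.
  intros Hab Hbc Hf.
  destruct (ccont_on_ex_RInt f a b) as [H1 H2]; [lra | intros t Ht; apply Hf; lra |].
  destruct (ccont_on_ex_RInt f b c) as [H3 H4]; [lra | intros t Ht; apply Hf; lra |].
  apply injective_projections; simpl; symmetry; apply (RInt_Chasles (V := R_CompleteNormedModule));
    assumption.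
Qed.

Lemma Re_le_Cmod (z : CC) : fst z <= Cmod z.
Proof.
  eapply Rle_trans; [apply Rle_abs|].
  eapply Rle_trans; [apply Rmax_l | apply Rmax_Cmod].
Qed.

Lemma CI_bound_fun (f : R -> CC) (phi : R -> R) (a b : R) : a <= b -> ccont_on f a b ->
  ex_RInt phi a b -> (forall t, a <= t <= b -> Cmod (f t) <= phi t) ->
  Cmod (CI f a b) <= RInt phi a b.
Proof.
  intros Hab Hf Hp H.
  destruct (exists_phase (CI f a b)) as [u [Hu Eu]].
  assert (Hc : ccont_on (fun t => u * f t)%C a b)
    by (intros t Ht; apply ccont_mult; [apply ccont_const | apply Hf, Ht]).
  rewrite <- CI_scal in Eu by assumption.
  replace (Cmod (CI f a b)) with (fst (CI (fun t => u * f t)%C a b)) by (rewrite Eu; reflexivity).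
  apply RInt_le; [exact Hab | apply (ccont_on_ex_RInt _ a b Hab Hc) | exact Hp |].
  intros t Ht; eapply Rle_trans; [apply Re_le_Cmod|].
  rewrite Cmod_mult, Hu, Rmult_1_l; apply H; lra.
Qed.

Lemma CI_bound (f : R -> CC) (M a b : R) : a <= b -> ccont_on f a b ->
  (forall t, a <= t <= b -> Cmod (f t) <= M) -> Cmod (CI f a b) <= M * (b - a).
Proof.
  intros Hab Hf H.
  replace (M * (b - a)) with (RInt (fun _ => M) a b)
    by (rewrite RInt_const; unfold scal; simpl; unfold mult; simpl; ring).
  apply CI_bound_fun; auto; apply (ex_RInt_const (V := R_NormedModule)).
Qed.

Lemma CI_derive (F f : R -> CC) (a b : R) : a <= b ->
  (forall t, a <= t <= b -> rderiv F t (f t)) -> ccont_on f a b -> CI f a b = (F b - F a)%C.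
Proof.
  intros Hab HF Hf.
  apply injective_projections; simpl; apply (is_RInt_unique (V := R_CompleteNormedModule)).
  1: apply (is_RInt_derive (V := R_CompleteNormedModule) (fun t => fst (F t))).
  3: apply (is_RInt_derive (V := R_CompleteNormedModule) (fun t => snd (F t))).
  all: rewrite Rmin_left, Rmax_right by lra; intros t Ht; first [apply (HF t Ht) | apply (Hf t Ht)].
Qed.

Lemma rderiv_lipschitz (v v' : R -> CC) (a b V : R) : a <= b ->
  (forall t, a <= t <= b -> rderiv v t (v' t)) -> ccont_on v' a b ->
  (forall t, a <= t <= b -> Cmod (v' t) <= V) ->
  forall s t, a <= s <= b -> a <= t <= b -> Cmod (v s - v t) <= V * Rabs (s - t).
Proof.
  intros Hab Hd Hc HV.
  assert (W : forall s t, a <= s <= b -> a <= t <= b -> t <= s -> Cmod (v s - v t) <= V * Rabs (s - t)).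
  { intros s t Hs Ht Hst; rewrite Rabs_pos_eq by lra.
    rewrite <- (CI_derive v v' t s Hst) by (intros x Hx; first [apply Hd | apply Hc]; lra).
    apply CI_bound; [exact Hst | intros x Hx; apply Hc; lra | intros x Hx; apply HV; lra]. }
  intros s t Hs Ht; destruct (Rle_dec t s) as [H|H]; [apply W; assumption|].
  rewrite Cmod_sub_sym, Rabs_minus_sym; apply W; try assumption; lra.
Qed.

(** * Bisection and Goursat's lemma on cones *)

(** The common point is the supremum of the left ends. It serves both the bisection of squares and
    the convergence of the fixed-point iteration. *)
Lemma nested_intervals (u h : nat -> R) : (forall n, 0 <= h n) ->
  (forall n, u n <= u (S n) /\ u (S n) + h (S n) <= u n + h n) ->
  exists U, forall n, u n <= U <= u n + h n.
Proof.
  intros Hh Hu.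
  assert (Hi : forall n m, (n <= m)%nat -> u n <= u m /\ u m + h m <= u n + h n).
  { intros n m Hnm; induction Hnm as [|m Hnm IH]; [lra|]; specialize (Hu m); lra. }
  assert (Hnm : forall n m, u m <= u n + h n).
  { intros n m; destruct (Nat.le_gt_cases n m) as [C|C].
    - specialize (Hi n m C); specialize (Hh m); lra.
    - specialize (Hi m n ltac:(lia)); specialize (Hh n); lra. }
  destruct (completeness (fun r => exists n, r = u n)) as [U [HU1 HU2]].
  - exists (u O + h O); intros r [n ->]; apply Hnm.
  - exists (u O); exists O; reflexivity.
  - exists U; intros n; split.
    + apply HU1; exists n; reflexivity.
    + apply HU2; intros r [m ->]; apply Hnm.
Qed.

Lemma square_bisection (P : R -> R -> R -> Prop) :
  P 0 0 1 ->
  (forall x y h, 0 < h -> P x y h ->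
     exists x' y', x <= x' <= x + h / 2 /\ y <= y' <= y + h / 2 /\ P x' y' (h / 2)) ->
  exists X Y, forall d, 0 < d ->
    exists x y h, P x y h /\ 0 < h < d /\ x <= X <= x + h /\ y <= Y <= y + h.
Proof.
  intros H0 Hstep.
  (* The bisection step is made total, vacuously so on squares without the property, so that choice
     turns it into a function that can be iterated. *)
  assert (Hs : forall q : R * R * R, exists q' : R * R * R,
    let '(x, y, h) := q in let '(x', y', h') := q' in
    0 < h -> P x y h -> x <= x' <= x + h / 2 /\ y <= y' <= y + h / 2 /\ P x' y' h' /\ h' = h / 2).
  { intros [[x y] h].
    destruct (excluded_middle_informative (0 < h /\ P x y h)) as [[Hh HP]|N].
    - destruct (Hstep x y h Hh HP) as [x' [y' [Hx [Hy HP']]]].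
      exists (x', y', h / 2); intros _ _; repeat split; tauto.
    - exists (x, y, h); tauto. }
  pose (next := fun q => proj1_sig (constructive_indefinite_description _ (Hs q))).
  assert (Hn : forall q, let '(x, y, h) := q in let '(x', y', h') := next q in
    0 < h -> P x y h -> x <= x' <= x + h / 2 /\ y <= y' <= y + h / 2 /\ P x' y' h' /\ h' = h / 2)
    by (intros q; exact (proj2_sig (constructive_indefinite_description _ (Hs q)))).
  pose (q := fix q n := match n with O => (0, 0, 1) | S m => next (q m) end).
  pose (x := fun n => fst (fst (q n))).
  pose (y := fun n => snd (fst (q n))).
  pose (h := fun n => snd (q n)).
  assert (Hq : forall n, P (x n) (y n) (h n) /\ h n = (/ 2) ^ n).
  { unfold x, y, h; induction n as [|n [IHP IHh]]; [simpl; auto|].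
    specialize (Hn (q n)); change (q (S n)) with (next (q n)).
    destruct (q n) as [[a b] c]; destruct (next (a, b, c)) as [[a' b'] c']; simpl in *.
    assert (Hc : 0 < c) by (rewrite IHh; apply pow_lt; lra).
    destruct (Hn Hc IHP) as [_ [_ [HP' E]]]; split; [exact HP' | rewrite E, IHh; lra]. }
  assert (Hh : forall n, 0 < h n) by (intros n; rewrite (proj2 (Hq n)); apply pow_lt; lra).
  assert (Hxy : forall n, x n <= x (S n) /\ x (S n) + h (S n) <= x n + h n /\
                          y n <= y (S n) /\ y (S n) + h (S n) <= y n + h n).
  { intros n; specialize (Hn (q n)); specialize (Hh n); destruct (Hq n) as [HP _].
    unfold x, y, h in *; change (q (S n)) with (next (q n)).
    destruct (q n) as [[a b] c]; destruct (next (a, b, c)) as [[a' b'] c']; simpl in *.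
    destruct (Hn Hh HP) as [? [? [_ ->]]]; lra. }
  destruct (nested_intervals x h) as [X HX]; [intros n; left; apply Hh | intros n; specialize (Hxy n); lra|].
  destruct (nested_intervals y h) as [Y HY]; [intros n; left; apply Hh | intros n; specialize (Hxy n); lra|].
  exists X, Y; intros d Hd.
  destruct (pow_lt_1_zero (/ 2)) with (y := d) as [N HN]; [rewrite Rabs_pos_eq; lra | exact Hd |].
  exists (x N), (y N), (h N); repeat split; try apply Hq; try apply Hh; try apply HX; try apply HY.
  rewrite (proj2 (Hq N)); specialize (HN N (Nat.le_refl _)).
  rewrite Rabs_pos_eq in HN; [exact HN | apply pow_le; lra].
Qed.

(** The integral of [k dz] around the image of [[s1, s2] * [t1, t2]] under the cone map
    [(s, t) |-> a + s * v t]; a circle [v] gives sectors and annuli, a segment [v] gives triangles. *)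
Definition arc_int (k : CC -> CC) (a : CC) (v v' : R -> CC) (s t1 t2 : R) : CC :=
  CI (fun t => k (a + s * v t)%C * (s * v' t))%C t1 t2.
Definition ray_int (k : CC -> CC) (a : CC) (v : R -> CC) (t s1 s2 : R) : CC :=
  CI (fun s => k (a + s * v t)%C * v t)%C s1 s2.
Definition contour (k : CC -> CC) (a : CC) (v v' : R -> CC) (s1 s2 t1 t2 : R) : CC :=
  (arc_int k a v v' s2 t1 t2 - arc_int k a v v' s1 t1 t2
   - ray_int k a v t2 s1 s2 + ray_int k a v t1 s1 s2)%C.

Definition ccont_cone (k : CC -> CC) (a : CC) (v : R -> CC) (s1 s2 t1 t2 : R) : Prop :=
  forall s t, s1 <= s <= s2 -> t1 <= t <= t2 -> ccont k (a + s * v t)%C.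

Definition C1_on (v v' : R -> CC) (t1 t2 : R) : Prop :=
  forall t, t1 <= t <= t2 -> rderiv v t (v' t) /\ ccont v' t.

Lemma arc_ccont k a v v' s1 s2 t1 t2 s : ccont_cone k a v s1 s2 t1 t2 -> C1_on v v' t1 t2 ->
  s1 <= s <= s2 -> ccont_on (fun t => k (a + s * v t)%C * (s * v' t))%C t1 t2.
Proof.
  intros Hk Hv Hs t Ht; destruct (Hv t Ht) as [Hd Hc]; apply rderiv_ccont in Hd.
  apply ccont_mult.
  - apply (ccont_comp (fun t => a + s * v t)%C k); [|apply Hk; assumption].
    apply ccont_plus; [apply ccont_const | apply ccont_mult; [apply ccont_const | exact Hd]].
  - apply ccont_mult; [apply ccont_const | exact Hc].
Qed.

Lemma ray_ccont k a v s1 s2 t1 t2 t : ccont_cone k a v s1 s2 t1 t2 ->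
  t1 <= t <= t2 -> ccont_on (fun s => k (a + s * v t)%C * v t)%C s1 s2.
Proof.
  intros Hk Ht s Hs; apply ccont_mult; [|apply ccont_const].
  apply (ccont_comp (fun s : R => a + s * v t)%C k); [|apply Hk; assumption].
  eapply rderiv_ccont, rderiv_line.
Qed.

(** The interior edges are traversed twice, in opposite directions. *)
Lemma contour_split k a v v' s1 s s2 t1 t t2 :
  s1 <= s <= s2 -> t1 <= t <= t2 -> ccont_cone k a v s1 s2 t1 t2 -> C1_on v v' t1 t2 ->
  contour k a v v' s1 s2 t1 t2 =
  (contour k a v v' s1 s t1 t + contour k a v v' s s2 t1 t +
   (contour k a v v' s1 s t t2 + contour k a v v' s s2 t t2))%C.
Proof.
  intros Hs Ht Hk Hv.
  assert (A : forall s', s1 <= s' <= s2 ->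
    arc_int k a v v' s' t1 t2 = (arc_int k a v v' s' t1 t + arc_int k a v v' s' t t2)%C)
    by (intros s' Hs'; apply CI_Chasles; try tauto; eapply arc_ccont; eassumption).
  assert (B : forall t', t1 <= t' <= t2 ->
    ray_int k a v t' s1 s2 = (ray_int k a v t' s1 s + ray_int k a v t' s s2)%C)
    by (intros t' Ht'; apply CI_Chasles; try tauto; eapply ray_ccont; eassumption).
  unfold contour; rewrite !A, !B by lra; ring.
Qed.

Lemma contour_plus k e a v v' s1 s2 t1 t2 : s1 <= s2 -> t1 <= t2 ->
  ccont_cone k a v s1 s2 t1 t2 -> ccont_cone e a v s1 s2 t1 t2 -> C1_on v v' t1 t2 ->
  contour (fun z => k z + e z)%C a v v' s1 s2 t1 t2 =
  (contour k a v v' s1 s2 t1 t2 + contour e a v v' s1 s2 t1 t2)%C.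
Proof.
  intros Hs Ht Hk He Hv.
  assert (A : forall s, s1 <= s <= s2 -> arc_int (fun z => k z + e z)%C a v v' s t1 t2 =
    (arc_int k a v v' s t1 t2 + arc_int e a v v' s t1 t2)%C).
  { intros s Hs'; unfold arc_int; rewrite <- CI_plus by
      first [assumption | eapply arc_ccont; eassumption].
    apply CI_ext; [exact Ht | intros; ring]. }
  assert (B : forall t, t1 <= t <= t2 -> ray_int (fun z => k z + e z)%C a v t s1 s2 =
    (ray_int k a v t s1 s2 + ray_int e a v t s1 s2)%C).
  { intros t Ht'; unfold ray_int; rewrite <- CI_plus by
      first [assumption | eapply ray_ccont; eassumption].
    apply CI_ext; [exact Hs | intros; ring]. }
  unfold contour; rewrite !A, !B by lra; ring.
Qed.

Lemma contour_primitive Phi k a v v' s1 s2 t1 t2 : s1 <= s2 -> t1 <= t2 ->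
  (forall z, cderiv Phi z (k z)) -> ccont_cone k a v s1 s2 t1 t2 -> C1_on v v' t1 t2 ->
  contour k a v v' s1 s2 t1 t2 = 0.
Proof.
  intros Hs Ht HP Hk Hv.
  assert (A : forall s, s1 <= s <= s2 -> arc_int k a v v' s t1 t2 =
    (Phi (a + s * v t2) - Phi (a + s * v t1))%C).
  { intros s Hs'; apply (CI_derive (fun t => Phi (a + s * v t)%C)); [exact Ht | |
      eapply arc_ccont; eassumption].
    intros t Ht'; destruct (Hv t Ht') as [Hd _].
    rewrite Cmult_comm; apply (rderiv_comp (fun t => a + s * v t)%C Phi); [|apply HP].
    replace (s * v' t)%C with (v' t * (0 + (0 * v t + s * 1)))%C by ring.
    apply (rderiv_comp v (fun z => a + s * z)%C); [exact Hd|].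
    apply cderiv_plus; [apply cderiv_const | apply cderiv_mult; [apply cderiv_const | apply cderiv_id]]. }
  assert (B : forall t, t1 <= t <= t2 -> ray_int k a v t s1 s2 =
    (Phi (a + s2 * v t) - Phi (a + s1 * v t))%C).
  { intros t Ht'; apply (CI_derive (fun s => Phi (a + s * v t)%C)); [exact Hs | |
      eapply ray_ccont; eassumption].
    intros s Hs'.
    rewrite Cmult_comm; apply (rderiv_comp (fun s => a + s * v t)%C Phi); [|apply HP].
    apply rderiv_line. }
  unfold contour; rewrite !A, !B by lra; ring.
Qed.

Lemma contour_bound e a v v' s1 s2 t1 t2 E V : 0 <= s1 <= s2 -> t1 <= t2 ->
  ccont_cone e a v s1 s2 t1 t2 -> C1_on v v' t1 t2 ->
  (forall t, t1 <= t <= t2 -> Cmod (v t) <= V /\ Cmod (v' t) <= V) ->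
  (forall s t, s1 <= s <= s2 -> t1 <= t <= t2 -> Cmod (e (a + s * v t)%C) <= E) ->
  Cmod (contour e a v v' s1 s2 t1 t2) <= 2 * E * V * (s2 * (t2 - t1) + (s2 - s1)).
Proof.
  intros Hs Ht He Hv HV HE.
  assert (HV0 : 0 <= V) by (eapply Rle_trans; [apply Cmod_ge_0 | apply (HV t1); lra]).
  assert (HE0 : 0 <= E) by (eapply Rle_trans; [apply Cmod_ge_0 | apply (HE s1 t1); lra]).
  assert (A : forall s, s1 <= s <= s2 -> Cmod (arc_int e a v v' s t1 t2) <= E * (s2 * V) * (t2 - t1)).
  { intros s Hs'; apply CI_bound; [lra | eapply arc_ccont; eassumption |].
    intros t Ht'; rewrite !Cmod_mult, Cmod_R, Rabs_pos_eq by lra.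
    apply Rmult_le_compat; [apply Cmod_ge_0 | | apply HE; assumption |].
    - apply Rmult_le_pos; [lra | apply Cmod_ge_0].
    - apply Rmult_le_compat; [lra | apply Cmod_ge_0 | lra | apply HV, Ht']. }
  assert (B : forall t, t1 <= t <= t2 -> Cmod (ray_int e a v t s1 s2) <= E * V * (s2 - s1)).
  { intros t Ht'; apply CI_bound; [lra | eapply ray_ccont; eassumption |].
    intros s Hs'; rewrite Cmod_mult.
    apply Rmult_le_compat; [apply Cmod_ge_0 .. | apply HE; assumption | apply HV, Ht']. }
  unfold contour.
  eapply Rle_trans; [apply Cmod_triangle|].
  eapply Rle_trans; [apply Rplus_le_compat_r, Cmod_triangle_sub|].
  eapply Rle_trans; [apply Rplus_le_compat_r, Rplus_le_compat_r, Cmod_triangle_sub|].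
  assert (A1 := A s1); assert (A2 := A s2); assert (B1 := B t1); assert (B2 := B t2).
  specialize (A1 ltac:(lra)); specialize (A2 ltac:(lra)).
  specialize (B1 ltac:(lra)); specialize (B2 ltac:(lra)). nra.
Qed.

(** Bisection takes place in the parameter rectangle, not in its image. On the selected subsquares
    of side [h] the integral stays at least [m h^2]. Near the limit point the affine part of [k] has
    a primitive and contributes nothing, and the rest is at most [2 eta W^2 h^2]. The case [s1 = 0],
    where the cone reaches its vertex, is included and gives triangles. *)
Lemma Goursat k a v v' s1 s2 t1 t2 V : 0 <= s1 <= s2 -> t1 <= t2 ->
  C1_on v v' t1 t2 ->
  (forall t, t1 <= t <= t2 -> Cmod (v t) <= V /\ Cmod (v' t) <= V) ->
  (forall s t, s1 <= s <= s2 -> t1 <= t <= t2 -> exists l, cderiv k (a + s * v t)%C l) ->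
  contour k a v v' s1 s2 t1 t2 = 0.
Proof.
  intros Hs Ht Hv HV Hk.
  assert (HV0 : 0 <= V) by (eapply Rle_trans; [apply Cmod_ge_0 | apply (HV t1); lra]).
  assert (Hc : ccont_cone k a v s1 s2 t1 t2)
    by (intros s t Hs' Ht'; destruct (Hk s t Hs' Ht') as [l Hl]; eapply cderiv_ccont, Hl).
  pose (m := Cmod (contour k a v v' s1 s2 t1 t2)).
  destruct (Rle_lt_or_eq_dec 0 m (Cmod_ge_0 _)) as [Hm|Hm];
    [exfalso | apply Cmod_eq_0; symmetry; exact Hm].
  pose (A := s2 - s1); pose (B := t2 - t1).
  assert (HA : 0 <= A) by (unfold A; lra); assert (HB : 0 <= B) by (unfold B; lra).
  (* The contour over the subsquare with corner [(x, y)] and side [h], in coordinates that make the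
     parameter rectangle the unit square. *)
  pose (G := fun x y h => contour k a v v' (s1 + x * A) (s1 + (x + h) * A) (t1 + y * B) (t1 + (y + h) * B)).
  assert (Sub : forall (x h : R), 0 <= x -> 0 <= h -> x + h <= 1 -> forall c C r : R, 0 <= C ->
    c + x * C <= r <= c + (x + h) * C -> c <= r <= c + C).
  { intros x h Hx Hh Hxh c C r HC Hr; nra. }
  assert (Hsub : forall x y h, 0 <= x -> 0 <= y -> 0 <= h -> x + h <= 1 -> y + h <= 1 ->
     ccont_cone k a v (s1 + x * A) (s1 + (x + h) * A) (t1 + y * B) (t1 + (y + h) * B) /\
     C1_on v v' (t1 + y * B) (t1 + (y + h) * B)).
  { intros x y h Hx Hy Hh Hxh Hyh; split.
    - intros s t Hs' Ht'; apply Hc.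
      + replace s2 with (s1 + A) by (unfold A; ring); eapply (Sub x h); eassumption.
      + replace t2 with (t1 + B) by (unfold B; ring); eapply (Sub y h); eassumption.
    - intros t Ht'; apply Hv.
      replace t2 with (t1 + B) by (unfold B; ring); eapply (Sub y h); eassumption. }
  destruct (square_bisection (fun x y h =>
    0 <= x /\ 0 <= y /\ x + h <= 1 /\ y + h <= 1 /\ m * h ^ 2 <= Cmod (G x y h))) as [X [Y HXY]].
  - repeat split; try lra.
    unfold G, A, B.
    replace (s1 + 0 * (s2 - s1)) with s1 by ring.
    replace (s1 + (0 + 1) * (s2 - s1)) with s2 by ring.
    replace (t1 + 0 * (t2 - t1)) with t1 by ring.
    replace (t1 + (0 + 1) * (t2 - t1)) with t2 by ring.
    fold m; lra.
  - intros x y h Hh [Hx [Hy [Hxh [Hyh HG]]]].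
    destruct (Hsub x y h) as [C1 C2]; try lra.
    assert (E : G x y h = Cplus (Cplus (G x y (h / 2)) (G (x + h / 2) y (h / 2)))
       (Cplus (G x (y + h / 2) (h / 2)) (G (x + h / 2) (y + h / 2) (h / 2)))).
    { unfold G; rewrite (contour_split _ _ _ _ _ (s1 + (x + h / 2) * A) _ _ (t1 + (y + h / 2) * B));
        try assumption; try (split; nra).
      replace (x + h / 2 + h / 2) with (x + h) by field.
      replace (y + h / 2 + h / 2) with (y + h) by field; reflexivity. }
    rewrite E in HG.
    assert (T1 := Cmod_triangle (Cplus (G x y (h / 2)) (G (x + h / 2) y (h / 2)))
       (Cplus (G x (y + h / 2) (h / 2)) (G (x + h / 2) (y + h / 2) (h / 2)))).
    assert (T2 := Cmod_triangle (G x y (h / 2)) (G (x + h / 2) y (h / 2))).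
    assert (T3 := Cmod_triangle (G x (y + h / 2) (h / 2)) (G (x + h / 2) (y + h / 2) (h / 2))).
    (* By the triangle inequality one quarter carries at least a quarter of the integral. *)
    destruct (Rle_dec (m * (h / 2) ^ 2) (Cmod (G x y (h / 2)))) as [D|D];
      [exists x, y; repeat split; try lra; exact D|].
    destruct (Rle_dec (m * (h / 2) ^ 2) (Cmod (G (x + h / 2) y (h / 2)))) as [D1|D1];
      [exists (x + h / 2), y; repeat split; try lra; exact D1|].
    destruct (Rle_dec (m * (h / 2) ^ 2) (Cmod (G x (y + h / 2) (h / 2)))) as [D2|D2];
      [exists x, (y + h / 2); repeat split; try lra; exact D2|].
    exists (x + h / 2), (y + h / 2); repeat split; try lra.
  (* In a subsquare of side [h] that contains the limit point, the image stays within [W h] of [z0],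
     and the integral is at most [2 W h] times the maximum of the integrand. *)
  - pose (W := V * (A + s2 * B)).
    assert (HW : 0 <= W) by (unfold W; apply Rmult_le_pos; nra).
    assert (Hin : 0 <= X <= 1 /\ 0 <= Y <= 1).
    { destruct (HXY 1 Rlt_0_1) as [x [y [h [H1 [H2 [H3 H4]]]]]]; lra. }
    pose (S := s1 + X * A); pose (T := t1 + Y * B).
    assert (HS : s1 <= S <= s2) by (unfold S, A in *; nra).
    assert (HT : t1 <= T <= t2) by (unfold T, B in *; nra).
    pose (z0 := (a + S * v T)%C).
    destruct (Hk S T HS HT) as [l Hl]; fold z0 in Hl.
    (* This gives [2 eta W^2 < m]; the added 1 covers [W = 0]. *)
    pose (eta := m / (2 * W ^ 2 + 1) / 2).
    assert (HW2 : 0 < 2 * W ^ 2 + 1) by nra.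
    assert (Heta : 0 < eta)
      by (unfold eta; apply Rdiv_lt_0_compat; [apply Rdiv_lt_0_compat; assumption | lra]).
    destruct (proj1 (locally_C_iff _ _) (proj1 (cderiv_eps _ _ _) Hl eta Heta)) as [d [Hd He]].
    destruct (HXY (d / (W + 1))) as [x [y [h [[Hx [Hy [Hxh [Hyh HG]]]] [Hh [HX HY]]]]]];
      [apply Rdiv_lt_0_compat; lra|].
    destruct (Hsub x y h) as [C1 C2]; try lra.
    pose (aff := fun z => (k z0 + (z - z0) * l)%C).
    pose (e := fun z => (k z - aff z)%C).
    assert (Haff : forall z, ccont aff z).
    { intros z; apply ccont_plus; [apply ccont_const|]; apply ccont_mult; [|apply ccont_const].
      apply ccont_minus; [apply ccont_id | apply ccont_const]. }
    assert (EG : G x y h = contour e a v v' (s1 + x * A) (s1 + (x + h) * A) (t1 + y * B) (t1 + (y + h) * B)).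
    { transitivity (contour (fun z => e z + aff z)%C a v v' (s1 + x * A) (s1 + (x + h) * A) (t1 + y * B) (t1 + (y + h) * B)).
      - unfold G, contour, arc_int, ray_int.
        assert (Ek : forall z, (e z + aff z = k z)%C) by (intros z; unfold e; ring).
        f_equal; [f_equal; [f_equal|]|]; apply CI_ext; try nra; intros; rewrite Ek; reflexivity.
      - rewrite contour_plus; try assumption; try nra.
        + rewrite (contour_primitive (fun z => (k z0 * z + (z - z0) * (z - z0) * l / 2)%C) aff);
            try assumption; try nra; [ring | | intros s t _ _; apply Haff].
          intros z; unfold aff.
          cderiv_calc; field; intros E; apply RtoC_inj in E; lra.
        + intros s t Hs' Ht'; apply ccont_minus; [apply C1; assumption | apply Haff].
        + intros s t _ _; apply Haff. }
    assert (Hb : Cmod (G x y h) <= 2 * (eta * (W * h)) * V *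
       ((s1 + (x + h) * A) * ((t1 + (y + h) * B) - (t1 + y * B)) + ((s1 + (x + h) * A) - (s1 + x * A)))).
    { rewrite EG; apply contour_bound; try assumption; try nra.
      - intros s t Hs' Ht'; apply ccont_minus; [apply C1; assumption | apply Haff].
      - intros t Ht'; apply HV.
        replace t2 with (t1 + B) by (unfold B; ring); eapply (Sub y h); eassumption || lra.
      - intros s t Hs' Ht'.
        assert (Hs2 : s1 <= s <= s2)
          by (replace s2 with (s1 + A) by (unfold A; ring); eapply (Sub x h); eassumption || lra).
        assert (Ht2 : t1 <= t <= t2)
          by (replace t2 with (t1 + B) by (unfold B; ring); eapply (Sub y h); eassumption || lra).
        assert (Hz : Cmod (a + s * v t - z0)%C <= W * h).
        { unfold z0.
          replace (a + s * v t - (a + S * v T))%C with (s * (v t - v T) + (s - S) * v T)%C by ring.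
          eapply Rle_trans; [apply Cmod_triangle|].
          rewrite !Cmod_mult, <- RtoC_minus, !Cmod_R, (Rabs_pos_eq s) by lra.
          assert (L1 : Cmod (v t - v T) <= V * (B * h)).
          { eapply Rle_trans; [apply (rderiv_lipschitz v v' t1 t2 V); try assumption|].
            - intros r Hr; apply Hv, Hr.
            - intros r Hr; apply Hv, Hr.
            - intros r Hr; apply HV, Hr.
            - apply Rmult_le_compat_l; [exact HV0|].
              unfold T; apply Rabs_le; nra. }
          assert (L2 : Rabs (s - S) <= A * h) by (unfold S; apply Rabs_le; nra).
          assert (L3 : Cmod (v T) <= V) by (apply HV, HT).
          assert (L4 : s * Cmod (v t - v T) <= s2 * (V * (B * h)))
            by (apply Rmult_le_compat; [lra | apply Cmod_ge_0 | lra | exact L1]).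
          assert (L5 : Rabs (s - S) * Cmod (v T) <= A * h * V)
            by (apply Rmult_le_compat; [apply Rabs_pos | apply Cmod_ge_0 | exact L2 | exact L3]).
          unfold W; lra. }
        unfold e, aff.
        replace (k (a + s * v t)%C - (k z0 + (a + s * v t - z0) * l))%C
          with (k (a + s * v t)%C - k z0 - (a + s * v t - z0) * l)%C by ring.
        eapply Rle_trans; [apply He|].
        + eapply Rle_lt_trans; [exact Hz|].
          destruct Hh as [Hh1 Hh2]; apply Rlt_div_r in Hh2; [|lra]. nra.
        + apply Rmult_le_compat_l; [lra | exact Hz]. }
    assert (Hfin : Cmod (G x y h) <= 2 * eta * W ^ 2 * h ^ 2).
    { eapply Rle_trans; [exact Hb|].
      replace (2 * eta * W ^ 2 * h ^ 2) with (2 * (eta * (W * h)) * V * (h * A + h * (s2 * B)))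
        by (unfold W; ring).
      apply Rmult_le_compat_l.
      - apply Rmult_le_pos; [|exact HV0].
        apply Rmult_le_pos; [lra | apply Rmult_le_pos; [lra | apply Rmult_le_pos; lra]].
      - assert (s1 + (x + h) * A <= s2) by (unfold A in *; nra).
        assert (0 <= h * B) by (apply Rmult_le_pos; lra). nra. }
    assert (Hlt : 2 * eta * W ^ 2 < m).
    { unfold eta.
      replace (2 * (m / (2 * W ^ 2 + 1) / 2) * W ^ 2) with (m * (W ^ 2 / (2 * W ^ 2 + 1))) by (field; lra).
      assert (W ^ 2 / (2 * W ^ 2 + 1) < 1) by (apply Rlt_div_l; nra). nra. }
    assert (0 < h ^ 2) by (apply pow_lt; lra). nra.
Qed.

(** * Cauchy's integral formula *)


Definition circ (r t : R) : CC := (r * cos t, r * sin t).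

Lemma Cmod_circ (r t : R) : 0 <= r -> Cmod (circ r t) = r.
Proof.
  intros Hr; unfold Cmod, circ; simpl fst; simpl snd.
  replace ((r * cos t) ^ 2 + (r * sin t) ^ 2) with (r ^ 2).
  - apply sqrt_pow2, Hr.
  - assert (E := sin2_cos2 t); unfold Rsqr in E.
    transitivity (r ^ 2 * (sin t * sin t + cos t * cos t)); [rewrite E|]; ring.
Qed.

Lemma circ_neq (r t : R) (z : CC) : Cmod z < r -> (circ r t - z)%C <> 0.
Proof.
  intros Hz E.
  assert (H := Cmod_triangle_inv (circ r t) z).
  rewrite E, Cmod_0, Cmod_circ in H by (generalize (Cmod_ge_0 z); lra); lra.
Qed.

Lemma circ_neq_0 (r t : R) : 0 < r -> circ r t <> 0.
Proof.
  intros Hr; apply Cmod_gt_0; rewrite Cmod_circ; lra.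
Qed.

Lemma rderiv_circ (r t : R) : rderiv (circ r) t (Ci * circ r t)%C.
Proof. split; unfold circ; simpl; auto_derive; auto; ring. Qed.

Lemma ccont_circ (r t : R) : ccont (circ r) t.
Proof. eapply rderiv_ccont, rderiv_circ. Qed.

Lemma circ_conj (r t : R) : 0 < r -> Cconj (circ r t) = (RtoC r ^ 2 / circ r t)%C.
Proof.
  intros Hr; assert (N := circ_neq_0 r t Hr).
  assert (E := Cmod2_conj (circ r t)).
  rewrite Cmod_circ, RtoC_pow in E by lra; rewrite E; field; exact N.
Qed.

Ltac ccont_step := match goal with
  | H : ccont ?f ?x |- ccont ?f ?x => exact H
  | H : forall n t, ccont (?f n) t |- ccont (?f ?n) ?x => exact (H n x)
  | H : forall t, ccont ?f t |- ccont ?f ?x => exact (H x)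
  | H : forall n t, ccont (?f n) t |- ccont (fun t => ?f ?n t) ?x => exact (H n x)
  | H : forall t, ccont ?f t |- ccont (fun t => ?f t) ?x => exact (H x)
  | |- ccont (fun _ => ?c) _ => apply ccont_const
  | |- ccont (fun t => circ ?r t) _ => apply ccont_circ
  | |- ccont (fun t => Cdiv (@?f t) (@?g t)) _ => apply (ccont_div f g)
  | |- ccont (fun t => Cminus (@?f t) (@?g t)) _ => apply (ccont_minus f g)
  | |- ccont (fun t => Cplus (@?f t) (@?g t)) _ => apply (ccont_plus f g)
  | |- ccont (fun t => Cmult (@?f t) (@?g t)) _ => apply (ccont_mult f g)
  | |- ccont (fun t => Cconj (@?f t)) _ => apply (ccont_conj f)
  | |- ccont (fun t => Copp (@?f t)) _ => apply (ccont_opp f)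
  | |- ccont (fun t => Cinv (@?f t)) _ => apply (ccont_inv f)
  | |- ccont (fun t => Cpow (@?f t) ?n) _ => apply (ccont_pow f n)
  end.
Ltac circ_continuity := repeat ccont_step.

Lemma is_zero_of_small (z : CC) (K d : R) : 0 < d ->
  (forall e, 0 < e < d -> Cmod z <= e * K) -> z = 0.
Proof.
  intros Hd H; apply Cmod_eq_0.
  destruct (Rle_lt_or_eq_dec 0 (Cmod z) (Cmod_ge_0 z)) as [P|P]; [exfalso|symmetry; exact P].
  assert (HK : 0 < K) by (specialize (H (d / 2)); specialize (H ltac:(lra)); nra).
  assert (He : 0 < Rmin d (Cmod z / K)) by (apply Rmin_pos; [exact Hd | apply Rdiv_lt_0_compat; lra]).
  specialize (H (Rmin d (Cmod z / K) / 2)).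
  assert (H1 := Rmin_l d (Cmod z / K)); assert (H2 := Rmin_r d (Cmod z / K)).
  specialize (H ltac:(lra)).
  assert (Rmin d (Cmod z / K) * K <= Cmod z) by (apply Rle_div_r; [exact HK | exact H2]).
  lra.
Qed.

Lemma PI2_pos : 0 <= 2 * PI.
Proof. generalize PI_RGT_0; lra. Qed.

(** On a closed circle the rays at [t = 0] and [t = 2 pi] coincide and cancel, which leaves the two
    arcs. With [a = b] the curve is the circle about 0 for [s = 1] and contracts to [a] as [s] tends
    to 0. *)
Lemma arc_circle_invariant (k : CC -> CC) (a b : CC) (r s1 s2 : R) : 0 < r -> 0 < s1 <= s2 ->
  (forall s t, s1 <= s <= s2 -> exists l, cderiv k (a + s * (circ r t - b))%C l) ->
  arc_int k a (fun t => circ r t - b)%C (fun t => Ci * circ r t)%C s1 0 (2 * PI) =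
  arc_int k a (fun t => circ r t - b)%C (fun t => Ci * circ r t)%C s2 0 (2 * PI).
Proof.
  intros Hr Hs Hk.
  assert (G := Goursat k a (fun t => circ r t - b)%C (fun t => Ci * circ r t)%C s1 s2 0 (2 * PI)
     (r + Cmod b) ltac:(lra) PI2_pos).
  unfold contour in G.
  replace (ray_int k a (fun t => circ r t - b)%C 0 s1 s2)
    with (ray_int k a (fun t => circ r t - b)%C (2 * PI) s1 s2) in G
    by (unfold ray_int, circ; rewrite cos_2PI, sin_2PI, cos_0, sin_0; reflexivity).
  set (X := arc_int k a _ _ s1 _ _) in *; set (Y := arc_int k a _ _ s2 _ _) in *.
  set (Z := ray_int _ _ _ _ _ _) in *.
  assert (G' : (Y - X - Z + Z)%C = 0).
  { apply G.
    - intros t _; split.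
      + replace (Ci * circ r t)%C with (Ci * circ r t * (1 + 0))%C by ring.
        apply (rderiv_comp (circ r) (fun z => z + - b)%C); [apply rderiv_circ|].
        apply cderiv_plus; [apply cderiv_id | apply cderiv_const].
      + circ_continuity.
    - intros t _; assert (H0 := Cmod_ge_0 b); split.
      + eapply Rle_trans; [apply Cmod_triangle_sub|]; rewrite Cmod_circ; lra.
      + rewrite Cmod_mult, Cmod_Ci, Cmod_circ; lra.
    - intros s t Hs' _; apply Hk, Hs'. }
  replace X with (Y - (Y - X - Z + Z))%C by ring; rewrite G'; ring.
Qed.

(** * Means over a circle *)

(** On [z = circ r t] one has [dz = i z dt], so [1 / (2 pi i)] times the integral of [k dz] is the
    mean of [k z]. Cauchy integrals are written in this form from here on. *)
Definition cmean (F : R -> CC) : CC := (CI F 0 (2 * PI) / (2 * PI))%C.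

Lemma RtoC_2PI_neq : (2 * PI)%C <> 0.
Proof. rewrite <- RtoC_mult; intros E; apply RtoC_inj in E; generalize PI_RGT_0; lra. Qed.

Lemma RtoC_PI_neq : RtoC PI <> 0.
Proof. intros E; apply RtoC_inj in E; generalize PI_RGT_0; lra. Qed.

Lemma cmean_ext (F G : R -> CC) : (forall t, F t = G t) -> cmean F = cmean G.
Proof. intros H; unfold cmean; f_equal; apply CI_ext; [apply PI2_pos | auto]. Qed.

Lemma cmean_plus (F G : R -> CC) : (forall t, ccont F t) -> (forall t, ccont G t) ->
  cmean (fun t => F t + G t)%C = (cmean F + cmean G)%C.
Proof.
  intros HF HG; unfold cmean; rewrite CI_plus by (first [apply PI2_pos | intros t _; auto]).
  field; apply RtoC_PI_neq.
Qed.

Lemma cmean_scal (c : CC) (F : R -> CC) : (forall t, ccont F t) ->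
  cmean (fun t => c * F t)%C = (c * cmean F)%C.
Proof.
  intros HF; unfold cmean; rewrite CI_scal by (first [apply PI2_pos | intros t _; auto]).
  field; apply RtoC_PI_neq.
Qed.

Lemma cmean_const (c : CC) : cmean (fun _ => c) = c.
Proof.
  unfold cmean; rewrite CI_const, RtoC_mult; field; apply RtoC_PI_neq.
Qed.

(** The majorant stays a complex mean, so that the algebra of [cmean] can evaluate it, as in
    [cmean_quad_sqr]. *)
Lemma cmean_bound_mean (F G : R -> CC) (phi : R -> R) :
  (forall t, ccont F t) -> (forall t, ccont G t) -> (forall t, G t = phi t) ->
  (forall t, Cmod (F t) <= phi t) -> Cmod (cmean F) <= Cmod (cmean G).
Proof.
  intros HF HG E H; unfold cmean.
  rewrite !Cmod_div by apply RtoC_2PI_neq.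
  apply Rmult_le_compat_r.
  { left; apply Rinv_0_lt_compat, Cmod_gt_0, RtoC_2PI_neq. }
  assert (Ephi : forall t, phi t = fst (G t)) by (intros t; rewrite E; reflexivity).
  eapply Rle_trans; [|apply Re_le_Cmod]; simpl.
  apply CI_bound_fun; [apply PI2_pos | intros t _; auto | |].
  - apply (ccont_on_ex_RInt G); [apply PI2_pos | intros t _; auto].
  - intros t _; rewrite <- Ephi; auto.
Qed.

Lemma cmean_bound (F : R -> CC) (M : R) : (forall t, ccont F t) ->
  (forall t, Cmod (F t) <= M) -> Cmod (cmean F) <= M.
Proof.
  intros HF H.
  assert (HM : 0 <= M) by (eapply Rle_trans; [apply Cmod_ge_0 | apply (H 0)]).
  rewrite <- (Rabs_pos_eq M HM), <- Cmod_R, <- (cmean_const M).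
  apply (cmean_bound_mean F (fun _ => RtoC M) (fun _ => M)); auto; intros t; apply ccont_const.
Qed.

(** The mean of [|H|] plays the part of a maximum over the circle, which spares a compactness
    argument. *)
Lemma cmean_bound_scal (F H : R -> CC) (M : R) : 0 <= M -> (forall t, ccont F t) ->
  (forall t, ccont H t) -> (forall t, Cmod (F t) <= M * Cmod (H t)) ->
  Cmod (cmean F) <= M * Cmod (cmean (fun t => Cmod (H t))).
Proof.
  intros HM HF HH Hb.
  rewrite <- (Rabs_pos_eq M HM), <- (Cmod_R M), <- Cmod_mult, <- cmean_scal
    by (intros t; apply ccont_RtoC, continuous_Cmod, HH).
  apply (cmean_bound_mean F _ (fun t => M * Cmod (H t))); auto.
  - intros t; apply ccont_mult; [apply ccont_const | apply ccont_RtoC, continuous_Cmod, HH].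
  - intros t; rewrite RtoC_mult; reflexivity.
Qed.

Lemma cmean_conj (F : R -> CC) : (forall t, ccont F t) ->
  cmean (fun t => Cconj (F t)) = Cconj (cmean F).
Proof.
  intros HF; unfold cmean.
  rewrite Cdiv_conj by apply RtoC_2PI_neq.
  f_equal.
  - unfold CI, Cconj; simpl; f_equal.
    apply (RInt_opp (V := R_CompleteNormedModule)).
    apply (ccont_on_ex_RInt F); [apply PI2_pos | intros t _; auto].
  - apply injective_projections; simpl; ring.
Qed.

(** The mean does not change when the circle is blown up to infinity. *)
Lemma cmean_kernel (r : R) (a : CC) : Cmod a < r ->
  cmean (fun t => circ r t / (circ r t - a))%C = 1.
Proof.
  intros Ha.
  assert (Hr : 0 < r) by (generalize (Cmod_ge_0 a); lra).
  pose (F := fun (s : R) t => (s * circ r t / (s * circ r t - a))%C).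
  assert (Hn : forall s t, 1 <= s -> r * s - Cmod a <= Cmod (s * circ r t - a)).
  { intros s t Hs; assert (H := Cmod_triangle_inv (s * circ r t) a).
    rewrite Cmod_mult, Cmod_R, Rabs_pos_eq, Cmod_circ in H by lra; lra. }
  assert (Hn0 : forall s t, 1 <= s -> (s * circ r t - a)%C <> 0).
  { intros s t Hs; apply Cmod_gt_0; specialize (Hn s t Hs); nra. }
  assert (HF : forall s t, 1 <= s -> ccont (F s) t)
    by (intros s t Hs; unfold F; circ_continuity; apply Hn0, Hs).
  assert (Inv : forall s, 1 <= s -> cmean (F s) = cmean (F 1)).
  { intros s Hs.
    assert (A := arc_circle_invariant (fun z => / (z - a))%C 0 0 r 1 s Hr ltac:(lra)).
    assert (E : forall s', 1 <= s' -> arc_int (fun z => / (z - a))%C 0 (fun t => circ r t - 0)%C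
        (fun t => Ci * circ r t)%C s' 0 (2 * PI) = (Ci * CI (F s') 0 (2 * PI))%C).
    { intros s' Hs'; rewrite <- CI_scal by (first [apply PI2_pos | intros t _; auto]).
      apply CI_ext; [apply PI2_pos|]; intros t _; unfold F.
      replace (0 + s' * (circ r t - 0) - a)%C with (s' * circ r t - a)%C by ring.
      field; apply Hn0, Hs'. }
    rewrite !E in A by lra; unfold cmean; f_equal.
    replace (CI (F s) 0 (2 * PI)) with (- (Ci * (Ci * CI (F s) 0 (2 * PI))))%C
      by (apply injective_projections; simpl; ring).
    rewrite <- A; [apply injective_projections; simpl; ring|].
    intros s' t Hs'.
    eexists; apply (cderiv_inv (fun z => z + - a)%C);
      [apply cderiv_plus; [apply cderiv_id | apply cderiv_const]|].
    replace (0 + s' * (circ r t - 0) + - a)%C with (s' * circ r t - a)%C by ring.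
    apply Hn0; lra. }
  transitivity (cmean (F 1)).
  { apply cmean_ext; intros t; unfold F; rewrite Cmult_1_l; reflexivity. }
  apply Ceq_minus, (is_zero_of_small _ (Cmod a / (r - Cmod a)) 1 Rlt_0_1).
  intros e He.
  assert (He1 : 1 <= / e) by (rewrite <- Rinv_1; apply Rinv_le_contravar; lra).
  rewrite <- (Inv (/ e) He1).
  replace (cmean (F (/ e)%R) - 1)%C with (cmean (fun t => F (/ e)%R t + - (1)))%C.
  2:{ rewrite cmean_plus, cmean_const; [ring | intros t; apply HF, He1 | intros t; apply ccont_const]. }
  apply cmean_bound.
  { intros t; apply ccont_plus; [apply HF, He1 | apply ccont_const]. }
  intros t; unfold F.
  assert (N := Hn0 (/ e) t He1).
  replace (RtoC (/ e) * circ r t / (RtoC (/ e) * circ r t - a) + - (1))%C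
    with (a / (RtoC (/ e) * circ r t - a))%C by (field; exact N).
  rewrite Cmod_div by exact N.
  assert (H := Hn (/ e) t He1).
  replace (e * (Cmod a / (r - Cmod a))) with (Cmod a * / ((r - Cmod a) / e)) by (field; lra).
  apply Rmult_le_compat_l; [apply Cmod_ge_0|].
  apply Rinv_le_contravar; [apply Rdiv_lt_0_compat; lra|].
  eapply Rle_trans; [|exact H].
  assert (Cmod a <= Cmod a * / e) by (generalize (Cmod_ge_0 a); nra).
  unfold Rdiv; lra.
Qed.

Definition holo_le (h : CC -> CC) (r : R) : Prop :=
  forall z, Cmod z <= r -> exists l, cderiv h z l.

Lemma holo_le_circ (h : CC -> CC) (r : R) : 0 <= r -> holo_le h r ->
  forall t, ccont (fun t => h (circ r t)) t.
Proof.
  intros Hr Hh t; apply (ccont_comp (circ r) h); [apply ccont_circ|].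
  destruct (Hh (circ r t)) as [l Hl]; [rewrite Cmod_circ; lra|].
  eapply cderiv_ccont, Hl.
Qed.

(** The homothety of centre [a] and ratio [s] shrinks the circle without changing the integral. As
    [s] tends to 0 the values of [h] tend to [h a], and [cmean_kernel] evaluates what remains. *)
Lemma Cauchy_formula (h : CC -> CC) (r : R) (a : CC) : holo_le h r -> Cmod a < r ->
  cmean (fun t => h (circ r t) * (circ r t / (circ r t - a)))%C = h a.
Proof.
  intros Hh Ha.
  assert (Hr : 0 < r) by (generalize (Cmod_ge_0 a); lra).
  pose (v := fun t => (circ r t - a)%C).
  assert (Hv : forall t, v t <> 0) by (intros t; apply circ_neq, Ha).
  assert (Hin : forall s t, 0 <= s <= 1 -> Cmod (a + s * v t) <= r).
  { intros s t Hs; unfold v.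
    replace (a + s * (circ r t - a))%C with (RtoC (1 - s) * a + s * circ r t)%C
      by (rewrite RtoC_minus; ring).
    eapply Rle_trans; [apply Cmod_triangle|].
    rewrite !Cmod_mult, !Cmod_R, !Rabs_pos_eq, Cmod_circ by lra; nra. }
  pose (F := fun (s : R) t => (h (a + s * v t) * (circ r t / v t))%C).
  assert (HF : forall s t, 0 <= s <= 1 -> ccont (F s) t).
  { intros s t Hs; unfold F; apply ccont_mult.
    - apply (ccont_comp (fun t => a + s * v t)%C h); [unfold v; circ_continuity|].
      destruct (Hh _ (Hin s t Hs)) as [l Hl]; eapply cderiv_ccont, Hl.
    - unfold v; circ_continuity; apply Hv. }
  assert (Inv : forall s, 0 < s <= 1 -> cmean (F s) = cmean (F 1)).
  { intros s Hs.
    assert (A := arc_circle_invariant (fun z => h z * / (z - a))%C a a r s 1 Hr ltac:(lra)).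
    assert (E : forall s', 0 < s' <= 1 -> arc_int (fun z => h z * / (z - a))%C a (fun t => circ r t - a)%C
        (fun t => Ci * circ r t)%C s' 0 (2 * PI) = (Ci * CI (F s') 0 (2 * PI))%C).
    { intros s' Hs'; rewrite <- CI_scal
        by (first [apply PI2_pos | intros t _; apply HF; lra]).
      apply CI_ext; [apply PI2_pos|]; intros t _; unfold F; fold (v t).
      assert (N : RtoC s' <> 0) by (intros N; apply RtoC_inj in N; lra).
      replace (a + s' * v t - a)%C with (s' * v t)%C by ring.
      field; split; [apply Hv | exact N]. }
    rewrite !E in A by lra; unfold cmean; f_equal.
    replace (CI (F s) 0 (2 * PI)) with (- (Ci * (Ci * CI (F s) 0 (2 * PI))))%C
      by (apply injective_projections; simpl; ring).
    rewrite A; [apply injective_projections; simpl; ring|].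
    intros s' t Hs'; fold (v t).
    destruct (Hh _ (Hin s' t ltac:(lra))) as [l Hl].
    eexists; apply cderiv_mult; [exact Hl|].
    apply (cderiv_inv (fun z => z + - a)%C);
      [apply cderiv_plus; [apply cderiv_id | apply cderiv_const]|].
    replace (a + s' * v t + - a)%C with (s' * v t)%C by ring.
    apply Cmult_neq_0; [intros N; apply RtoC_inj in N; lra | apply Hv]. }
  transitivity (cmean (F 1)).
  { apply cmean_ext; intros t; unfold F, v; f_equal; f_equal; ring. }
  pose (K := fun t => (circ r t / v t)%C).
  assert (HK : forall t, ccont K t) by (intros t; unfold K, v; circ_continuity; apply Hv).
  assert (E0 : h a = cmean (fun t => h a * K t)%C).
  { rewrite cmean_scal by exact HK; unfold K, v; rewrite cmean_kernel by exact Ha; ring. }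
  apply Ceq_minus, (is_zero_of_small _ (Cmod (cmean (fun t => Cmod (K t)))) 1 Rlt_0_1).
  intros e He.
  destruct (Hh a ltac:(lra)) as [l Hl].
  destruct (proj1 (locally_C_iff _ _) (proj1 (ccont_eps _ _) (cderiv_ccont _ _ _ Hl) e (proj1 He)))
    as [d [Hd Hcont]].
  (* Since [|circ r t - a| <= 2 r], the shrunken circle lies within [d / 2] of [a]. *)
  pose (s := Rmin 1 (d / (4 * r))).
  assert (Hs : 0 < s <= 1).
  { unfold s; split; [apply Rmin_pos; [lra | apply Rdiv_lt_0_compat; lra] | apply Rmin_l]. }
  assert (Hs2 : s * (4 * r) <= d) by (apply Rle_div_r; [lra | apply Rmin_r]).
  rewrite <- (Inv s Hs), E0.
  replace (cmean (F s) - cmean (fun t => h a * K t))%C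
    with (cmean (fun t => F s t + (- (1)) * (h a * K t)))%C.
  2:{ rewrite cmean_plus, (cmean_scal (- (1))); [ring | | |].
      - intros t; circ_continuity; apply HK.
      - intros t; apply HF; lra.
      - intros t; circ_continuity; apply HK. }
  apply cmean_bound_scal; [lra | | exact HK |].
  - intros t; apply ccont_plus; [apply HF; lra | circ_continuity; apply HK].
  - intros t; unfold F; fold (K t).
    replace (h (a + s * v t) * K t + - (1) * (h a * K t))%C
      with ((h (a + s * v t)%C - h a) * K t)%C by ring.
    rewrite Cmod_mult; apply Rmult_le_compat_r; [apply Cmod_ge_0|].
    left; apply Hcont.
    replace (a + s * v t - a)%C with (s * v t)%C by ring.
    rewrite Cmod_mult, Cmod_R, Rabs_pos_eq by lra.
    assert (Cmod (v t) <= 2 * r).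
    { unfold v; eapply Rle_trans; [apply Cmod_triangle_sub|]; rewrite Cmod_circ; lra. }
    nra.
Qed.

(** * Taylor expansions *)


(** Cauchy's integral for the [n]-th Taylor coefficient. Its independence of [r] comes from
    [jet_unique]. *)
Definition tcoef (r : R) (h : CC -> CC) (n : nat) : CC :=
  cmean (fun t => h (circ r t) * (/ circ r t) ^ n)%C.

Fixpoint csum (u : nat -> CC) (n : nat) : CC :=
  match n with O => 0%C | S m => (csum u m + u m)%C end.

Lemma kernel_ccont (r : R) (h : CC -> CC) (z : CC) (n : nat) (t : R) : holo_le h r -> Cmod z < r ->
  ccont (fun t => h (circ r t) * ((/ circ r t) ^ n * (circ r t / (circ r t - z))))%C t.
Proof.
  intros Hh Hz.
  assert (Hr : 0 < r) by (generalize (Cmod_ge_0 z); lra).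
  assert (Hc := holo_le_circ h r ltac:(lra) Hh t).
  circ_continuity; [apply circ_neq_0, Hr | apply circ_neq, Hz].
Qed.

Lemma tcoef_ccont (r : R) (h : CC -> CC) (n : nat) (t : R) : 0 < r -> holo_le h r ->
  ccont (fun t => h (circ r t) * (/ circ r t) ^ n)%C t.
Proof.
  intros Hr Hh; assert (Hc := holo_le_circ h r ltac:(lra) Hh t).
  circ_continuity; apply circ_neq_0, Hr.
Qed.

(** Iterates [zeta / (zeta - z) = 1 + (z / zeta) (zeta / (zeta - z))] in Cauchy's formula, which
    keeps the remainder exact at every order. *)
Lemma taylor_remainder (r : R) (h : CC -> CC) (z : CC) (n : nat) : holo_le h r -> Cmod z < r ->
  h z = (csum (fun k => tcoef r h k * z ^ k) n +
    z ^ n * cmean (fun t => h (circ r t) * ((/ circ r t) ^ n * (circ r t / (circ r t - z)))))%C.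
Proof.
  intros Hh Hz.
  assert (Hr : 0 < r) by (generalize (Cmod_ge_0 z); lra).
  induction n as [|n IH].
  - simpl; rewrite <- (Cauchy_formula h r z Hh Hz).
    rewrite Cplus_0_l, Cmult_1_l; apply cmean_ext; intros t; ring.
  - rewrite IH at 1; simpl csum.
    replace (cmean (fun t => h (circ r t) * ((/ circ r t) ^ n * (circ r t / (circ r t - z)))))%C
      with (tcoef r h n + z * cmean (fun t => h (circ r t) *
              ((/ circ r t) ^ (S n) * (circ r t / (circ r t - z)))))%C.
    { simpl Cpow; ring. }
    unfold tcoef.
    rewrite <- cmean_scal by (intros t; apply kernel_ccont; assumption).
    rewrite <- cmean_plus.
    + apply cmean_ext; intros t; simpl; field; split; [apply circ_neq, Hz | apply circ_neq_0, Hr].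
    + intros t; apply tcoef_ccont; assumption.
    + intros t; apply ccont_mult; [apply ccont_const | apply kernel_ccont; assumption].
Qed.

(** The mean of [|h|] on the circle; the outer [Cmod] extracts a real number from the complex
    mean. *)
Definition circ_norm (r : R) (h : CC -> CC) : R := Cmod (cmean (fun t => Cmod (h (circ r t)))).

Lemma taylor_bound (r : R) (h : CC -> CC) (z : CC) (n : nat) : 0 < r -> holo_le h r -> Cmod z <= r / 2 ->
  Cmod (h z - csum (fun k => tcoef r h k * z ^ k) n)%C <= 2 * circ_norm r h * (Cmod z / r) ^ n.
Proof.
  intros Hr Hh Hz.
  assert (Hz' : Cmod z < r) by lra.
  rewrite (taylor_remainder r h z n Hh Hz') at 1.
  match goal with |- Cmod (?A + ?B - ?A) <= _ => replace (A + B - A)%C with B by ring end.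
  rewrite Cmod_mult, Cmod_pow.
  unfold Rdiv; rewrite Rpow_mult_distr.
  replace (2 * circ_norm r h * (Cmod z ^ n * (/ r) ^ n))
    with (Cmod z ^ n * (2 * (/ r) ^ n * circ_norm r h)) by ring.
  apply Rmult_le_compat_l; [apply pow_le, Cmod_ge_0|].
  apply (cmean_bound_scal _ (fun t => h (circ r t))).
  - apply Rmult_le_pos; [lra | apply pow_le; left; apply Rinv_0_lt_compat, Hr].
  - intros t; apply kernel_ccont; assumption.
  - apply holo_le_circ; [lra | exact Hh].
  - intros t.
    rewrite !Cmod_mult, Cmod_pow, Cmod_inv by (apply circ_neq_0, Hr).
    rewrite Cmod_div by (apply circ_neq, Hz').
    rewrite Cmod_circ by lra.
    assert (L := Cmod_triangle_inv (circ r t) z); rewrite Cmod_circ in L by lra.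
    (* The hypothesis [|z| <= r / 2] keeps the Cauchy kernel below 2, the origin of the factor 2. *)
    assert (L2 : r * / Cmod (circ r t - z) <= 2).
    { apply Rle_div_l; lra. }
    assert (P : 0 <= (/ r) ^ n) by (apply pow_le; left; apply Rinv_0_lt_compat, Hr).
    assert (Q := Cmod_ge_0 (h (circ r t))).
    rewrite (Rmult_comm (2 * (/ r) ^ n)).
    apply Rmult_le_compat_l; [exact Q|].
    rewrite Rmult_comm; apply Rmult_le_compat_r; assumption.
Qed.

(** [sum_n] includes the index [n], whereas [csum] stops before it. *)
Lemma sum_n_csum (a : nat -> CC) (z : CC) (n : nat) :
  sum_n (fun k => scal (pow_n (K := C_AbsRing) z k) (a k : C_NormedModule)) n
  = csum (fun k => a k * z ^ k)%C (S n).
Proof.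
  assert (Ek : forall k, scal (pow_n (K := C_AbsRing) z k) (a k : C_NormedModule) = (a k * z ^ k)%C).
  { intros k; rewrite Cmult_comm; change (scal ?x ?y) with (Cmult x y); f_equal. }
  induction n as [|n IH].
  - rewrite sum_O, Ek; symmetry; apply Cplus_0_l.
  - rewrite sum_Sn, IH, Ek; reflexivity.
Qed.

Lemma holo_is_pseries (h : CC -> CC) (r : R) (z : CC) : 0 < r -> holo_le h r -> Cmod z <= r / 2 ->
  @is_pseries C_AbsRing C_NormedModule (tcoef r h) z (h z).
Proof.
  intros Hr Hh Hz.
  intros P [d HP]; unfold filtermap.
  assert (HN : exists N, forall n, (N <= n)%nat -> 2 * circ_norm r h * (/ 2) ^ n < d).
  { assert (HM := Cmod_ge_0 (cmean (fun t => Cmod (h (circ r t))))); fold (circ_norm r h) in HM.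
    destruct (pow_lt_1_zero (/ 2)) with (y := d / (2 * circ_norm r h + 1)) as [N HN].
    - rewrite Rabs_pos_eq; lra.
    - apply Rdiv_lt_0_compat; [apply cond_pos | lra].
    - exists N; intros n Hn; specialize (HN n Hn).
      rewrite Rabs_pos_eq in HN by (apply pow_le; lra).
      apply Rlt_div_r in HN; [|lra].
      assert (0 <= (/ 2) ^ n) by (apply pow_le; lra). lra. }
  destruct HN as [N HN]; exists N; intros n Hn; apply HP.
  rewrite sum_n_csum; apply C_NormedModule_mixin_compat1.
  change (Cmod (csum (fun k => tcoef r h k * z ^ k)%C (S n) - h z) < d).
  rewrite Cmod_sub_sym.
  eapply Rle_lt_trans; [apply taylor_bound; assumption|].
  eapply Rle_lt_trans; [|apply (HN (S n)); lia].
  apply Rmult_le_compat_l.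
  - apply Rmult_le_pos; [lra | apply Cmod_ge_0].
  - apply pow_incr; split.
    + apply Rdiv_le_0_compat; [apply Cmod_ge_0 | exact Hr].
    + apply Rle_div_l; lra.
Qed.

(** Differentiating the Cauchy kernel, then expanding it to fourth order. *)
Lemma taylor_deriv_bound (r : R) (h : CC -> CC) : 0 < r -> holo_le h r ->
  exists M, forall z l, Cmod z <= r / 2 -> cderiv h z l ->
  Cmod (l - (tcoef r h 1 + 2 * tcoef r h 2 * z + 3 * tcoef r h 3 * z ^ 2 + 4 * tcoef r h 4 * z ^ 3))%C
    <= M * Cmod z ^ 4.
Proof.
  intros Hr Hh.
  assert (Hc := holo_le_circ h r ltac:(lra) Hh).
  assert (Hn0 := fun t => circ_neq_0 r t Hr).
  assert (Hn : forall z t, Cmod z < r -> (circ r t - z)%C <> 0) by (intros; apply circ_neq; assumption).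
  assert (Hlow : forall z t, Cmod z <= r / 2 -> / Cmod (circ r t - z) <= / (r / 2)).
  { intros z t Hz; apply Rinv_le_contravar; [lra|].
    assert (L := Cmod_triangle_inv (circ r t) z); rewrite Cmod_circ in L by lra; lra. }
  assert (Hir : 0 < / r) by (apply Rinv_0_lt_compat, Hr).
  assert (Hir2 : 0 < / (r / 2)) by (apply Rinv_0_lt_compat; lra).
  assert (Hin : forall x : CC, x <> 0 -> 0 <= / Cmod x)
    by (intros x Hx; left; apply Rinv_0_lt_compat, Cmod_gt_0, Hx).
  assert (D : forall z l, Cmod z <= r / 2 -> cderiv h z l ->
     l = cmean (fun t => h (circ r t) * (circ r t / ((circ r t - z) * (circ r t - z))))%C).
  { intros z l Hz Hl; apply (cderiv_unique h z); [exact Hl|]; clear l Hl.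
    apply cderiv_eps; intros e He.
    assert (Hnorm := Cmod_ge_0 (cmean (fun t => Cmod (h (circ r t))))); fold (circ_norm r h) in Hnorm.
    pose (K := r * (/ (r / 2)) * (/ (r / 2)) * (4 / r)).
    assert (HK : 0 < K) by (unfold K; repeat apply Rmult_lt_0_compat; try assumption; lra).
    assert (HKn : 0 <= K * circ_norm r h) by (apply Rmult_le_pos; lra).
    apply locally_C_iff; exists (Rmin (r / 4) (e / (K * circ_norm r h + 1))); split.
    { apply Rmin_pos; [lra | apply Rdiv_lt_0_compat; lra]. }
    intros y Hy.
    assert (Hy1 : Cmod (y - z) < r / 4) by (eapply Rlt_le_trans; [exact Hy | apply Rmin_l]).
    assert (Hy2 : Cmod (y - z) < e / (K * circ_norm r h + 1))
      by (eapply Rlt_le_trans; [exact Hy | apply Rmin_r]).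
    assert (Hyr : Cmod y <= 3 / 4 * r).
    { assert (L := Cmod_triangle_inv y z); lra. }
    assert (Hlowy : forall t, / Cmod (circ r t - y) <= 4 / r).
    { intros t; replace (4 / r) with (/ (r / 4)) by (field; lra); apply Rinv_le_contravar; [lra|].
      assert (L := Cmod_triangle_inv (circ r t) y); rewrite Cmod_circ in L by lra; lra. }
    rewrite <- (Cauchy_formula h r y Hh), <- (Cauchy_formula h r z Hh) by lra.
    (* With [zeta = circ r t], this comes from [1/(zeta - y) - 1/(zeta - z) - (y - z)/(zeta - z)^2 =
       (y - z)^2 / ((zeta - z)^2 (zeta - y))]. *)
    set (G := fun t => (h (circ r t) * (circ r t / ((circ r t - z) * (circ r t - z) * (circ r t - y))))%C).
    assert (HG : forall t, ccont G t).
    { intros t; assert (Hct := Hc t); unfold G; circ_continuity.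
      repeat apply Cmult_neq_0; apply Hn; lra. }
    replace (_ - _ - _)%C with ((y - z) * ((y - z) * cmean G))%C.
    2:{ rewrite <- !cmean_scal by (intros t; assert (Hct := Hc t); assert (HGt := HG t); circ_continuity;
          repeat apply Cmult_neq_0; apply Hn; lra).
        match goal with |- _ = (cmean ?A - cmean ?B - cmean ?C)%C =>
          replace (cmean A - cmean B - cmean C)%C with (cmean A + (- (1) * cmean B + - (1) * cmean C))%C by ring
        end.
        rewrite <- !cmean_scal by (intros t; assert (Hct := Hc t); circ_continuity;
          repeat apply Cmult_neq_0; apply Hn; lra).
        rewrite <- !cmean_plus by (intros t; assert (Hct := Hc t); circ_continuity;
          repeat apply Cmult_neq_0; apply Hn; lra).
        apply cmean_ext; intros t; unfold G; field; split; apply Hn; lra. }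
    rewrite !Cmod_mult.
    assert (B : Cmod (cmean G) <= K * circ_norm r h).
    { apply (cmean_bound_scal G (fun t => h (circ r t))); [lra | exact HG | exact Hc |].
      intros t; unfold G.
      rewrite Cmod_mult, Cmod_div, !Cmod_mult, Cmod_circ
        by (first [lra | repeat apply Cmult_neq_0; apply Hn; lra]).
      rewrite (Rmult_comm K); apply Rmult_le_compat_l; [apply Cmod_ge_0|].
      unfold Rdiv at 1; rewrite !Rinv_mult.
      unfold K; rewrite !Rmult_assoc; apply Rmult_le_compat_l; [lra|].
      assert (B1 := Hlow z t Hz); assert (B2 := Hlowy t).
      assert (P1 := Hin _ (Hn z t ltac:(lra))); assert (P2 := Hin _ (Hn y t ltac:(lra))).
      apply Rmult_le_compat; [exact P1 | apply Rmult_le_pos; assumption | exact B1 |].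
      apply Rmult_le_compat; assumption. }
    rewrite (Rmult_comm e); apply Rmult_le_compat_l; [apply Cmod_ge_0|].
    apply Rlt_div_r in Hy2; [|lra].
    assert (Hp := Cmod_ge_0 (y - z)); assert (Hp2 := Cmod_ge_0 (cmean G)). nra. }
  pose (c := (/ r) ^ 5 * 8 * r * (/ (r / 2)) * (/ (r / 2)) * r).
  exists (c * circ_norm r h); intros z l Hz Hl.
  rewrite (D z l Hz Hl).
  assert (Hz' : Cmod z < r) by lra.
  (* With [x = z / circ r t], the remainder is [1/(1 - x)^2 - (1 + 2x + 3x^2 + 4x^3) = x^4 (5 - 4x)
     / (1 - x)^2]. *)
  set (G := fun t => (h (circ r t) * ((/ circ r t) ^ 4 *
      (circ r t * (5 - 4 * (z / circ r t)) / ((circ r t - z) * (circ r t - z)))))%C).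
  assert (HG : forall t, ccont G t).
  { intros t; assert (Hct := Hc t); unfold G; circ_continuity; auto.
    apply Cmult_neq_0; apply Hn, Hz'. }
  replace (_ - _)%C with (z ^ 4 * cmean G)%C.
  2:{ pose (A := fun t => (h (circ r t) * (circ r t / ((circ r t - z) * (circ r t - z))))%C).
      pose (B := fun k t => (h (circ r t) * (/ circ r t) ^ k)%C).
      transitivity (cmean A + (- (1) * cmean (B 1%nat) + ((- (2) * z) * cmean (B 2%nat)
        + ((- (3) * z ^ 2) * cmean (B 3%nat) + (- (4) * z ^ 3) * cmean (B 4%nat)))))%C;
        [unfold A, B | unfold tcoef, A, B; ring].
      rewrite <- !cmean_scal by (intros t; assert (Hct := Hc t); assert (HGt := HG t); circ_continuity; auto).
      rewrite <- !cmean_plus by (intros t; assert (Hct := Hc t); circ_continuity; auto;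
        apply Cmult_neq_0; apply Hn, Hz').
      apply cmean_ext; intros t; unfold G; field; split; first [apply Hn0 | apply Hn, Hz']. }
  rewrite Cmod_mult, Cmod_pow, (Rmult_comm _ (Cmod z ^ 4)).
  apply Rmult_le_compat_l; [apply pow_le, Cmod_ge_0|].
  apply (cmean_bound_scal G (fun t => h (circ r t))); [| exact HG | exact Hc |].
  - unfold c; repeat apply Rmult_le_pos; try lra; apply pow_le; lra.
  - intros t; unfold G.
    replace (circ r t * (5 - 4 * (z / circ r t)) / ((circ r t - z) * (circ r t - z)))%C
      with ((5 * circ r t - 4 * z) / ((circ r t - z) * (circ r t - z)))%C
      by (field; split; first [apply Hn0 | apply Hn, Hz']).
    rewrite Cmod_mult, Cmod_mult, Cmod_pow, Cmod_inv, Cmod_circ by (auto; lra).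
    rewrite Cmod_div, Cmod_mult by (apply Cmult_neq_0; apply Hn, Hz').
    rewrite (Rmult_comm c); apply Rmult_le_compat_l; [apply Cmod_ge_0|].
    replace c with ((/ r) ^ 4 * (8 * r * (/ (r / 2) * / (r / 2)))) by (unfold c; field; lra).
    apply Rmult_le_compat_l; [apply pow_le; lra|].
    unfold Rdiv at 1; rewrite Rinv_mult.
    assert (B1 := Hlow z t Hz); assert (P1 := Hin _ (Hn z t Hz')).
    apply Rmult_le_compat; [apply Cmod_ge_0 | apply Rmult_le_pos; assumption | |
      apply Rmult_le_compat; assumption].
    eapply Rle_trans; [apply Cmod_triangle_sub|].
    rewrite !Cmod_mult, !Cmod_R, !Rabs_pos_eq, Cmod_circ by lra; lra.
Qed.

(** * Coefficient inequalities for Schwarz functions *)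


Ltac cmean_linear := repeat match goal with
  | |- context [cmean (fun t => Cplus (@?F t) (@?G t))] => rewrite (cmean_plus F G)
  | |- context [cmean (fun t => Cmult ?c (@?F t))] => rewrite (cmean_scal c F)
  end.

Lemma tcoef_0 (r : R) (h : CC -> CC) : 0 < r -> holo_le h r -> tcoef r h 0 = h 0.
Proof.
  intros Hr Hh.
  rewrite <- (Cauchy_formula h r 0 Hh) by (rewrite Cmod_0; exact Hr).
  apply cmean_ext; intros t; simpl.
  field; exact (circ_neq_0 r t Hr).
Qed.

(** Cauchy's formula at 0 for [h z * z ^ S n]: Taylor coefficients of negative index vanish. *)
Lemma cmean_mult_circ_pow (r : R) (h : CC -> CC) (n : nat) : 0 < r -> holo_le h r ->
  cmean (fun t => h (circ r t) * circ r t ^ S n)%C = 0.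
Proof.
  intros Hr Hh.
  assert (Hpow : forall z, cderiv (fun z => z ^ S n)%C z (INR (S n) * z ^ n)%C).
  { intros z; induction n as [|n IH].
    - apply cderiv_ext with (fun z : CC => z); [intros y; simpl; ring|].
      cderiv_calc; simpl; ring.
    - apply cderiv_ext with (fun z => z * z ^ S n)%C; [reflexivity|].
      cderiv_calc.
      rewrite (S_INR (S n)), RtoC_plus; simpl Cpow; ring. }
  rewrite <- (cmean_ext (fun t => (h (circ r t) * circ r t ^ S n) * (circ r t / (circ r t - 0)))%C).
  - rewrite (Cauchy_formula (fun z => h z * z ^ S n)%C); [simpl; ring | | rewrite Cmod_0; exact Hr].
    intros z Hz; destruct (Hh z Hz) as [l Hl].
    eexists; apply cderiv_mult; [exact Hl | apply Hpow].
  - intros t; field.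
    replace (circ r t - 0)%C with (circ r t) by ring; exact (circ_neq_0 r t Hr).
Qed.

Lemma holo_le_const (c : CC) (r : R) : holo_le (fun _ => c) r.
Proof. intros z _; eexists; apply cderiv_const. Qed.

Lemma cmean_circ_pow (r : R) (n : nat) : 0 < r -> cmean (fun t => circ r t ^ S n)%C = 0.
Proof.
  intros Hr; rewrite <- (cmean_mult_circ_pow r (fun _ => 1%C) n Hr (holo_le_const _ _)).
  apply cmean_ext; intros t; ring.
Qed.

Lemma cmean_circ_inv_pow (r : R) (n : nat) : 0 < r -> cmean (fun t => (/ circ r t) ^ S n)%C = 0.
Proof.
  intros Hr.
  assert (Hn := fun t => circ_neq_0 r t Hr).
  assert (Nr : RtoC r <> 0) by (intros E; apply RtoC_inj in E; lra).
  rewrite (cmean_ext _ (fun t => (/ RtoC r ^ 2) ^ S n * Cconj (circ r t ^ S n))%C).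
  - rewrite cmean_scal, cmean_conj, cmean_circ_pow by
      first [exact Hr | intros t; circ_continuity].
    replace (Cconj (RtoC 0)) with (RtoC 0) by (apply injective_projections; simpl; ring); ring.
  - intros t; rewrite Cpow_conj, circ_conj by exact Hr.
    rewrite <- Cpow_mult_l; f_equal; field; split; first [apply Hn | exact Nr].
Qed.

Definition quad (a b z : CC) : CC := (1 + a * z + b * z ^ 2)%C.

(** Parseval's identity: on the circle [Cconj z = r^2 / z], so the product is a Laurent polynomial
    whose nonconstant powers have mean zero. *)
Lemma cmean_quad_sqr (r : R) (a b : CC) : 0 < r ->
  cmean (fun t => quad a b (circ r t) * Cconj (quad a b (circ r t)))%C
  = RtoC (1 + Cmod a ^ 2 * r ^ 2 + Cmod b ^ 2 * r ^ 4).
Proof.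
  intros Hr; assert (Hn := fun t => circ_neq_0 r t Hr).
  pose (Z := fun n t => (circ r t ^ S n)%C); pose (W := fun n t => ((/ circ r t) ^ S n)%C).
  assert (HZ : forall n t, ccont (Z n) t) by (intros n t; unfold Z; circ_continuity).
  assert (HW : forall n t, ccont (W n) t) by (intros n t; unfold W; circ_continuity; apply Hn).
  transitivity (cmean (fun t => RtoC (1 + Cmod a ^ 2 * r ^ 2 + Cmod b ^ 2 * r ^ 4) +
    ((a + Cconj a * b * r ^ 2) * Z 0%nat t + (b * Z 1%nat t +
    ((Cconj a * r ^ 2 + a * Cconj b * r ^ 4) * W 0%nat t + Cconj b * r ^ 4 * W 1%nat t))))%C).
  - apply cmean_ext; intros t; unfold quad, Z, W.
    rewrite !Cplus_conj, !Cmult_conj, Cpow_conj, circ_conj by exact Hr.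
    replace (Cconj (RtoC 1)) with (RtoC 1) by (apply injective_projections; simpl; ring).
    rewrite !RtoC_plus, !RtoC_mult, !Cmod2_conj, !RtoC_pow.
    simpl; field; apply Hn.
  - cmean_linear; try (intros t; circ_continuity).
    rewrite cmean_const.
    unfold Z, W; rewrite !cmean_circ_pow, !cmean_circ_inv_pow by exact Hr; ring.
Qed.

(** For [r = 1] this is the contractivity of multiplication by [w] on the Hardy space, tested on [p] and its
    reversal. *)
Lemma schwarz_quad_bound (r : R) (w : CC -> CC) (a b : CC) (n : nat) : 0 < r < 1 -> holo_le w r ->
  (forall t, Cmod (w (circ r t)) <= 1) ->
  r ^ n * Cmod (cmean (fun t => w (circ r t) * (quad a b (circ r t) ^ 2 * (/ circ r t) ^ n))%C)
    <= 1 + Cmod a ^ 2 + Cmod b ^ 2.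
Proof.
  intros Hr Hh Hw.
  assert (Hn := fun t => circ_neq_0 r t (proj1 Hr)).
  assert (Hc := holo_le_circ w r ltac:(lra) Hh).
  assert (Hq : forall t, ccont (fun t => quad a b (circ r t)) t)
    by (intros t; unfold quad; circ_continuity).
  assert (B : Cmod (cmean (fun t => RtoC (r ^ n) * (w (circ r t) * (quad a b (circ r t) ^ 2 * (/ circ r t) ^ n)))%C)
     <= Cmod (cmean (fun t => quad a b (circ r t) * Cconj (quad a b (circ r t)))%C)).
  { apply (cmean_bound_mean _ _ (fun t => Cmod (quad a b (circ r t)) ^ 2)).
    - intros t; assert (Hct := Hc t); assert (Hqt := Hq t); circ_continuity; apply Hn.
    - intros t; assert (Hqt := Hq t); circ_continuity.
    - intros t; symmetry; apply Cmod2_conj.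
    - intros t; rewrite !Cmod_mult, !Cmod_pow, Cmod_inv, Cmod_circ, Cmod_R by (auto; lra).
      rewrite Rabs_pos_eq by (apply pow_le; lra).
      replace (r ^ n * (Cmod (w (circ r t)) * (Cmod (quad a b (circ r t)) ^ 2 * (/ r) ^ n)))
        with (Cmod (w (circ r t)) * Cmod (quad a b (circ r t)) ^ 2 * (r * / r) ^ n)
        by (rewrite Rpow_mult_distr; ring).
      rewrite Rinv_r, pow1, Rmult_1_r by lra.
      rewrite <- (Rmult_1_l (Cmod (quad a b (circ r t)) ^ 2)) at 2.
      apply Rmult_le_compat_r; [apply pow2_ge_0 | apply Hw]. }
  rewrite cmean_scal in B by (intros t; assert (Hct := Hc t); assert (Hqt := Hq t); circ_continuity; apply Hn).
  rewrite cmean_quad_sqr, Cmod_mult, !Cmod_R, !Rabs_pos_eq in B; [| | apply pow_le; lra | lra].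
  - assert (0 <= r ^ 2 <= 1) by (split; [apply pow_le; lra | simpl; nra]).
    assert (0 <= r ^ 4 <= 1) by (replace (r ^ 4) with (r ^ 2 * r ^ 2) by ring; nra).
    assert (Ha := pow2_ge_0 (Cmod a)); assert (Hb := pow2_ge_0 (Cmod b)). nra.
  - assert (Ha := pow2_ge_0 (Cmod a)); assert (Hb := pow2_ge_0 (Cmod b)).
    assert (0 <= r ^ 2) by (apply pow_le; lra); assert (0 <= r ^ 4) by (apply pow_le; lra). nra.
Qed.

(** Here [p^2 = 1 + 2 a z + (a^2 + 2 b) z^2 + 2 a b z^3 + b^2 z^4]. The cubic term meets [w 0 = 0],
    and the quartic one leaves a positive power of [z], of mean zero. *)
Lemma cmean_quad_coef (r : R) (w : CC -> CC) (a b : CC) : 0 < r -> holo_le w r -> w 0 = 0 ->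
  let c := tcoef r w in
  (cmean (fun t => w (circ r t) * (quad a b (circ r t) ^ 2 * (/ circ r t) ^ 3))
     = c 3%nat + 2 * a * c 2%nat + (a ^ 2 + 2 * b) * c 1%nat)%C /\
  (cmean (fun t => w (circ r t) * (quad a 0 (circ r t) ^ 2 * (/ circ r t) ^ 2))
     = c 2%nat + 2 * a * c 1%nat)%C /\
  (cmean (fun t => w (circ r t) * (quad 0 0 (circ r t) ^ 2 * (/ circ r t) ^ 1)) = c 1%nat)%C.
Proof.
  intros Hr Hh H0 c.
  assert (Hn := fun t => circ_neq_0 r t Hr).
  assert (E0 : c 0%nat = 0) by (unfold c; rewrite tcoef_0 by assumption; exact H0).
  pose (T := fun n t => (w (circ r t) * (/ circ r t) ^ n)%C).
  assert (HT : forall n t, ccont (T n) t) by (intros n t; apply tcoef_ccont; assumption).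
  assert (Ec : forall n, cmean (T n) = c n) by reflexivity.
  pose (X := fun t => (w (circ r t) * circ r t ^ 1)%C).
  assert (HX : forall t, ccont X t)
    by (intros t; assert (Hc := holo_le_circ w r ltac:(lra) Hh t); unfold X; circ_continuity).
  assert (EX : cmean X = 0) by (apply cmean_mult_circ_pow; assumption).
  repeat split.
  - rewrite (cmean_ext _ (fun t => T 3%nat t + (2 * a * T 2%nat t + ((a ^ 2 + 2 * b) * T 1%nat t
        + (2 * a * b * T 0%nat t + b ^ 2 * X t))))%C).
    + cmean_linear; try (intros t; circ_continuity).
      rewrite !Ec; change (cmean (fun t => X t)) with (cmean X); rewrite EX, E0; ring.
    + intros t; unfold T, X, quad; simpl; field; apply Hn.
  - rewrite (cmean_ext _ (fun t => T 2%nat t + (2 * a * T 1%nat t + a ^ 2 * T 0%nat t))%C).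
    + cmean_linear; try (intros t; circ_continuity).
      rewrite !Ec, E0; ring.
    + intros t; unfold T, quad; simpl; field; apply Hn.
  - apply cmean_ext; intros t; unfold quad; ring.
Qed.

Lemma le_of_cube_le (x K : R) : (forall r, 0 < r < 1 -> r ^ 3 * x <= K) -> x <= K.
Proof.
  intros H; destruct (Rle_dec x K) as [L|L]; [exact L | exfalso].
  apply Rnot_le_lt in L.
  destruct (Rle_dec x 0) as [X0|X0].
  - specialize (H (/ 2)); specialize (H ltac:(lra)); nra.
  - apply Rnot_le_lt in X0.
    (* By Bernoulli, [(1 - e)^3 x >= x - 3 e x >= x - 3/4 (x - K) > K]. *)
    pose (e := Rmin (1 / 2) ((x - K) / (4 * x))).
    assert (He : 0 < e) by (apply Rmin_pos; [lra | apply Rdiv_lt_0_compat; lra]).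
    assert (He1 : e <= 1 / 2) by apply Rmin_l.
    assert (He2 : e * (4 * x) <= x - K) by (apply Rle_div_r; [lra | apply Rmin_r]).
    specialize (H (1 - e)); specialize (H ltac:(lra)).
    assert (1 - 3 * e <= (1 - e) ^ 3) by (simpl; nra). nra.
Qed.

Lemma schwarz_coef_bounds (w : CC -> CC) (c1 c2 c3 : CC) :
  analytic_U w -> w 0 = 0 -> (forall z, inU z -> Cmod (w z) < 1) ->
  (forall r, 0 < r < 1 -> tcoef r w 1 = c1 /\ tcoef r w 2 = c2 /\ tcoef r w 3 = c3) ->
  Cmod c1 <= 1 /\
  (forall a, Cmod (c2 + 2 * a * c1)%C <= 1 + Cmod a ^ 2) /\
  (forall a b, Cmod (c3 + 2 * a * c2 + (a ^ 2 + 2 * b) * c1)%C <= 1 + Cmod a ^ 2 + Cmod b ^ 2).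
Proof.
  intros Hw H0 Hb Hc.
  assert (Hh : forall r, 0 < r < 1 -> holo_le w r)
    by (intros r Hr z Hz; apply Hw; unfold inU; lra).
  assert (Hcirc : forall r t, 0 < r < 1 -> Cmod (w (circ r t)) <= 1)
    by (intros r t Hr; left; apply Hb; unfold inU; rewrite Cmod_circ; lra).
  (* The three bounds carry factors [r], [r^2] and [r^3]; weakening all to [r^3] lets one lemma pass
     to the limit [r = 1]. *)
  assert (Hpow : forall r, 0 < r < 1 -> r ^ 3 <= r ^ 2 /\ r ^ 3 <= r ^ 1)
    by (intros r Hr; simpl; split; nra).
  split; [|split].
  - apply le_of_cube_le; intros r Hr.
    destruct (Hc r Hr) as [E1 [E2 E3]].
    destruct (cmean_quad_coef r w 0 0 ltac:(lra) (Hh r Hr) H0) as [_ [_ E]].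
    assert (B := schwarz_quad_bound r w 0 0 1 Hr (Hh r Hr) (fun t => Hcirc r t Hr)).
    rewrite E, E1, Cmod_0 in B; destruct (Hpow r Hr); generalize (Cmod_ge_0 c1); nra.
  - intros a; apply le_of_cube_le; intros r Hr.
    destruct (Hc r Hr) as [E1 [E2 E3]].
    destruct (cmean_quad_coef r w a 0 ltac:(lra) (Hh r Hr) H0) as [_ [E _]].
    assert (B := schwarz_quad_bound r w a 0 2 Hr (Hh r Hr) (fun t => Hcirc r t Hr)).
    rewrite E, E1, E2, Cmod_0 in B; destruct (Hpow r Hr).
    generalize (Cmod_ge_0 (c2 + 2 * a * c1)); nra.
  - intros a b; apply le_of_cube_le; intros r Hr.
    destruct (Hc r Hr) as [E1 [E2 E3]].
    destruct (cmean_quad_coef r w a b ltac:(lra) (Hh r Hr) H0) as [E _].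
    assert (B := schwarz_quad_bound r w a b 3 Hr (Hh r Hr) (fun t => Hcirc r t Hr)).
    rewrite E, E1, E2, E3 in B; exact B.
Qed.

(** The choice [a = u * conj c1], with [u] the phase of [c2], aligns the two terms of
    [c2 + 2 a c1]. *)
Lemma schwarz_c2 (c1 c2 : CC) : (forall a, Cmod (c2 + 2 * a * c1)%C <= 1 + Cmod a ^ 2) ->
  Cmod c2 <= 1 - Cmod c1 ^ 2.
Proof.
  intros H.
  destruct (exists_phase c2) as [u [Hu Eu]].
  assert (Nu : u <> 0) by (intros E; rewrite E, Cmod_0 in Hu; lra).
  specialize (H (Cconj c1 / u)%C).
  rewrite Cmod_div, Cmod_conj, Hu in H by exact Nu.
  replace (Cmod (c2 + 2 * (Cconj c1 / u) * c1)%C) with (Cmod c2 + 2 * Cmod c1 ^ 2) in H.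
  - unfold Rdiv in H; rewrite Rinv_1, Rmult_1_r in H; lra.
  - rewrite <- (Rmult_1_l (Cmod (_ + _)%C)), <- Hu, <- Cmod_mult.
    replace (u * (c2 + 2 * (Cconj c1 / u) * c1))%C with (u * c2 + 2 * (c1 * Cconj c1))%C
      by (field; exact Nu).
    rewrite Eu, <- Cmod2_conj, <- RtoC_mult, <- RtoC_plus, Cmod_R, Rabs_pos_eq; [reflexivity|].
    assert (P := Cmod_ge_0 c2); assert (Q := pow2_ge_0 (Cmod c1)); lra.
Qed.

Lemma inverse_coef_bounds (c1 c2 c3 : CC) :
  Cmod c1 <= 1 ->
  (forall a, Cmod (c2 + 2 * a * c1)%C <= 1 + Cmod a ^ 2) ->
  (forall a b, Cmod (c3 + 2 * a * c2 + (a ^ 2 + 2 * b) * c1)%C <= 1 + Cmod a ^ 2 + Cmod b ^ 2) ->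
  Cmod (- c1 / 2) <= 1 / 2 /\
  Cmod (5 / 12 * c1 ^ 2 - c2 / 4)%C <= 5 / 12 /\
  Cmod (- (c3 - 10 / 3 * c1 * c2 + 31 / 12 * c1 ^ 3) / 6)%C <= 31 / 72.
Proof.
  intros H1 H2 H3; apply schwarz_c2 in H2.
  assert (P := Cmod_ge_0 c1); assert (Q := Cmod_ge_0 c2).
  assert (ER : forall x : R, 0 <= x -> Cmod x = x)
    by (intros x Hx; rewrite Cmod_R, Rabs_pos_eq; [reflexivity | exact Hx]).
  assert (N2 : RtoC 2 <> 0) by (intros E; apply RtoC_inj in E; lra).
  assert (N4 : RtoC 4 <> 0) by (intros E; apply RtoC_inj in E; lra).
  assert (N6 : RtoC 6 <> 0) by (intros E; apply RtoC_inj in E; lra).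
  split; [|split].
  - rewrite Cmod_div, Cmod_opp, ER by (assumption || lra); lra.
  (* With [|c2| <= 1 - |c1|^2] the sum is at most [1/4 + |c1|^2 / 6]. *)
  - eapply Rle_trans; [apply Cmod_triangle_sub|].
    rewrite <- !RtoC_div by lra.
    rewrite Cmod_mult, Cmod_pow, Cmod_div, !ER by (assumption || lra); nra.
  - (* At [c1 = 1] the bound must be an equality with [p] self-reversed: [b = 1] and [a^2 + 2 = 31/12]; the
       rational value [9/16] replaces [a^2 = 7/12]. *)
    specialize (H3 (- (3 / 4) * c1)%C (c1 ^ 2)%C).
    set (X := (c3 + _ + _)%C) in H3.
    (* As [X = c3 - 3/2 c1 c2 + 41/16 c1^3], the corrections are [-10/3 + 3/2 = -11/6] and
       [31/12 - 41/16 = 1/48]. *)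
    replace (- (c3 - 10 / 3 * c1 * c2 + 31 / 12 * c1 ^ 3) / 6)%C
      with (- (X - RtoC (11 / 6) * (c1 * c2) + RtoC (1 / 48) * c1 ^ 3) / 6)%C
      by (unfold X; rewrite !RtoC_div by lra; field; repeat split; intros E; apply RtoC_inj in E; lra).
    rewrite Cmod_div, Cmod_opp, (ER 6) by (assumption || lra).
    assert (T1 := Cmod_triangle (X - RtoC (11 / 6) * (c1 * c2)) (RtoC (1 / 48) * c1 ^ 3)).
    assert (T2 := Cmod_triangle_sub X (RtoC (11 / 6) * (c1 * c2))).
    rewrite !Cmod_mult, Cmod_pow, !ER in T1 by lra.
    rewrite !Cmod_mult, !ER in T2 by lra.
    rewrite <- RtoC_div, <- RtoC_opp, Cmod_mult, Cmod_R, Cmod_pow in H3 by lra.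
    rewrite Rabs_left in H3 by lra.
    set (c := Cmod c1) in *.
    assert (M : c * Cmod c2 <= c * (1 - c ^ 2)) by (apply Rmult_le_compat_l; assumption).
    (* At [c = 1] this is the equality [1 + 9/16 + 1 + 1/48 = 31/12], and [31/72] is a sixth of
       it. *)
    assert (F : 1 + (9 / 16) * c ^ 2 + c ^ 4 + 11 / 6 * (c * (1 - c ^ 2)) + 1 / 48 * c ^ 3 <= 31 / 12)
      by (assert (0 <= c ^ 2 <= 1) by (simpl; nra); simpl in *; nra).
    apply Rle_div_l; [lra|]. nra.
Qed.

(** * Third-order jets at the origin *)


(** Punctured at [0], so that [f z / z] qualifies. *)
Definition jet (h : CC -> CC) (c0 c1 c2 c3 : CC) : Prop :=
  exists M d, 0 < d <= 1 /\ 0 <= M /\ forall z, 0 < Cmod z < d ->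
    Cmod (h z - (c0 + c1 * z + c2 * z ^ 2 + c3 * z ^ 3))%C <= M * Cmod z ^ 4.

(** The clauses [d <= 1] and [0 <= M] of [jet] let products absorb every higher power of [z] into
    [|z|^4]; clamping restores them here. *)
Lemma jet_intro (h : CC -> CC) (c0 c1 c2 c3 : CC) (M d : R) : 0 < d ->
  (forall z, 0 < Cmod z < d ->
    Cmod (h z - (c0 + c1 * z + c2 * z ^ 2 + c3 * z ^ 3))%C <= M * Cmod z ^ 4) ->
  jet h c0 c1 c2 c3.
Proof.
  intros Hd H; exists (Rmax M 0), (Rmin d 1); split; [|split].
  - split; [apply Rmin_pos; lra | apply Rmin_r].
  - apply Rmax_r.
  - intros z Hz; assert (Hz' : Cmod z < d) by (eapply Rlt_le_trans; [apply Hz | apply Rmin_l]).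
    eapply Rle_trans; [apply H; lra|].
    apply Rmult_le_compat_r; [apply pow_le; lra | apply Rmax_l].
Qed.

Lemma jet_ext (h k : CC -> CC) (c0 c1 c2 c3 : CC) (d : R) : 0 < d ->
  (forall z, 0 < Cmod z < d -> h z = k z) -> jet h c0 c1 c2 c3 -> jet k c0 c1 c2 c3.
Proof.
  intros Hd H [M [d' [Hd' [HM Hj]]]].
  apply (jet_intro _ _ _ _ _ M (Rmin d d')); [apply Rmin_pos; lra|].
  intros z Hz; assert (A := Rmin_l d d'); assert (B := Rmin_r d d').
  rewrite <- H by lra; apply Hj; lra.
Qed.

Lemma jet_eq (h : CC -> CC) (c0 c1 c2 c3 d0 d1 d2 d3 : CC) : jet h c0 c1 c2 c3 ->
  c0 = d0 -> c1 = d1 -> c2 = d2 -> c3 = d3 -> jet h d0 d1 d2 d3.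
Proof. intros H <- <- <- <-; exact H. Qed.

Lemma jet_const (c : CC) : jet (fun _ => c) c 0 0 0.
Proof.
  apply (jet_intro _ _ _ _ _ 0 1); [lra|]; intros z Hz.
  replace (_ - _)%C with (RtoC 0) by ring; rewrite Cmod_0; lra.
Qed.

Lemma jet_id : jet (fun z => z) 0 1 0 0.
Proof.
  apply (jet_intro _ _ _ _ _ 0 1); [lra|]; intros z Hz.
  replace (_ - _)%C with (RtoC 0) by ring; rewrite Cmod_0; lra.
Qed.

Lemma jet_small (h : CC -> CC) (M d : R) : 0 < d ->
  (forall z, 0 < Cmod z < d -> Cmod (h z) <= M * Cmod z ^ 4) -> jet h 0 0 0 0.
Proof.
  intros Hd H; apply (jet_intro _ _ _ _ _ M d Hd); intros z Hz.
  replace (h z - _)%C with (h z) by ring; apply H, Hz.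
Qed.

Lemma jet_plus (h k : CC -> CC) (c0 c1 c2 c3 d0 d1 d2 d3 : CC) :
  jet h c0 c1 c2 c3 -> jet k d0 d1 d2 d3 ->
  jet (fun z => h z + k z)%C (c0 + d0) (c1 + d1) (c2 + d2) (c3 + d3).
Proof.
  intros [M [d [Hd [HM H]]]] [M' [d' [Hd' [HM' H']]]].
  apply (jet_intro _ _ _ _ _ (M + M') (Rmin d d')); [apply Rmin_pos; lra|].
  intros z Hz; assert (A := Rmin_l d d'); assert (B := Rmin_r d d').
  specialize (H z ltac:(lra)); specialize (H' z ltac:(lra)).
  replace (_ - _)%C with ((h z - (c0 + c1 * z + c2 * z ^ 2 + c3 * z ^ 3))
     + (k z - (d0 + d1 * z + d2 * z ^ 2 + d3 * z ^ 3)))%C by ring.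
  eapply Rle_trans; [apply Cmod_triangle|]; lra.
Qed.

Lemma cubic_bound (c0 c1 c2 c3 z : CC) : Cmod z <= 1 ->
  Cmod (c0 + c1 * z + c2 * z ^ 2 + c3 * z ^ 3)%C <= Cmod c0 + Cmod c1 + Cmod c2 + Cmod c3.
Proof.
  intros Hz; assert (P := Cmod_ge_0 z).
  assert (P2 : Cmod z ^ 2 <= 1) by (simpl; nra).
  assert (P3 : Cmod z ^ 3 <= 1) by (simpl in *; nra).
  eapply Rle_trans; [apply Cmod_triangle|].
  eapply Rle_trans; [apply Rplus_le_compat_r, Cmod_triangle|].
  eapply Rle_trans; [apply Rplus_le_compat_r, Rplus_le_compat_r, Cmod_triangle|].
  rewrite !Cmod_mult, !Cmod_pow.
  assert (Q1 := Cmod_ge_0 c1); assert (Q2 := Cmod_ge_0 c2); assert (Q3 := Cmod_ge_0 c3). nra.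
Qed.

Lemma jet_mult (h k : CC -> CC) (c0 c1 c2 c3 d0 d1 d2 d3 : CC) :
  jet h c0 c1 c2 c3 -> jet k d0 d1 d2 d3 ->
  jet (fun z => h z * k z)%C (c0 * d0) (c0 * d1 + c1 * d0) (c0 * d2 + c1 * d1 + c2 * d0)
    (c0 * d3 + c1 * d2 + c2 * d1 + c3 * d0).
Proof.
  intros [M [d [Hd [HM H]]]] [M' [d' [Hd' [HM' H']]]].
  pose (C := Cmod c0 + Cmod c1 + Cmod c2 + Cmod c3).
  pose (D := Cmod d0 + Cmod d1 + Cmod d2 + Cmod d3).
  (* Bounds the terms of degree 4 to 6 in the product of the two polynomials; the zero completes the
     cubic pattern of [cubic_bound]. *)
  pose (E := Cmod (c1 * d3 + c2 * d2 + c3 * d1) + Cmod (c2 * d3 + c3 * d2) + Cmod (c3 * d3) + Cmod 0).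
  assert (HC : 0 <= C) by (unfold C; repeat apply Rplus_le_le_0_compat; apply Cmod_ge_0).
  assert (HD : 0 <= D) by (unfold D; repeat apply Rplus_le_le_0_compat; apply Cmod_ge_0).
  apply (jet_intro _ _ _ _ _ (M * (D + M') + C * M' + E) (Rmin d d')); [apply Rmin_pos; lra|].
  intros z Hz; assert (A := Rmin_l d d'); assert (B := Rmin_r d d').
  specialize (H z ltac:(lra)); specialize (H' z ltac:(lra)).
  set (P := (c0 + c1 * z + c2 * z ^ 2 + c3 * z ^ 3)%C) in *.
  set (Q := (d0 + d1 * z + d2 * z ^ 2 + d3 * z ^ 3)%C) in *.
  replace (_ - _)%C with ((h z - P) * (Q + (k z - Q)) + P * (k z - Q) + z ^ 4 *
     ((c1 * d3 + c2 * d2 + c3 * d1) + (c2 * d3 + c3 * d2) * z + (c3 * d3) * z ^ 2 + 0 * z ^ 3))%C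
    by (unfold P, Q; ring).
  assert (HP : Cmod P <= C) by (apply cubic_bound; lra).
  assert (HQ : Cmod Q <= D) by (apply cubic_bound; lra).
  assert (HE : Cmod ((c1 * d3 + c2 * d2 + c3 * d1) + (c2 * d3 + c3 * d2) * z + (c3 * d3) * z ^ 2 + 0 * z ^ 3)%C <= E)
    by (apply cubic_bound; lra).
  assert (Z4 : 0 <= Cmod z ^ 4 <= 1).
  { split; [apply pow_le; lra|]; rewrite <- (pow1 4); apply pow_incr; lra. }
  assert (HQ' : Cmod (Q + (k z - Q))%C <= D + M').
  { eapply Rle_trans; [apply Cmod_triangle|].
    assert (M' * Cmod z ^ 4 <= M') by nra. lra. }
  eapply Rle_trans; [apply Cmod_triangle|].
  eapply Rle_trans; [apply Rplus_le_compat_r, Cmod_triangle|].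
  rewrite !Cmod_mult, Cmod_pow.
  assert (T1 : Cmod (h z - P) * Cmod (Q + (k z - Q)) <= M * Cmod z ^ 4 * (D + M'))
    by (apply Rmult_le_compat; try apply Cmod_ge_0; assumption).
  assert (T2 : Cmod P * Cmod (k z - Q) <= C * (M' * Cmod z ^ 4))
    by (apply Rmult_le_compat; try apply Cmod_ge_0; assumption).
  assert (T3 := Rmult_le_compat_l _ _ _ (proj1 Z4) HE). lra.
Qed.

Lemma jet_scal (c : CC) (h : CC -> CC) (c0 c1 c2 c3 : CC) : jet h c0 c1 c2 c3 ->
  jet (fun z => c * h z)%C (c * c0) (c * c1) (c * c2) (c * c3).
Proof.
  intros H; eapply jet_eq; [apply jet_mult; [apply jet_const | exact H] | ring ..].
Qed.

(** One step of the uniqueness of jets: small positive reals [z = e] force the constant term to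
    vanish, and division by [z] lowers the order by one. *)
Lemma coef_zero (d0 : CC) (q : CC -> CC) (M B d : R) (n : nat) : 0 < d <= 1 ->
  (forall z, Cmod z <= 1 -> Cmod (q z) <= B) ->
  (forall z, 0 < Cmod z < d -> Cmod (d0 + z * q z)%C <= M * Cmod z ^ S n) ->
  d0 = 0 /\ (forall z, 0 < Cmod z < d -> Cmod (q z) <= M * Cmod z ^ n).
Proof.
  intros Hd Hq H.
  assert (E : d0 = 0).
  { apply (is_zero_of_small _ (Rmax M 0 + B) d ltac:(lra)); intros e He.
    specialize (H e); specialize (Hq e).
    rewrite Cmod_R, Rabs_pos_eq in H, Hq by lra.
    specialize (H ltac:(lra)); specialize (Hq ltac:(lra)).
    assert (T := Cmod_triangle_inv' d0 (e * q e)).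
    rewrite Cmod_mult, Cmod_R, Rabs_pos_eq in T by lra.
    assert (Hpow : 0 <= e ^ n <= 1)
      by (split; [apply pow_le; lra | rewrite <- (pow1 n); apply pow_incr; lra]).
    simpl in H.
    assert (M * (e * e ^ n) <= Rmax M 0 * e).
    { assert (M <= Rmax M 0) by apply Rmax_l; assert (0 <= Rmax M 0) by apply Rmax_r.
      assert (0 <= e * e ^ n <= e) by nra. nra. }
    nra. }
  split; [exact E|]; intros z Hz; specialize (H z Hz).
  rewrite E, Cplus_0_l, Cmod_mult in H; simpl in H.
  apply Rmult_le_reg_l with (Cmod z); [lra|]; lra.
Qed.

Lemma jet_unique (h : CC -> CC) (c0 c1 c2 c3 d0 d1 d2 d3 : CC) :
  jet h c0 c1 c2 c3 -> jet h d0 d1 d2 d3 -> c0 = d0 /\ c1 = d1 /\ c2 = d2 /\ c3 = d3.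
Proof.
  intros H H'.
  assert (H0 := jet_plus _ _ _ _ _ _ _ _ _ _ H (jet_scal (- (1)) _ _ _ _ _ H')).
  destruct H0 as [M [d [Hd [HM H0]]]].
  assert (Z : forall a b : CC, (a + - (1) * b)%C = 0 -> a = b).
  { intros a b E; apply Ceq_minus; rewrite <- E; ring. }
  set (e0 := (c0 + - (1) * d0)%C) in *; set (e1 := (c1 + - (1) * d1)%C) in *.
  set (e2 := (c2 + - (1) * d2)%C) in *; set (e3 := (c3 + - (1) * d3)%C) in *.
  assert (B : forall a b c e : CC, exists B, forall z, Cmod z <= 1 ->
    Cmod (a + b * z + c * z ^ 2 + e * z ^ 3)%C <= B)
    by (intros a b c e; eexists; intros z Hz; apply cubic_bound, Hz).
  destruct (B e1 e2 e3 0) as [B1 HB1]; destruct (B e2 e3 0 0) as [B2 HB2].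
  destruct (B e3 0 0 0) as [B3 HB3]; destruct (B 0 0 0 0) as [B4 HB4].
  destruct (coef_zero e0 _ M B1 d 3 Hd HB1) as [E0 K1].
  { intros z Hz; rewrite <- (Cmod_opp (_ + _)); eapply Rle_trans; [right|apply H0, Hz].
    f_equal; ring. }
  destruct (coef_zero e1 _ M B2 d 2 Hd HB2) as [E1 K2].
  { intros z Hz; eapply Rle_trans; [right|apply K1, Hz]; f_equal; ring. }
  destruct (coef_zero e2 _ M B3 d 1 Hd HB3) as [E2 K3].
  { intros z Hz; eapply Rle_trans; [right|apply K2, Hz]; f_equal; ring. }
  destruct (coef_zero e3 _ M B4 d 0 Hd HB4) as [E3 _].
  { intros z Hz; eapply Rle_trans; [right|apply K3, Hz]; f_equal; ring. }
  repeat split; apply Z; assumption.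
Qed.

Lemma jet_linear_bound (h : CC -> CC) (c1 c2 c3 : CC) : jet h 0 c1 c2 c3 ->
  exists M d, 0 < d /\ 0 <= M /\ forall z, 0 < Cmod z < d -> Cmod (h z) <= M * Cmod z.
Proof.
  intros [M [d [Hd [HM H]]]].
  exists (M + (Cmod c1 + Cmod c2 + Cmod c3 + Cmod 0)), d; split; [lra|]; split.
  { repeat apply Rplus_le_le_0_compat; try apply Cmod_ge_0; exact HM. }
  intros z Hz; specialize (H z Hz).
  assert (B := cubic_bound c1 c2 c3 0 z ltac:(lra)).
  assert (Z4 : Cmod z ^ 4 <= Cmod z).
  { assert (Cmod z ^ 3 <= 1) by (rewrite <- (pow1 3); apply pow_incr; lra). simpl in *; nra. }
  replace (h z) with ((h z - (0 + c1 * z + c2 * z ^ 2 + c3 * z ^ 3)) +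
     z * (c1 + c2 * z + c3 * z ^ 2 + 0 * z ^ 3))%C by ring.
  eapply Rle_trans; [apply Cmod_triangle|]; rewrite Cmod_mult. nra.
Qed.

(** Stands in for a composition rule: the polynomial part of an outer function is expanded by
    [jet_mult], so only its error [O(u^4)] has to be composed. *)
Lemma jet_compose_O4 (h e : CC -> CC) (c1 c2 c3 : CC) (K r : R) : jet h 0 c1 c2 c3 -> 0 < r -> 0 <= K ->
  (forall u, Cmod u <= r -> Cmod (e u) <= K * Cmod u ^ 4) -> jet (fun z => e (h z)) 0 0 0 0.
Proof.
  intros H Hr HK He.
  destruct (jet_linear_bound _ _ _ _ H) as [M [d [Hd [HM Hb]]]].
  apply (jet_small _ (K * M ^ 4) (Rmin d (r / (M + 1)))).
  { apply Rmin_pos; [exact Hd | apply Rdiv_lt_0_compat; lra]. }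
  intros z Hz.
  assert (A := Rmin_l d (r / (M + 1))); assert (B := Rmin_r d (r / (M + 1))).
  assert (Hr' : Cmod z * (M + 1) <= r) by (apply Rle_div_r; lra).
  specialize (Hb z ltac:(lra)).
  eapply Rle_trans; [apply He; nra|].
  rewrite Rmult_assoc, <- Rpow_mult_distr.
  apply Rmult_le_compat_l; [exact HK|]; apply pow_incr; split; [apply Cmod_ge_0 | exact Hb].
Qed.

Lemma taylor_jet (r : R) (h : CC -> CC) : 0 < r -> holo_le h r ->
  jet h (h 0) (tcoef r h 1) (tcoef r h 2) (tcoef r h 3).
Proof.
  intros Hr Hh; apply (jet_intro _ _ _ _ _ (2 * circ_norm r h * (/ r) ^ 4) (r / 2)); [lra|].
  intros z Hz; rewrite <- (tcoef_0 r h Hr Hh).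
  assert (B := taylor_bound r h z 4 Hr Hh ltac:(lra)).
  unfold Rdiv in B; rewrite Rpow_mult_distr in B.
  replace (_ * _ * (/ r) ^ 4 * Cmod z ^ 4) with (2 * circ_norm r h * (Cmod z ^ 4 * (/ r) ^ 4)) by ring.
  eapply Rle_trans; [right|exact B]; f_equal; simpl; ring.
Qed.

(** Jets stop at third order, whereas [A 4] involves the fourth coefficient of [f]; dividing by [z]
    brings it within reach. *)
Lemma taylor_jet_div (r : R) (h : CC -> CC) : 0 < r -> holo_le h r -> h 0 = 0 ->
  jet (fun z => h z / z)%C (tcoef r h 1) (tcoef r h 2) (tcoef r h 3) (tcoef r h 4).
Proof.
  intros Hr Hh H0; apply (jet_intro _ _ _ _ _ (2 * circ_norm r h * (/ r) ^ 5) (r / 2)); [lra|].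
  intros z Hz.
  assert (Nz : z <> 0) by (apply Cmod_gt_0; lra).
  assert (B := taylor_bound r h z 5 Hr Hh ltac:(lra)).
  unfold Rdiv in B; rewrite Rpow_mult_distr in B.
  simpl csum in B; rewrite (tcoef_0 r h Hr Hh), H0 in B.
  replace (h z / z - _)%C with ((h z - (0 + 0 * z ^ 0 + tcoef r h 1 * z ^ 1 + tcoef r h 2 * z ^ 2 +
    tcoef r h 3 * z ^ 3 + tcoef r h 4 * z ^ 4)) / z)%C by (simpl; field; exact Nz).
  rewrite Cmod_div by exact Nz.
  apply Rle_div_l; [lra|].
  eapply Rle_trans; [exact B|]; right; simpl; ring.
Qed.

(** * The complex exponential and logarithm *)


Definition Cexp (z : CC) : CC := (exp (fst z) * cos (snd z), exp (fst z) * sin (snd z)).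

Lemma Cexp_0 : Cexp 0 = 1.
Proof. unfold Cexp; apply injective_projections; simpl; rewrite exp_0, ?cos_0, ?sin_0; ring. Qed.

Lemma Cexp_plus (z w : CC) : Cexp (z + w) = (Cexp z * Cexp w)%C.
Proof.
  unfold Cexp; apply injective_projections; simpl; rewrite exp_plus, ?cos_plus, ?sin_plus; ring.
Qed.

Lemma Cmod_Cexp (z : CC) : Cmod (Cexp z) = exp (fst z).
Proof.
  unfold Cmod, Cexp; simpl fst; simpl snd.
  replace ((exp (fst z) * cos (snd z)) ^ 2 + (exp (fst z) * sin (snd z)) ^ 2) with (exp (fst z) ^ 2).
  - apply sqrt_pow2; left; apply exp_pos.
  - assert (E := sin2_cos2 (snd z)); unfold Rsqr in E.
    transitivity (exp (fst z) ^ 2 * (sin (snd z) * sin (snd z) + cos (snd z) * cos (snd z)));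
      [rewrite E|]; ring.
Qed.

Lemma Cexp_neq_0 (z : CC) : Cexp z <> 0.
Proof. apply Cmod_gt_0; rewrite Cmod_Cexp; apply exp_pos. Qed.

Lemma Cexp_opp (z : CC) : Cexp (- z) = (/ Cexp z)%C.
Proof.
  assert (E : (Cexp (- z) * Cexp z)%C = 1).
  { rewrite <- Cexp_plus, <- Cexp_0; f_equal; ring. }
  replace (Cexp (- z))%C with (Cexp (- z) * Cexp z * / Cexp z)%C by (field; apply Cexp_neq_0).
  rewrite E; ring.
Qed.

Lemma cderiv_Cexp_0 : cderiv Cexp 0 1%C.
Proof.
  assert (D1 : rderiv (fun x => RtoC (exp x)) 0 1%C).
  { split; simpl; [|auto_derive; auto].
    auto_derive; auto; rewrite exp_0; ring. }
  assert (D2 : rderiv (fun y => (cos y, sin y)) 0 Ci).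
  { split; simpl; auto_derive; auto; rewrite ?cos_0, ?sin_0; ring. }
  apply cderiv_eps; intros e He.
  rewrite rderiv_eps in D1, D2.
  assert (He4 : 0 < Rmin (e / 4) 1) by (apply Rmin_pos; lra).
  destruct (D1 _ He4) as [d1 H1]; destruct (D2 _ He4) as [d2 H2]; clear D1 D2.
  apply locally_C_iff; exists (Rmin (Rmin d1 d2) (e / 4)); split.
  { apply Rmin_pos; [apply Rmin_pos; apply cond_pos | lra]. }
  intros [x y] Hz.
  assert (E0 : forall u : CC, (u - 0)%C = u) by (intros u; ring).
  rewrite E0 in Hz |- *.
  assert (A1 := Rmin_l (Rmin d1 d2) (e / 4)); assert (A2 := Rmin_r (Rmin d1 d2) (e / 4)).
  assert (A3 := Rmin_l d1 d2); assert (A4 := Rmin_r d1 d2).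
  assert (A5 := Rmin_l (e / 4) 1); assert (A6 := Rmin_r (e / 4) 1).
  assert (Hx : Rabs x <= Cmod (x, y)) by (eapply Rle_trans; [apply Rmax_l | apply (Rmax_Cmod (x, y))]).
  assert (Hy : Rabs y <= Cmod (x, y)) by (eapply Rle_trans; [apply Rmax_r | apply (Rmax_Cmod (x, y))]).
  specialize (H1 x); specialize (H2 y).
  assert (B : forall d u : R, Rabs u < d -> Rabs (minus u 0) < d).
  { intros d u Hu; change (minus u 0) with (u + - 0); replace (u + - 0) with u by ring; exact Hu. }
  assert (G1 := H1 (B d1 x ltac:(lra))); assert (G2 := H2 (B d2 y ltac:(lra))).
  rewrite exp_0 in G1; rewrite cos_0, sin_0 in G2.
  replace (x - 0) with x in G1 by ring; replace (y - 0) with y in G2 by ring.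
  set (a := (RtoC (exp x) - RtoC 1 - (x - 0) * 1)%C) in G1.
  set (b := (((cos y, sin y) : CC) - (1, 0) - (y - 0) * Ci)%C) in G2.
  (* [e^z - 1 - z = (e^x - 1 - x) e^(iy) + (e^(iy) - 1 - iy) + x (e^(iy) - 1)]; the last term is
     quadratic. *)
  replace (Cexp (x, y) - Cexp 0 - (x, y) * 1)%C with (a * (cos y, sin y) + b + x * (b + y * Ci))%C.
  2:{ rewrite Cexp_0; unfold a, b, Cexp; apply injective_projections; simpl; ring. }
  assert (Hcs : Cmod (cos y, sin y) = 1).
  { replace ((cos y, sin y) : CC) with (Cexp (0, y))
      by (unfold Cexp; simpl; rewrite exp_0, !Rmult_1_l; reflexivity).
    rewrite Cmod_Cexp; apply exp_0. }
  eapply Rle_trans; [apply Cmod_triangle|].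
  eapply Rle_trans; [apply Rplus_le_compat_r, Cmod_triangle|].
  rewrite !Cmod_mult, Hcs, Cmod_R.
  assert (T : Cmod (b + y * Ci) <= 2 * Cmod (x, y)).
  { eapply Rle_trans; [apply Cmod_triangle|]; rewrite Cmod_mult, Cmod_Ci, Cmod_R.
    assert (Rabs y >= 0) by (apply Rle_ge, Rabs_pos). nra. }
  assert (P := Cmod_ge_0 (x, y)); assert (Px := Rabs_pos x); assert (Py := Rabs_pos y).
  assert (Pb := Cmod_ge_0 (b + y * Ci)).
  assert (T2 : Rabs x * Cmod (b + y * Ci) <= Cmod (x, y) * (2 * Cmod (x, y)))
    by (apply Rmult_le_compat; assumption).
  assert (M1 : Cmod a <= e / 4 * Cmod (x, y)) by nra.
  assert (M2 : Cmod b <= e / 4 * Cmod (x, y)) by nra.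
  nra.
Qed.

Lemma cderiv_Cexp (z : CC) : cderiv Cexp z (Cexp z).
Proof.
  apply cderiv_ext with (fun y => Cexp z * Cexp (y - z))%C.
  { intros y; rewrite <- Cexp_plus; f_equal; ring. }
  apply cderiv_eq with (0 * Cexp (z - z) + Cexp z * ((1 - 0) * 1))%C; [|ring].
  apply (cderiv_mult (fun _ => Cexp z) (fun y => Cexp (y - z)%C)); [apply cderiv_const|].
  apply (cderiv_comp (fun y => y - z)%C Cexp).
  - apply cderiv_minus; [apply cderiv_id | apply cderiv_const].
  - replace (z - z)%C with (RtoC 0) by ring; apply cderiv_Cexp_0.
Qed.

(** One integration of a Taylor remainder by the mean value inequality. The constant 3, a bound of
    [|e^u|] on the unit disc, is carried along without the gain [1 / (n + 1)]. *)
Lemma Cexp_taylor_step (F F' : CC -> CC) (n : nat) :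
  (forall z, cderiv F z (F' z)) -> F 0 = 0 ->
  (forall z, Cmod z <= 1 -> Cmod (F' z) <= 3 * Cmod z ^ n) ->
  forall z, Cmod z <= 1 -> Cmod (F z) <= 3 * Cmod z ^ S n.
Proof.
  intros HF H0 Hb z Hz.
  replace (F z) with (F (0 + z)%C - F 0)%C by (rewrite H0, Cplus_0_l; ring).
  replace (3 * Cmod z ^ S n) with (3 * Cmod z ^ n * Cmod z) by (simpl; ring).
  apply (mean_value_ineq F F'); [intros; apply HF|].
  intros t Ht.
  assert (E : Cmod (0 + t * z)%C <= Cmod z).
  { rewrite Cplus_0_l, Cmod_mult, Cmod_R, Rabs_pos_eq by lra.
    generalize (Cmod_ge_0 z); nra. }
  eapply Rle_trans; [apply Hb; lra|].
  apply Rmult_le_compat_l; [lra|]; apply pow_incr; split; [apply Cmod_ge_0 | exact E].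
Qed.

Lemma Cexp_taylor4 (z : CC) : Cmod z <= 1 ->
  Cmod (Cexp z - (1 + z + z ^ 2 / 2 + z ^ 3 / 6 + z ^ 4 / 24))%C <= 3 * Cmod z ^ 5.
Proof.
  assert (N : forall x : R, x <> 0 -> RtoC x <> 0) by (intros x Hx E; apply RtoC_inj in E; auto).
  assert (N2 := N 2 ltac:(lra)); assert (N3 := N 3 ltac:(lra)); assert (N4 := N 4 ltac:(lra)).
  assert (N6 := N 6 ltac:(lra)); assert (N24 := N 24 ltac:(lra)).
  assert (S0 : forall z, Cmod z <= 1 -> Cmod (Cexp z) <= 3 * Cmod z ^ 0).
  { intros u Hu; rewrite Cmod_Cexp; simpl; rewrite Rmult_1_r.
    eapply Rle_trans; [|apply exp_le_3].
    assert (fst u <= 1).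
    { eapply Rle_trans; [|exact Hu].
      eapply Rle_trans; [apply Rle_abs|]; eapply Rle_trans; [apply Rmax_l | apply Rmax_Cmod]. }
    destruct (Rle_lt_or_eq_dec (fst u) 1) as [L|L]; [assumption | left; apply exp_increasing, L | rewrite L; lra]. }
  assert (D := cderiv_Cexp).
  assert (D2 : forall z, cderiv (fun z => z ^ 2)%C z (2 * z)%C).
  { intros u; apply cderiv_ext with (fun z => z * z)%C; [intros y; simpl; ring|].
    cderiv_calc; ring. }
  assert (D3 : forall z, cderiv (fun z => z ^ 3)%C z (3 * z ^ 2)%C).
  { intros u; apply cderiv_ext with (fun z => z * z ^ 2)%C; [intros y; simpl; ring|].
    specialize (D2 u); cderiv_calc; simpl; ring. }
  assert (D4 : forall z, cderiv (fun z => z ^ 4)%C z (4 * z ^ 3)%C).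
  { intros u; apply cderiv_ext with (fun z => z * z ^ 3)%C; [intros y; simpl; ring|].
    specialize (D3 u); cderiv_calc; simpl; ring. }
  pose (F1 := fun z => (Cexp z - 1)%C).
  pose (F2 := fun z => (Cexp z - (1 + z))%C).
  pose (F3 := fun z => (Cexp z - (1 + z + z ^ 2 / 2))%C).
  pose (F4 := fun z => (Cexp z - (1 + z + z ^ 2 / 2 + z ^ 3 / 6))%C).
  pose (F5 := fun z => (Cexp z - (1 + z + z ^ 2 / 2 + z ^ 3 / 6 + z ^ 4 / 24))%C).
  assert (S1 := Cexp_taylor_step F1 Cexp 0); assert (S2 := Cexp_taylor_step F2 F1 1).
  assert (S3 := Cexp_taylor_step F3 F2 2); assert (S4 := Cexp_taylor_step F4 F3 3).
  assert (S5 := Cexp_taylor_step F5 F4 4).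
  unfold F1, F2, F3, F4, F5 in *.
  assert (Z0 : forall n, (RtoC 0 ^ S n)%C = 0) by (intros n; simpl; ring).
  apply S5; [ | rewrite Cexp_0, !Z0; field; auto | apply S4;
    [ | rewrite Cexp_0, !Z0; field; auto | apply S3;
      [ | rewrite Cexp_0, !Z0; field; auto | apply S2; [ | rewrite Cexp_0; ring | apply S1; [ | rewrite Cexp_0; ring | exact S0]]]]];
  intros u; specialize (D u); specialize (D2 u); specialize (D3 u); specialize (D4 u);
    cderiv_calc; solve [auto | field; auto].
Qed.

(** [Psi] read in the variable [u = ln (1 + z)], by [Psi_Cexpq]; it is also the derivative of
    [Ein]. *)
Definition Cexpq (u : CC) : CC := if Ceq_dec u 0 then 1%C else ((Cexp u - 1) / u)%C.

Lemma Cexpq_mult (u : CC) : (Cexpq u * u = Cexp u - 1)%C.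
Proof.
  unfold Cexpq; destruct (Ceq_dec u 0) as [->|N]; [rewrite Cexp_0; ring | field; exact N].
Qed.

Lemma Cexpq_taylor3 (u : CC) : Cmod u <= 1 ->
  Cmod (Cexpq u - (1 + u / 2 + u ^ 2 / 6 + u ^ 3 / 24))%C <= 3 * Cmod u ^ 4.
Proof.
  intros Hu; destruct (Ceq_dec u 0) as [E|N].
  - unfold Cexpq; destruct (Ceq_dec u 0) as [_|N]; [|contradiction].
    rewrite E; replace (_ - _)%C with (RtoC 0)
      by (field; repeat split; intros E'; apply RtoC_inj in E'; lra).
    rewrite Cmod_0; simpl; lra.
  - assert (T := Cexp_taylor4 u Hu).
    replace (Cexp u) with (1 + Cexpq u * u)%C in T by (rewrite Cexpq_mult; ring).
    replace (_ - _)%C with (u * (Cexpq u - (1 + u / 2 + u ^ 2 / 6 + u ^ 3 / 24)))%C in T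
      by (field; repeat split; intros E'; apply RtoC_inj in E'; lra).
    rewrite Cmod_mult in T.
    assert (P : 0 < Cmod u) by (apply Cmod_gt_0, N).
    apply Rmult_le_reg_l with (Cmod u); [exact P|]; simpl in *; lra.
Qed.

Lemma Cln_Cexp (z : CC) : - PI < snd z < PI -> Cln (Cexp z) = z.
Proof.
  intros Hz; unfold Cln; rewrite Cmod_Cexp, ln_exp; destruct z as [x y]; simpl in *.
  f_equal; unfold Carg; rewrite Cmod_Cexp; simpl.
  assert (P := exp_pos x).
  replace (exp x * cos y / exp x) with (cos y) by (field; lra).
  destruct (Rle_dec 0 (exp x * sin y)) as [H|H].
  - assert (Hs : 0 <= sin y) by nra.
    destruct (Rle_dec 0 y) as [Hy|Hy]; [apply acos_cos; lra|].
    assert (S := sin_gt_0 (- y) ltac:(lra) ltac:(lra)); rewrite sin_neg in S; lra.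
  - assert (Hs : sin y < 0) by nra.
    destruct (Rle_dec 0 y) as [Hy|Hy].
    + assert (S := sin_ge_0 y ltac:(lra) ltac:(lra)); lra.
    + rewrite <- (cos_neg y), acos_cos by lra; ring.
Qed.

Lemma Cmod_pos_of_Re (z : CC) : 0 < fst z -> 0 < Cmod z.
Proof. intros Hz; apply Cmod_gt_0; intros ->; simpl in Hz; lra. Qed.

Lemma Cexp_polar (z : CC) : 0 < fst z -> Cexp (ln (Cmod z), atan (snd z / fst z)) = z.
Proof.
  intros Hz; assert (Hm := Cmod_pos_of_Re z Hz).
  unfold Cexp; cbn [fst snd]; rewrite exp_ln by exact Hm.
  rewrite cos_atan, sin_atan.
  assert (E : sqrt (1 + (snd z / fst z)²) = Cmod z / fst z).
  { unfold Cmod; rewrite <- (sqrt_pow2 (fst z)) at 3 by lra.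
    rewrite <- sqrt_div_alt by (apply pow_lt, Hz).
    f_equal; unfold Rsqr; field; lra. }
  rewrite E; destruct z as [x y]; cbn [fst snd] in *; f_equal; field; lra.
Qed.

(** [Carg] is given by [acos] and a sign test, from which continuity is awkward to obtain; in the
    right half-plane, where [1 + z] lies for [|z| < 1], the arctangent replaces it. *)
Lemma Cln_right_half_plane (z : CC) : 0 < fst z -> Cln z = (ln (Cmod z), atan (snd z / fst z)).
Proof.
  intros Hz.
  assert (Hb := atan_bound (snd z / fst z)); assert (HPI := PI_RGT_0).
  rewrite <- (Cexp_polar z Hz) at 1; apply Cln_Cexp; simpl; lra.
Qed.

Lemma Cln_Im_bound (z : CC) : 0 < fst z -> - PI / 2 < snd (Cln z) < PI / 2.
Proof. intros Hz; rewrite Cln_right_half_plane by exact Hz; apply atan_bound. Qed.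

Lemma Cexp_Cln (z : CC) : 0 < fst z -> Cexp (Cln z) = z.
Proof. intros Hz; rewrite Cln_right_half_plane by exact Hz; apply Cexp_polar, Hz. Qed.

Lemma Cln_1 : Cln 1 = 0.
Proof.
  rewrite <- Cexp_0; apply Cln_Cexp; simpl; generalize PI_RGT_0; lra.
Qed.

Lemma locally_Re_pos (z : CC) : 0 < fst z -> locally z (fun y => 0 < fst y).
Proof.
  intros Hz; apply locally_C_iff; exists (fst z); split; [exact Hz|].
  intros y Hy.
  assert (H : Rabs (fst (y - z)%C) < fst z).
  { eapply Rle_lt_trans; [|exact Hy]; eapply Rle_trans; [apply Rmax_l | apply Rmax_Cmod]. }
  apply Rabs_lt_between in H; simpl in H; lra.
Qed.

Lemma cderiv_Cln (z : CC) : 0 < fst z -> cderiv Cln z (/ z)%C.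
Proof.
  intros Hz.
  assert (Hl := locally_Re_pos z Hz).
  assert (Hm := Cmod_pos_of_Re z Hz).
  replace (/ z)%C with (/ Cexp (Cln z))%C by (rewrite Cexp_Cln by exact Hz; reflexivity).
  apply (cderiv_inverse Cexp Cln).
  - revert Hl; apply filter_imp; intros y Hy; apply Cexp_Cln, Hy.
  - apply ccont_ext_loc with (fun z => (ln (Cmod z), atan (snd z / fst z))).
    { revert Hl; apply filter_imp; intros y Hy; symmetry; apply Cln_right_half_plane, Hy. }
    destruct (ccont_id z) as [C1 C2]; split; simpl.
    + apply (continuous_comp (fun z : CC => Cmod z) ln); [apply continuous_Cmod, ccont_id|].
      apply (ex_derive_continuous (K := R_AbsRing) (V := R_NormedModule)); eexists; apply is_derive_ln, Hm.
    + apply (continuous_comp (fun z : CC => snd z / fst z) atan).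
      * unfold Rdiv; apply (continuous_mult (K := R_AbsRing)); [exact C2|].
        apply (continuous_comp _ Rinv); [exact C1 | apply continuous_Rinv; lra].
      * apply (ex_derive_continuous (K := R_AbsRing) (V := R_NormedModule)); eexists; apply is_derive_atan.
  - apply cderiv_Cexp.
  - apply Cexp_neq_0.
Qed.

Lemma Cexp_eq_1 (z : CC) : Cexp z = 1 -> exists k : Z, z = (0, 2 * PI * IZR k).
Proof.
  intros E.
  assert (Hx : fst z = 0).
  { assert (M := Cmod_Cexp z); rewrite E, Cmod_1 in M.
    rewrite <- ln_1, M; symmetry; apply ln_exp. }
  destruct z as [x y]; simpl in Hx; subst x.
  unfold Cexp in E; cbn [fst snd] in E; rewrite exp_0 in E.
  assert (Ec : cos y = 1) by (apply (f_equal fst) in E; simpl in E; lra).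
  destruct (sin_eq_0_0 (y / 2)) as [k Hk].
  { assert (D := cos_2a_sin (y / 2)); replace (2 * (y / 2)) with y in D by field.
    rewrite Ec in D; nra. }
  exists k; f_equal; lra.
Qed.

(** * Coefficients of the inverse function *)


Lemma eventually_bounded (u : nat -> R) (K : R) (N : nat) : (forall n, 0 <= u n) ->
  (forall n, (N <= n)%nat -> u n <= K) -> exists K', 0 <= K' /\ forall n, u n <= K'.
Proof.
  intros Hu; revert K; induction N as [|N IH]; intros K HK.
  - exists (Rmax K 0); split; [apply Rmax_r|]; intros n.
    eapply Rle_trans; [apply HK; lia | apply Rmax_l].
  - apply (IH (Rmax K (u N))); intros n Hn.
    destruct (Nat.eq_dec n N) as [->|D]; [apply Rmax_r|].
    eapply Rle_trans; [apply HK; lia | apply Rmax_l].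
Qed.

(** Convergence at [r / 2] bounds the terms there by some [K]. For [|w| < r / 4] the ratio
    [q = 2 |w| / r] is at most [1/2], so the tail from index 5 on is at most [2 K q^5]. *)
Lemma pseries_tail_bound (A : nat -> CC) (g : CC -> CC) (r : R) : 0 < r ->
  (forall w, Cmod w < r -> @is_pseries C_AbsRing C_NormedModule A w (g w)) ->
  exists M d, 0 < d /\ 0 <= M /\
    forall w, Cmod w < d -> Cmod (g w - csum (fun k => A k * w ^ k) 5)%C <= M * Cmod w ^ 5.
Proof.
  intros Hr Hg.
  assert (Hr2 : Cmod (RtoC (r / 2)) = r / 2) by (rewrite Cmod_R, Rabs_pos_eq; lra).
  assert (Hb : exists K, 0 <= K /\ forall n, Cmod (A n) * (r / 2) ^ n <= K).
  { assert (Hs := Hg (RtoC (r / 2)) ltac:(lra)).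
    destruct (Hs (fun u => Cmod (u - g (RtoC (r / 2))) < 1)) as [N HN].
    { apply locally_C_iff; exists 1; split; [lra | auto]. }
    apply (eventually_bounded _ 2 (S N)).
    - intros n; apply Rmult_le_pos; [apply Cmod_ge_0 | apply pow_le; lra].
    - intros n Hn.
      rewrite <- Hr2 at 1; rewrite <- Cmod_pow, <- Cmod_mult.
      destruct n as [|n]; [lia|].
      assert (H1 := HN n ltac:(lia)); assert (H2 := HN (S n) ltac:(lia)).
      rewrite sum_n_csum in H1, H2.
      replace (A (S n) * RtoC (r / 2) ^ S n)%C
        with ((csum (fun k => A k * RtoC (r / 2) ^ k) (S (S n)) - g (RtoC (r / 2)))
           - (csum (fun k => A k * RtoC (r / 2) ^ k) (S n) - g (RtoC (r / 2))))%C
        by (cbn [csum]; ring).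
      eapply Rle_trans; [apply Cmod_triangle_sub|]; lra. }
  destruct Hb as [K [HK Hb]].
  exists (2 * K * (2 / r) ^ 5), (r / 4); split; [lra|]; split.
  { apply Rmult_le_pos; [lra | apply pow_le; left; apply Rdiv_lt_0_compat; lra]. }
  intros w Hw.
  pose (q := 2 / r * Cmod w).
  assert (Hq : 0 <= q <= / 2).
  { unfold q; split.
    - apply Rmult_le_pos; [left; apply Rdiv_lt_0_compat; lra | apply Cmod_ge_0].
    - replace (2 / r * Cmod w) with (2 * Cmod w / r) by (field; lra); apply Rle_div_l; lra. }
  assert (Hterm : forall n, Cmod (A n * w ^ n) <= K * q ^ n).
  { intros n; rewrite Cmod_mult, Cmod_pow; unfold q; rewrite Rpow_mult_distr.
    replace (Cmod (A n) * Cmod w ^ n) with (Cmod (A n) * (r / 2) ^ n * ((2 / r) ^ n * Cmod w ^ n)).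
    - apply Rmult_le_compat_r; [|apply Hb].
      rewrite <- Rpow_mult_distr; apply pow_le, Hq.
    - transitivity (Cmod (A n) * Cmod w ^ n * ((r / 2) * (2 / r)) ^ n);
        [rewrite Rpow_mult_distr; ring|].
      replace (r / 2 * (2 / r)) with 1 by (field; lra); rewrite pow1; ring. }
  assert (Q5 : 0 <= K * q ^ 5) by (apply Rmult_le_pos; [exact HK | apply pow_le, Hq]).
  replace (2 * K * (2 / r) ^ 5 * Cmod w ^ 5) with (2 * (K * q ^ 5))
    by (unfold q; rewrite Rpow_mult_distr; ring).
  assert (Hpart : forall m, Cmod (csum (fun k => A k * w ^ k) (m + 5) - csum (fun k => A k * w ^ k) 5)%C
     <= 2 * (K * q ^ 5) * (1 - (/ 2) ^ m)).
  { induction m as [|m IH].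
    - change (0 + 5)%nat with 5%nat; replace (_ - _)%C with (RtoC 0) by ring; rewrite Cmod_0; simpl; lra.
    - change (S m + 5)%nat with (S (m + 5)).
      replace (csum (fun k => A k * w ^ k) (S (m + 5)) - csum (fun k => A k * w ^ k) 5)%C
        with ((csum (fun k => A k * w ^ k) (m + 5) - csum (fun k => A k * w ^ k) 5) + A (m + 5)%nat * w ^ (m + 5))%C
        by (simpl csum; ring).
      eapply Rle_trans; [apply Cmod_triangle|].
      assert (T := Hterm (m + 5)%nat).
      assert (T2 : K * q ^ (m + 5) <= K * q ^ 5 * (/ 2) ^ m).
      { rewrite pow_add; replace (K * (q ^ m * q ^ 5)) with (K * q ^ 5 * q ^ m) by ring.
        apply Rmult_le_compat_l; [exact Q5 | apply pow_incr; exact Hq]. }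
      simpl pow; lra. }
  apply le_epsilon; intros e He.
  assert (Hs := Hg w ltac:(lra)).
  destruct (Hs (fun u => Cmod (u - g w) < e)) as [N HN].
  { apply locally_C_iff; exists e; split; [exact He | auto]. }
  specialize (HN (N + 4)%nat ltac:(lia)).
  change (Cmod (sum_n (fun k => scal (pow_n (K := C_AbsRing) w k) (A k : C_NormedModule)) (N + 4) - g w)%C < e) in HN.
  rewrite sum_n_csum in HN; replace (S (N + 4)) with (N + 5)%nat in HN by lia.
  specialize (Hpart N).
  assert (P2 : 0 <= (/ 2) ^ N) by (apply pow_le; lra).
  replace (g w - csum (fun k => A k * w ^ k) 5)%C
    with ((csum (fun k => A k * w ^ k) (N + 5) - csum (fun k => A k * w ^ k) 5)
          - (csum (fun k => A k * w ^ k) (N + 5) - g w))%C by ring.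
  eapply Rle_trans; [apply Cmod_triangle_sub|].
  assert (2 * (K * q ^ 5) * (1 - (/ 2) ^ N) <= 2 * (K * q ^ 5)) by nra.
  lra.
Qed.

Ltac RtoC_neq := let E := fresh in intros E; apply RtoC_inj in E; lra.
Ltac Cfield := field; repeat split; RtoC_neq.

Lemma Re_one_plus_pos (z : CC) : Cmod z < 1 -> 0 < fst (1 + z)%C.
Proof.
  intros Hz; assert (H := Re_le_Cmod (- z)); rewrite Cmod_opp in H; simpl in *; lra.
Qed.

Lemma Psi_Cexpq (z : CC) : Cmod z < 1 -> Psi z = Cexpq (Cln (1 + z)).
Proof.
  intros Hz; assert (E := Cexp_Cln _ (Re_one_plus_pos z Hz)).
  unfold Psi, Cexpq; destruct (Defs.Ceq_dec z 0) as [->|N].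
  - replace (1 + 0)%C with (RtoC 1) by ring; rewrite Cln_1.
    destruct (Ceq_dec 0 0) as [_|N]; [reflexivity | contradiction].
  - destruct (Ceq_dec (Cln (1 + z)) 0) as [E0|N0].
    + exfalso; apply N; rewrite E0, Cexp_0 in E.
      replace z with (1 + z - 1)%C by ring; rewrite <- E; ring.
    + rewrite E; f_equal; ring.
Qed.

(** Three identities are compared by [jet_unique]: [1 + w = e^L] gives the coefficients of [w] in
    terms of those of [L], [f' = (f / z) Psi(w)] those of [f], and [g (f z) = z] those of [g]. *)
Lemma inverse_coef_relation (f f' w g : CC -> CC) (A : nat -> CC) (c1 c2 c3 : CC) :
  classS f -> (forall z, inU z -> cderiv f z (f' z)) ->
  analytic_U w -> w 0 = 0 ->
  (forall z, inU z -> Cmod (w z) < 1 /\ starfun f f' z = Psi (w z)) ->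
  inverse_coeffs f g A -> jet w 0 c1 c2 c3 ->
  A 2%nat = (- c1 / 2)%C /\ A 3%nat = (5 / 12 * c1 ^ 2 - c2 / 4)%C /\
  A 4%nat = (- (c3 - 10 / 3 * c1 * c2 + 31 / 12 * c1 ^ 3) / 6)%C.
Proof.
  intros [Hf [Hinj [Hf0 Hf1]]] Hf' Hw Hw0 Hs [Hg [r0 [Hr0 Hps]]] Jw.
  assert (I0 : inU 0) by (unfold inU; rewrite Cmod_0; lra).
  assert (Hh : 0 < / 2) by lra.
  assert (Hhol : forall h, analytic_U h -> holo_le h (/ 2))
    by (intros h H z Hz; apply H; unfold inU; lra).
  (* With [L = ln (1 + w)] one has [Psi w = (e^L - 1) / L], so only the exponential series is needed. *)
  pose (L := fun z => Cln (1 + w z)%C).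
  assert (HL : analytic_U L).
  { intros z Hz; destruct (Hw z Hz) as [l Hl]; eexists; unfold L.
    apply (cderiv_comp (fun z => 1 + w z)%C Cln).
    - apply cderiv_plus; [apply cderiv_const | exact Hl].
    - apply cderiv_Cln, Re_one_plus_pos, Hs, Hz. }
  assert (HL0 : L 0 = 0).
  { unfold L; rewrite Hw0; replace (1 + 0)%C with (RtoC 1) by ring; apply Cln_1. }
  assert (EL : forall z, inU z -> (Cexp (L z) = 1 + w z)%C)
    by (intros z Hz; apply Cexp_Cln, Re_one_plus_pos, Hs, Hz).
  assert (JL := taylor_jet (/ 2) L Hh (Hhol L HL)); rewrite HL0 in JL.
  set (l1 := tcoef (/ 2) L 1) in JL; set (l2 := tcoef (/ 2) L 2) in JL; set (l3 := tcoef (/ 2) L 3) in JL.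
  assert (JL2 := jet_mult _ _ _ _ _ _ _ _ _ _ JL JL).
  assert (JL3 := jet_mult _ _ _ _ _ _ _ _ _ _ JL2 JL).
  assert (Ec : c1 = l1 /\ c2 = (l2 + l1 ^ 2 / 2)%C /\ c3 = (l3 + l1 * l2 + l1 ^ 3 / 6)%C).
  { assert (Je : jet (fun z => Cexp (L z) - (1 + L z + L z ^ 2 / 2 + L z ^ 3 / 6))%C 0 0 0 0).
    { apply (jet_compose_O4 L (fun u => Cexp u - (1 + u + u ^ 2 / 2 + u ^ 3 / 6))%C l1 l2 l3 4 1); try assumption; try lra.
      intros u Hu; assert (T := Cexp_taylor4 u Hu); assert (P := Cmod_ge_0 u).
      replace (_ - _)%C with ((Cexp u - (1 + u + u ^ 2 / 2 + u ^ 3 / 6 + u ^ 4 / 24)) + u ^ 4 * RtoC (/ 24))%C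
        by (rewrite RtoC_inv by lra; Cfield).
      eapply Rle_trans; [apply Cmod_triangle|].
      rewrite Cmod_mult, Cmod_pow, Cmod_R, Rabs_pos_eq by lra.
      assert (0 <= Cmod u ^ 4) by (apply pow_le, P).
      replace (Cmod u ^ 5) with (Cmod u * Cmod u ^ 4) in T by ring. nra. }
    assert (J := jet_plus _ _ _ _ _ _ _ _ _ _ JL (jet_plus _ _ _ _ _ _ _ _ _ _
      (jet_scal (/ 2)%C _ _ _ _ _ JL2) (jet_plus _ _ _ _ _ _ _ _ _ _ (jet_scal (/ 6)%C _ _ _ _ _ JL3) Je))).
    apply (jet_ext _ w _ _ _ _ 1 ltac:(lra)) in J.
    - destruct (jet_unique _ _ _ _ _ _ _ _ _ Jw J) as [_ [E1 [E2 E3]]].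
      rewrite E1, E2, E3; repeat split; Cfield.
    - intros z Hz; rewrite EL by (unfold inU; lra); Cfield. }
  destruct Ec as [-> [-> ->]]; clear Jw.
  assert (JS : jet (fun z => Cexpq (L z)) 1 (l1 / 2) (l2 / 2 + l1 ^ 2 / 6)
     (l3 / 2 + l1 * l2 / 3 + l1 ^ 3 / 24)).
  { assert (Je := jet_compose_O4 L (fun u => Cexpq u - (1 + u / 2 + u ^ 2 / 6 + u ^ 3 / 24))%C
      l1 l2 l3 3 1 JL Rlt_0_1 ltac:(lra) Cexpq_taylor3).
    assert (J := jet_plus _ _ _ _ _ _ _ _ _ _ (jet_plus _ _ _ _ _ _ _ _ _ _ (jet_const 1)
      (jet_scal (/ 2)%C _ _ _ _ _ JL)) (jet_plus _ _ _ _ _ _ _ _ _ _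
      (jet_scal (/ 6)%C _ _ _ _ _ JL2) (jet_plus _ _ _ _ _ _ _ _ _ _ (jet_scal (/ 24)%C _ _ _ _ _ JL3) Je))).
    apply (jet_ext _ (fun z => Cexpq (L z)) _ _ _ _ 1 ltac:(lra)) in J; [|intros z Hz; Cfield].
    eapply jet_eq; [exact J | Cfield ..]. }
  assert (Jphi := taylor_jet_div (/ 2) f Hh (Hhol f Hf) Hf0).
  set (a1 := tcoef (/ 2) f 1) in Jphi; set (a2 := tcoef (/ 2) f 2) in Jphi.
  set (a3 := tcoef (/ 2) f 3) in Jphi; set (a4 := tcoef (/ 2) f 4) in Jphi.
  destruct (taylor_deriv_bound (/ 2) f Hh (Hhol f Hf)) as [M HM].
  fold a1 a2 a3 a4 in HM.
  (* At [z = 0] the error bound for the derivative is 0, so [a1 = f'(0)]. *)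
  assert (E1 : a1 = 1).
  { assert (H := HM 0 1%C ltac:(rewrite Cmod_0; lra) Hf1).
    rewrite Cmod_0 in H.
    replace (1 - (a1 + 2 * a2 * 0 + 3 * a3 * 0 ^ 2 + 4 * a4 * 0 ^ 3))%C with (1 - a1)%C in H by ring.
    assert (P := Cmod_ge_0 (1 - a1)).
    symmetry; apply Ceq_minus, Cmod_eq_0; simpl in H; lra. }
  assert (Jf' : jet f' a1 (2 * a2) (3 * a3) (4 * a4)).
  { apply (jet_intro _ _ _ _ _ M (/ 4)); [lra|]; intros z Hz; apply HM; [lra|].
    apply Hf'; unfold inU; lra. }
  rewrite E1 in *; clear E1 HM.
  assert (Hfz : forall z, 0 < Cmod z < 1 -> f z <> 0).
  { intros z Hz E; rewrite <- Hf0 in E; apply Hinj in E; [|unfold inU; lra | exact I0].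
    rewrite E, Cmod_0 in Hz; lra. }
  assert (J := jet_mult _ _ _ _ _ _ _ _ _ _ Jphi JS).
  apply (jet_ext _ f' _ _ _ _ 1 ltac:(lra)) in J.
  2:{ intros z Hz; destruct (Hs z ltac:(unfold inU; lra)) as [Hw1 Es].
      assert (Nz : z <> 0) by (apply Cmod_gt_0; lra).
      unfold L; rewrite <- Psi_Cexpq, <- Es by exact Hw1.
      unfold starfun; destruct (Defs.Ceq_dec z 0) as [E|_]; [contradiction|].
      field; split; [apply Hfz, Hz | exact Nz]. }
  destruct (jet_unique _ _ _ _ _ _ _ _ _ Jf' J) as [_ [E2 [E3 E4]]]; clear J Jf'.
  (* In [f' = (f / z) Psi(w)] the coefficient [a_n] occurs [n] times on the left and once on the
     right, since [Psi(0) = 1]; hence the divisors [n - 1]. *)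
  assert (Ea2 : a2 = (l1 / 2)%C) by (transitivity (2 * a2 - a2)%C; [|rewrite E2]; ring).
  rewrite Ea2 in *; clear E2.
  assert (Ea3 : a3 = (l2 / 4 + 5 / 24 * l1 ^ 2)%C)
    by (transitivity ((3 * a3 - a3) / 2)%C; [|rewrite E3]; Cfield).
  rewrite Ea3 in *; clear E3.
  assert (Ea4 : a4 = (l3 / 6 + 17 / 72 * l1 * l2 + 11 / 144 * l1 ^ 3)%C)
    by (transitivity ((4 * a4 - a4) / 3)%C; [|rewrite E4]; Cfield).
  rewrite Ea4 in *; clear E4.
  destruct (pseries_tail_bound A g r0 Hr0 Hps) as [K [d [Hd [HK Htail]]]].
  assert (G0 : g 0 = 0).
  { destruct (Hg 0) as [G1 G2]; [rewrite Cmod_0; lra|].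
    apply Hinj; [exact G1 | exact I0 | rewrite G2, Hf0; reflexivity]. }
  assert (A0 : A 0%nat = 0).
  { specialize (Htail 0); rewrite Cmod_0 in Htail; specialize (Htail Hd).
    rewrite G0 in Htail; simpl csum in Htail.
    replace (0 - _)%C with (- A 0%nat)%C in Htail by (simpl; ring).
    rewrite Cmod_opp in Htail; assert (P := Cmod_ge_0 (A 0%nat)).
    apply Cmod_eq_0; simpl in Htail; lra. }
  assert (Jf := jet_mult _ _ _ _ _ _ _ _ _ _ jet_id Jphi).
  apply (jet_ext _ f _ _ _ _ 1 ltac:(lra)) in Jf;
    [|intros z Hz; assert (Nz : z <> 0) by (apply Cmod_gt_0; lra); field; exact Nz].
  eapply jet_eq in Jf;
    [|instantiate (1 := RtoC 0); ring | reflexivity | reflexivity | reflexivity].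
  destruct (jet_linear_bound _ _ _ _ Jf) as [B [db [Hdb [HB Hfb]]]].
  (* Small enough for [f z] to lie within reach of the tail bound and in the disc [|w| < 1/4] where
     [g] is a right inverse of [f]. *)
  pose (rho := Rmin (Rmin db 1) (Rmin d (/ 4) / (B + 1))).
  assert (Hrho : 0 < rho).
  { unfold rho; repeat apply Rmin_pos; try lra.
    apply Rdiv_lt_0_compat; [apply Rmin_pos; lra | lra]. }
  assert (Hsmall : forall z, 0 < Cmod z < rho -> Cmod z < db /\ Cmod z < 1 /\ Cmod (f z) < d /\ Cmod (f z) < / 4
      /\ Cmod (f z) <= B * Cmod z).
  { intros z Hz; unfold rho in Hz.
    assert (R1 := Rmin_l (Rmin db 1) (Rmin d (/ 4) / (B + 1))).
    assert (R2 := Rmin_r (Rmin db 1) (Rmin d (/ 4) / (B + 1))).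
    assert (R3 := Rmin_l db 1); assert (R4 := Rmin_r db 1).
    assert (R5 := Rmin_l d (/ 4)); assert (R6 := Rmin_r d (/ 4)).
    assert (R7 : Cmod z < Rmin d (/ 4) / (B + 1)) by lra.
    apply Rlt_div_r in R7; [|lra].
    assert (R8 := Hfb z ltac:(lra)). repeat split; try lra; nra. }
  assert (Je : jet (fun z => (g (f z) - csum (fun k => A k * f z ^ k) 5) / z)%C 0 0 0 0).
  { apply (jet_small _ (K * B ^ 5) rho Hrho); intros z Hz.
    destruct (Hsmall z Hz) as [_ [_ [H1 [_ H2]]]].
    assert (Nz : z <> 0) by (apply Cmod_gt_0; lra).
    rewrite Cmod_div by exact Nz; apply Rle_div_l; [lra|].
    eapply Rle_trans; [apply Htail, H1|].
    replace (K * B ^ 5 * Cmod z ^ 4 * Cmod z) with (K * (B * Cmod z) ^ 5) by (rewrite Rpow_mult_distr; ring).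
    apply Rmult_le_compat_l; [exact HK|]; apply pow_incr; split; [apply Cmod_ge_0 | exact H2]. }
  assert (Jf2 := jet_mult _ _ _ _ _ _ _ _ _ _ Jf Jf).
  assert (Jf3 := jet_mult _ _ _ _ _ _ _ _ _ _ Jf2 Jf).
  (* The identity is used after division by [z]: [1 = (f z / z) (A1 + A2 f + A3 f^2 + A4 f^3) +
     O(z^4)], where third-order jets determine [A 4]. *)
  assert (JG := jet_plus _ _ _ _ _ _ _ _ _ _ (jet_plus _ _ _ _ _ _ _ _ _ _ (jet_const (A 1%nat))
      (jet_scal (A 2%nat) _ _ _ _ _ Jf)) (jet_plus _ _ _ _ _ _ _ _ _ _
      (jet_scal (A 3%nat) _ _ _ _ _ Jf2) (jet_scal (A 4%nat) _ _ _ _ _ Jf3))).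
  assert (J := jet_plus _ _ _ _ _ _ _ _ _ _ (jet_mult _ _ _ _ _ _ _ _ _ _ Jphi JG) Je).
  apply (jet_ext _ (fun _ => 1%C) _ _ _ _ rho Hrho) in J.
  2:{ intros z Hz; destruct (Hsmall z Hz) as [_ [Hz1 [_ [H2 _]]]].
      assert (Nz : z <> 0) by (apply Cmod_gt_0; lra).
      assert (Egf : g (f z) = z).
      { destruct (Hg (f z) H2) as [G1 G2]; apply Hinj in G2; [exact G2 | exact G1 | unfold inU; lra]. }
      rewrite Egf; simpl csum; rewrite A0; simpl; field; exact Nz. }
  destruct (jet_unique _ _ _ _ _ _ _ _ _ (jet_const 1) J) as [F0 [F1 [F2 F3]]]; clear J.
  assert (A1 : A 1%nat = 1) by (rewrite F0; ring).
  rewrite A1 in *; clear F0.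
  assert (A2 : A 2%nat = (- l1 / 2)%C).
  { transitivity (A 2%nat - 0)%C; [ring | rewrite F1; Cfield]. }
  rewrite A2 in *; clear F1.
  assert (A3 : A 3%nat = (5 / 12 * l1 ^ 2 - (l2 + l1 ^ 2 / 2) / 4)%C).
  { transitivity (A 3%nat - 0)%C; [ring | rewrite F2; Cfield]. }
  rewrite A3 in *; clear F2.
  split; [reflexivity|]; split; [reflexivity|].
  transitivity (A 4%nat - 0)%C; [ring | rewrite F3; Cfield].
Qed.

Theorem coefficient_bounds (f g : CC -> CC) (A : nat -> CC) : SGstar f -> inverse_coeffs f g A ->
  Cmod (A 2%nat) <= 1/2 /\ Cmod (A 3%nat) <= 5/12 /\ Cmod (A 4%nat) <= 31/72.
Proof.
  intros [HS [f' [Hf' [w [Hw [Hw0 Hs]]]]]] Hinv.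
  assert (Hj : forall r, 0 < r < 1 -> jet w 0 (tcoef r w 1) (tcoef r w 2) (tcoef r w 3)).
  { intros r Hr; rewrite <- Hw0 at 1; apply taylor_jet; [lra|].
    intros z Hz; apply Hw; unfold inU; lra. }
  assert (J2 := Hj (/ 2) ltac:(lra)).
  destruct (inverse_coef_relation f f' w g A _ _ _ HS Hf' Hw Hw0 Hs Hinv J2) as [-> [-> ->]].
  (* The coefficients at every radius [r] agree with those at [1/2], both forming the jet of [w];
     this permits [r] to tend to 1. *)
  destruct (schwarz_coef_bounds w _ _ _ Hw Hw0 (fun z Hz => proj1 (Hs z Hz))
    (fun r Hr => proj2 (jet_unique _ _ _ _ _ _ _ _ _ (Hj r Hr) J2))) as [B1 [B2 B3]].
  apply inverse_coef_bounds; assumption.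
Qed.

(** * The extremal function *)


(** Differentiability at the removable singularity comes from the Taylor estimate. It must hold at 0
    too, for Goursat's lemma is applied on triangles with a vertex there. *)
Lemma cderiv_Cexpq (u : CC) : exists l, cderiv Cexpq u l.
Proof.
  destruct (Ceq_dec u 0) as [->|N].
  - exists (/ 2)%C; apply cderiv_eps; intros e He.
    apply locally_C_iff; exists (Rmin 1 (e / 4)); split; [apply Rmin_pos; lra|].
    intros y Hy; replace (y - 0)%C with y in * by ring.
    assert (Hy1 : Cmod y < 1) by (eapply Rlt_le_trans; [exact Hy | apply Rmin_l]).
    assert (Hy2 : Cmod y < e / 4) by (eapply Rlt_le_trans; [exact Hy | apply Rmin_r]).
    assert (P := Cmod_ge_0 y).
    assert (T := Cexpq_taylor3 y ltac:(lra)).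
    assert (E0 : Cexpq 0 = 1) by (unfold Cexpq; destruct (Ceq_dec 0 0); [reflexivity | contradiction]).
    rewrite E0.
    replace (Cexpq y - 1 - y * / 2)%C
      with ((Cexpq y - (1 + y / 2 + y ^ 2 / 6 + y ^ 3 / 24)) + y ^ 2 * (RtoC (/ 6) + y * RtoC (/ 24)))%C
      by (rewrite !RtoC_inv by lra; Cfield).
    eapply Rle_trans; [apply Cmod_triangle|]; rewrite Cmod_mult, Cmod_pow.
    assert (T2 : Cmod (RtoC (/ 6) + y * RtoC (/ 24)) <= 1).
    { eapply Rle_trans; [apply Cmod_triangle|].
      rewrite Cmod_mult, !Cmod_R, !Rabs_pos_eq by lra; lra. }
    assert (P2 : 0 <= Cmod y ^ 2) by (apply pow_le, P).
    assert (P4 : Cmod y ^ 4 <= Cmod y ^ 2).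
    { replace (Cmod y ^ 4) with (Cmod y ^ 2 * Cmod y ^ 2) by ring.
      assert (Cmod y ^ 2 <= 1) by (simpl; nra). nra. }
    assert (T3 : Cmod y ^ 2 * Cmod (RtoC (/ 6) + y * RtoC (/ 24)) <= Cmod y ^ 2 * 1)
      by (apply Rmult_le_compat_l; assumption).
    assert (T4 : 4 * Cmod y ^ 2 <= e * Cmod y) by (simpl; nra).
    lra.
  - eexists; apply cderiv_ext_loc with (fun y => (Cexp y - 1) * / y)%C.
    + generalize (ccont_neq_0 _ _ (ccont_id u) N); apply filter_imp; intros y Hy.
      unfold Cexpq; destruct (Ceq_dec y 0); [contradiction | reflexivity].
    + assert (D := cderiv_Cexp u).
      apply (cderiv_mult (fun y => Cexp y - 1)%C (fun y => / y)%C).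
      * apply cderiv_minus; [exact D | apply cderiv_const].
      * apply cderiv_inv; [apply cderiv_id | exact N].
Qed.

Definition primitive (h : CC -> CC) (z : CC) : CC := CI (fun s => h (s * z) * z)%C 0 1.

(** Goursat's lemma on the triangle [0, z, y]. *)
Lemma entire_primitive (h : CC -> CC) : (forall z, exists l, cderiv h z l) ->
  forall z, cderiv (primitive h) z (h z).
Proof.
  intros Hh.
  assert (Hc : forall z, ccont h z) by (intros z; destruct (Hh z) as [l Hl]; eapply cderiv_ccont, Hl).
  assert (Hlin : forall z k : CC, forall t : R, ccont (fun t : R => z + t * k)%C t)
    by (intros z k t; eapply rderiv_ccont, rderiv_line).
  assert (D : forall z k, (primitive h (z + k) - primitive h z)%C = CI (fun t => h (z + t * k) * k)%C 0 1).
  { intros z k.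
    assert (G := Goursat h 0 (fun t => z + t * k)%C (fun _ => k) 0 1 0 1 (Cmod z + Cmod k)
      ltac:(lra) ltac:(lra)).
    unfold contour, arc_int, ray_int in G.
    rewrite (CI_ext (fun t => h (0 + 1 * (z + t * k)) * (1 * k))%C (fun t => h (z + t * k) * k)%C) in G;
      [|lra | intros t _; rewrite Cplus_0_l, !Cmult_1_l; reflexivity].
    rewrite (CI_ext (fun t => h (0 + 0 * (z + t * k)) * (0 * k))%C (fun _ => RtoC 0)) in G;
      [|lra | intros t _; ring].
    rewrite (CI_ext (fun s => h (0 + s * (z + 1 * k)) * (z + 1 * k))%C (fun s => h (s * (z + k)) * (z + k))%C) in G;
      [|lra | intros t _; rewrite Cplus_0_l, !Cmult_1_l; reflexivity].
    rewrite (CI_ext (fun s => h (0 + s * (z + 0 * k)) * (z + 0 * k))%C (fun s => h (s * z) * z)%C) in G;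
      [|lra | intros t _; rewrite Cplus_0_l, !Cmult_0_l, Cplus_0_r; reflexivity].
    rewrite CI_const in G; fold (primitive h (z + k)%C) (primitive h z) in G.
    assert (G' := G ltac:(intros t _; split; [apply rderiv_line | apply ccont_const])).
    clear G.
    assert (Hkz : forall t, 0 <= t <= 1 -> Cmod (z + t * k) <= Cmod z + Cmod k /\ Cmod k <= Cmod z + Cmod k).
    { intros t Ht; assert (P := Cmod_ge_0 z); assert (Q := Cmod_ge_0 k); split; [|lra].
      eapply Rle_trans; [apply Cmod_triangle|].
      rewrite Cmod_mult, Cmod_R, Rabs_pos_eq by lra; nra. }
    specialize (G' Hkz (fun s t _ _ => Hh _)).
    set (X := CI _ 0 1) in G' |- *.
    transitivity (X - (X - 0 * (1 - 0) - primitive h (z + k) + primitive h z))%C; [ring|].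
    rewrite G'; ring. }
  intros z; apply cderiv_eps; intros e He.
  destruct (proj1 (locally_C_iff _ _) (proj1 (ccont_eps _ _) (Hc z) e He)) as [d [Hd Hcont]].
  apply locally_C_iff; exists d; split; [exact Hd|]; intros y Hy.
  assert (E : primitive h y = primitive h (z + (y - z))%C) by (f_equal; ring).
  rewrite E, D; set (k := (y - z)%C) in *.
  assert (Hint : ccont_on (fun t => h (z + t * k) * k)%C 0 1).
  { intros t _; apply ccont_mult; [|apply ccont_const].
    apply (ccont_comp (fun t : R => z + t * k)%C h); [apply Hlin | apply Hc]. }
  replace (CI (fun t => h (z + t * k) * k)%C 0 1 - k * h z)%C
    with (CI (fun t => h (z + t * k) * k + - (h z * k))%C 0 1).
  2:{ rewrite CI_plus, CI_const by (first [lra | exact Hint | intros t _; apply ccont_const]); ring. }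
  replace (e * Cmod k) with (e * Cmod k * (1 - 0)) by ring.
  apply CI_bound; [lra | intros t Ht; apply ccont_plus; [apply Hint, Ht | apply ccont_const] |].
  intros t Ht.
  replace (h (z + t * k) * k + - (h z * k))%C with ((h (z + t * k)%C - h z) * k)%C by ring.
  rewrite Cmod_mult; apply Rmult_le_compat_r; [apply Cmod_ge_0|].
  left; apply Hcont.
  replace (z + t * k - z)%C with (t * k)%C by ring.
  rewrite Cmod_mult, Cmod_R, Rabs_pos_eq by lra.
  assert (P := Cmod_ge_0 k); nra.
Qed.

(** The entire function [sum_(n >= 1) u^n / (n n!)], so that [u exp (Ein u) = exp (Ei u - gamma)]. *)
Definition Ein : CC -> CC := primitive Cexpq.

Lemma cderiv_Ein (u : CC) : cderiv Ein u (Cexpq u).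
Proof. apply entire_primitive, cderiv_Cexpq. Qed.

Lemma Ein_0 : Ein 0 = 0.
Proof.
  unfold Ein, primitive; rewrite (CI_ext _ (fun _ => RtoC 0)); [|lra | intros; ring].
  rewrite CI_const; ring.
Qed.

Definition clog1p (z : CC) : CC := Cln (1 + z).
(** Solves [z f' / f = z / ln (1 + z)]: with [u = ln (1 + z)] and [dz = e^u du], one gets [d (log f)
    / du = e^u / u = 1 / u + Ein'(u)]. *)
Definition extremal (z : CC) : CC := (clog1p z * Cexp (Ein (clog1p z)))%C.
Definition extremal' (z : CC) : CC := Cexp (Ein (clog1p z)).

Lemma Cexp_clog1p (z : CC) : inU z -> Cexp (clog1p z) = (1 + z)%C.
Proof. intros Hz; apply Cexp_Cln, Re_one_plus_pos, Hz. Qed.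

Lemma one_plus_neq_0 (z : CC) : inU z -> (1 + z)%C <> 0.
Proof. intros Hz; rewrite <- Cexp_clog1p by exact Hz; apply Cexp_neq_0. Qed.

Lemma cderiv_clog1p (z : CC) : inU z -> cderiv clog1p z (/ (1 + z))%C.
Proof.
  intros Hz; replace (/ (1 + z))%C with ((0 + 1) * / (1 + z))%C by ring.
  apply (cderiv_comp (fun z => 1 + z)%C Cln).
  - apply cderiv_plus; [apply cderiv_const | apply cderiv_id].
  - apply cderiv_Cln, Re_one_plus_pos, Hz.
Qed.

Lemma clog1p_eq_0 (z : CC) : inU z -> clog1p z = 0 -> z = 0.
Proof.
  intros Hz E; assert (H := Cexp_clog1p z Hz); rewrite E, Cexp_0 in H.
  replace z with (1 + z - 1)%C by ring; rewrite <- H; ring.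
Qed.

Lemma clog1p_0 : clog1p 0 = 0.
Proof. unfold clog1p; replace (1 + 0)%C with (RtoC 1) by ring; apply Cln_1. Qed.

Lemma cderiv_extremal (z : CC) : inU z -> cderiv extremal z (extremal' z).
Proof.
  intros Hz; assert (D := cderiv_clog1p z Hz).
  assert (DE : cderiv (fun z => Cexp (Ein (clog1p z))) z
     (/ (1 + z) * (Cexpq (clog1p z) * Cexp (Ein (clog1p z))))%C).
  { apply (cderiv_comp clog1p (fun u => Cexp (Ein u))); [exact D|].
    apply (cderiv_comp Ein Cexp); [apply cderiv_Ein | apply cderiv_Cexp]. }
  eapply cderiv_eq; [exact (cderiv_mult _ _ _ _ _ D DE)|].
  unfold extremal'.
  transitivity (/ (1 + z) * Cexp (Ein (clog1p z)) * (1 + Cexpq (clog1p z) * clog1p z))%C; [ring|].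
  rewrite Cexpq_mult, Cexp_clog1p by exact Hz; field; apply one_plus_neq_0, Hz.
Qed.

Lemma extremal_0 : extremal 0 = 0.
Proof. unfold extremal; rewrite clog1p_0; ring. Qed.

Lemma extremal_eq_0 (z : CC) : inU z -> extremal z = 0 -> z = 0.
Proof.
  intros Hz E; apply clog1p_eq_0; [exact Hz|].
  destruct (Ceq_dec (clog1p z) 0) as [E0|N]; [exact E0 | exfalso].
  exact (Cmult_neq_0 _ _ N (Cexp_neq_0 _) E).
Qed.

(** * Univalence of the extremal function *)

(** Times [e^x / |u|^2] this is [Re ((e^u - 1) / u)] for [u = x + i y]. The first term is negative
    only for [x > 0] and [cos y < e^(-x)], and then [y sin y >= sin^2 y] outweighs it. *)
Lemma starlike_real_ineq (x y : R) : - PI / 2 < y < PI / 2 -> x <> 0 \/ y <> 0 ->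
  0 < x * (cos y - exp (- x)) + y * sin y.
Proof.
  intros Hy Hn.
  assert (Hc : 0 < cos y) by (apply cos_gt_0; lra).
  assert (Hs : 0 <= y * sin y /\ (sin y) ^ 2 <= y * sin y /\ (y <> 0 -> 0 < y * sin y)).
  { destruct (Rtotal_order y 0) as [L|[E|G]].
    - assert (S1 := sin_gt_0 (- y) ltac:(lra) ltac:(lra)); assert (S2 := sin_lt_x (- y) ltac:(lra)).
      rewrite sin_neg in S1, S2; simpl; repeat split; nra.
    - rewrite E, sin_0; simpl; repeat split; [lra | lra | intros N; contradiction].
    - assert (S1 := sin_gt_0 y ltac:(lra) ltac:(lra)); assert (S2 := sin_lt_x y ltac:(lra)).
      simpl; repeat split; nra. }
  destruct Hs as [Hs1 [Hs2 Hs3]].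
  assert (Hsc := sin2_cos2 y); unfold Rsqr in Hsc.
  assert (Hc1 := COS_bound y).
  destruct (Rtotal_order x 0) as [L|[E|G]].
  - assert (H := exp_ineq1 (- x) ltac:(lra)). nra.
  - subst x; destruct Hn as [N|N]; [lra|]; specialize (Hs3 N); lra.
  - set (m := exp (- x)); set (c := cos y) in *.
    assert (Hm : 0 < m) by apply exp_pos.
    assert (Hm1 : m < 1) by (unfold m; rewrite <- exp_0; apply exp_increasing; lra).
    assert (Hxm : (1 + x) * m < 1).
    { assert (H := exp_ineq1 x ltac:(lra)).
      assert (E : exp x * m = 1) by (unfold m; rewrite <- exp_plus, <- exp_0; f_equal; ring).
      nra. }
    destruct (Rlt_le_dec m c) as [D|D]; [nra|].
    destruct (Req_dec c m) as [E|N].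
    + assert (Ny : y <> 0) by (intros Ey; unfold c in E; rewrite Ey, cos_0 in E; lra).
      specialize (Hs3 Ny); rewrite E; lra.
    (* With [m = e^(-x)] and [c = cos y], [(1 + x) m < 1] implies [x (m - c) < 1 - c^2 = sin^2 y];
       multiplying by [m] lets that hypothesis replace [x m]. *)
    + assert (K : m * (x * (m - c)) < m * ((1 - c) * (1 + c))).
      { assert (x * m < 1 - m) by lra.
        assert (x * m * (m - c) < (1 - m) * (m - c)) by nra.
        assert (m * c <= 1 * c) by (apply Rmult_le_compat_r; lra).
        assert ((1 - m) * (m - c) <= (1 - m) * (m * (1 - c))) by (apply Rmult_le_compat_l; lra).
        assert (0 <= m * (1 - c)) by (apply Rmult_le_pos; lra).
        assert ((1 - m) * (m * (1 - c)) <= (1 + c) * (m * (1 - c))) by (apply Rmult_le_compat_r; lra). lra. }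
      apply Rmult_lt_reg_l in K; [|exact Hm].
      simpl in Hs2; nra.
Qed.

Lemma Re_div_clog1p (z : CC) : inU z -> z <> 0 -> 0 < fst (z / clog1p z)%C.
Proof.
  intros Hz Nz.
  assert (Nu : clog1p z <> 0) by (intros E; apply Nz, clog1p_eq_0; assumption).
  assert (B := Cln_Im_bound _ (Re_one_plus_pos z Hz)); fold (clog1p z) in B.
  assert (Ez : z = (Cexp (clog1p z) - 1)%C) by (rewrite Cexp_clog1p by exact Hz; ring).
  rewrite Ez at 1; clear Ez.
  assert (S := sum_sqr_neq_0 _ Nu).
  destruct (clog1p z) as [x y] eqn:Eu; cbn [fst snd] in *.
  assert (H := starlike_real_ineq x y B).
  assert (Hn : x <> 0 \/ y <> 0).
  { destruct (Req_dec x 0) as [->|N]; [right; intros ->; apply Nu; reflexivity | left; exact N]. }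
  specialize (H Hn).
  assert (P : 0 < x ^ 2 + y ^ 2) by (simpl in *; nra).
  replace (fst ((Cexp (x, y) - 1) / (x, y))%C)
    with (exp x * (x * (cos y - exp (- x)) + y * sin y) / (x ^ 2 + y ^ 2)).
  - apply Rdiv_lt_0_compat; [apply Rmult_lt_0_compat; [apply exp_pos | exact H] | exact P].
  - rewrite exp_Ropp; unfold Cexp; simpl; field; split; [simpl in *; lra | apply Rgt_not_eq, exp_pos].
Qed.

Lemma Re_inv_pos (z : CC) : 0 < fst z -> 0 < fst (/ z)%C.
Proof.
  intros Hz; simpl; apply Rdiv_lt_0_compat; [exact Hz|]; nra.
Qed.

(** A rotation by a multiple of [pi / 2] brings [z] into the right half-plane, where [Cexp_Cln]
    applies. *)
Lemma Cexp_surj (z : CC) : z <> 0 -> exists v, Cexp v = z.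
Proof.
  intros Nz.
  assert (K : forall c, 0 < fst (Cexp c * z)%C -> exists v, Cexp v = z).
  { intros c Hc; exists (Cln (Cexp c * z) + - c)%C.
    rewrite Cexp_plus, Cexp_opp, Cexp_Cln by exact Hc; field; apply Cexp_neq_0. }
  assert (R1 := K (0, 0)); assert (R2 := K (0, PI)); assert (R3 := K (0, PI / 2)).
  assert (R4 := K (0, - (PI / 2))); clear K.
  destruct z as [x y]; unfold Cexp in R1, R2, R3, R4; cbn [fst snd] in *.
  rewrite exp_0, ?cos_0, ?sin_0, ?cos_PI, ?sin_PI, ?cos_neg, ?sin_neg, ?cos_PI2, ?sin_PI2 in *.
  simpl in R1, R2, R3, R4.
  destruct (Rtotal_order x 0) as [L|[E|G]]; [apply R2; lra | | apply R1; lra].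
  destruct (Rtotal_order y 0) as [L|[E'|G]]; [apply R3; lra | | apply R4; lra].
  exfalso; apply Nz; rewrite E, E'; reflexivity.
Qed.

Lemma Cexp_period (v : CC) (k : Z) : Cexp (Cplus v (0, 2 * PI * IZR k)) = Cexp v.
Proof.
  rewrite Cexp_plus; replace (Cexp (0, 2 * PI * IZR k)) with (RtoC 1); [ring|].
  unfold Cexp; cbn [fst snd]; rewrite exp_0.
  replace (2 * PI * IZR k) with (2 * (IZR k * PI)) by ring.
  rewrite cos_2a_sin, sin_2a.
  rewrite (sin_eq_0_1 (IZR k * PI)) by (exists k; reflexivity).
  apply injective_projections; simpl; ring.
Qed.

(** Noshiro--Warschawski. *)
Lemma injective_of_Re_deriv_pos (F F' : CC -> CC) (a b : CC) :
  (forall t, 0 <= t <= 1 -> cderiv F (a + t * (b - a))%C (F' (a + t * (b - a))%C)) ->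
  (forall t, 0 <= t <= 1 -> 0 < fst (F' (a + t * (b - a))%C)) -> F a = F b -> a = b.
Proof.
  intros HF HR E.
  destruct (Ceq_dec (b - a) 0) as [E0|N].
  { symmetry; apply Ceq_minus, E0. }
  exfalso; set (k := (b - a)%C) in *.
  pose (phi := fun t : R => (Cconj k * F (a + t * k))%C).
  assert (Hphi : forall t, 0 <= t <= 1 -> rderiv phi t (k * (Cconj k * F' (a + t * k)))%C).
  { intros t Ht; unfold phi.
    apply (rderiv_comp (fun t => a + t * k)%C (fun z => Cconj k * F z)%C); [apply rderiv_line|].
    eapply cderiv_eq; [apply (cderiv_mult (fun _ => Cconj k) F); [apply cderiv_const | apply HF, Ht] | ring]. }
  destruct (MVT_gen (fun t => fst (phi t)) 0 1 (fun t => fst (k * (Cconj k * F' (a + t * k)))%C)) as [c [Hc Ec]].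
  - rewrite Rmin_left, Rmax_right by lra; intros t Ht; apply Hphi; lra.
  - rewrite Rmin_left, Rmax_right by lra; intros t Ht; apply continuity_pt_filterlim.
    apply (rderiv_ccont _ _ _ (Hphi t Ht)).
  - rewrite Rmin_left, Rmax_right in Hc by lra.
    assert (E1 : phi 1 = phi 0).
    { unfold phi; f_equal.
      replace (a + 1%R * k)%C with b by (unfold k; ring).
      replace (a + 0%R * k)%C with a by ring; symmetry; exact E. }
    rewrite E1 in Ec.
    specialize (HR c Hc).
    replace (k * (Cconj k * F' (a + c * k)))%C with (RtoC (Cmod k ^ 2) * F' (a + c * k)%C)%C in Ec
      by (rewrite Cmod2_conj; ring).
    assert (P : 0 < Cmod k ^ 2) by (apply pow_lt, Cmod_gt_0, N).
    simpl in Ec, P; nra.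
Qed.

(** A branch of [log f] at [e^v] for [Re v < 0]. In [v + log (u / z) + Ein u], with [z = e^v] and
    [u = ln (1 + z)], the principal logarithm meets only [u / z], whose real part is positive. *)
Definition logf (v : CC) : CC :=
  (v + (Cln (clog1p (Cexp v) / Cexp v) + Ein (clog1p (Cexp v))))%C.

Lemma inU_Cexp (v : CC) : fst v < 0 -> inU (Cexp v).
Proof. intros Hv; unfold inU; rewrite Cmod_Cexp, <- exp_0; apply exp_increasing, Hv. Qed.

Lemma Re_clog1p_div (v : CC) : fst v < 0 -> 0 < fst (clog1p (Cexp v) / Cexp v)%C.
Proof.
  intros Hv; assert (Hz := inU_Cexp v Hv).
  assert (Nu : clog1p (Cexp v) <> 0)
    by (intros E; apply (Cexp_neq_0 v), clog1p_eq_0; assumption).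
  replace (clog1p (Cexp v) / Cexp v)%C with (/ (Cexp v / clog1p (Cexp v)))%C
    by (field; split; first [exact Nu | apply Cexp_neq_0]).
  apply Re_inv_pos, Re_div_clog1p; [exact Hz | apply Cexp_neq_0].
Qed.

Lemma Cexp_logf (v : CC) : fst v < 0 -> Cexp (logf v) = extremal (Cexp v).
Proof.
  intros Hv; unfold logf, extremal; rewrite !Cexp_plus, Cexp_Cln by (apply Re_clog1p_div, Hv).
  field; apply Cexp_neq_0.
Qed.

Lemma cderiv_logf (v : CC) : fst v < 0 -> cderiv logf v (Cexp v / clog1p (Cexp v))%C.
Proof.
  intros Hv; assert (Hz := inU_Cexp v Hv).
  assert (Nz := Cexp_neq_0 v).
  assert (Nu : clog1p (Cexp v) <> 0)
    by (intros E; apply Nz, clog1p_eq_0; assumption).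
  assert (N1 := one_plus_neq_0 _ Hz).
  assert (De := cderiv_Cexp v).
  assert (Du := cderiv_comp _ clog1p _ _ _ De (cderiv_clog1p _ Hz)).
  assert (Di := cderiv_inv _ _ _ De Nz).
  assert (Dq := cderiv_mult _ _ _ _ _ Du Di).
  assert (Dl := cderiv_comp _ Cln _ _ _ Dq (cderiv_Cln _ (Re_clog1p_div v Hv))).
  assert (DE := cderiv_comp _ Ein _ _ _ Du (cderiv_Ein _)).
  eapply cderiv_eq; [exact (cderiv_plus _ _ _ _ _ (cderiv_id v) (cderiv_plus _ _ _ _ _ Dl DE))|].
  assert (Eq := Cexpq_mult (clog1p (Cexp v))); rewrite Cexp_clog1p in Eq by exact Hz.
  replace (Cexpq (clog1p (Cexp v))) with (Cexp v / clog1p (Cexp v))%C.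
  - field; repeat split; assumption.
  - transitivity ((1 + Cexp v - 1) / clog1p (Cexp v))%C; [field; exact Nu|].
    rewrite <- Eq; field; exact Nu.
Qed.

Lemma univalent_extremal : univalent_U extremal.
Proof.
  intros z1 z2 H1 H2 E.
  destruct (Ceq_dec z1 0) as [->|N1].
  { rewrite extremal_0 in E; symmetry; apply extremal_eq_0; [exact H2 | symmetry; exact E]. }
  destruct (Ceq_dec z2 0) as [->|N2].
  { rewrite extremal_0 in E; apply extremal_eq_0; assumption. }
  destruct (Cexp_surj z1 N1) as [v1 E1]; destruct (Cexp_surj z2 N2) as [v2 E2]; subst z1 z2.
  assert (HRe : forall v, inU (Cexp v) -> fst v < 0).
  { intros v Hv; unfold inU in Hv; rewrite Cmod_Cexp, <- exp_0 in Hv; apply exp_lt_inv, Hv. }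
  apply HRe in H1; apply HRe in H2; clear HRe.
  rewrite <- !Cexp_logf in E by assumption.
  destruct (Cexp_eq_1 (logf v1 + - logf v2)%C) as [k Hk].
  { rewrite Cexp_plus, Cexp_opp, E; field; apply Cexp_neq_0. }
  (* All summands of [logf v] but the first depend on [Cexp v] alone, so [logf] commutes with the
     shift by [2 pi i k]; shifting [v2] makes the two values of [logf] equal. *)
  pose (v3 := Cplus v2 (0, 2 * PI * IZR k)).
  assert (Ev3 : Cexp v3 = Cexp v2) by apply Cexp_period.
  assert (H3 : fst v3 < 0) by (unfold v3; simpl; lra).
  assert (EF : logf v1 = logf v3).
  { unfold logf at 2; rewrite Ev3; unfold v3; rewrite <- Hk; unfold logf at 3; ring. }
  rewrite <- Ev3; f_equal.
  assert (Hseg : forall t, 0 <= t <= 1 -> fst (v1 + t * (v3 - v1))%C < 0).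
  { intros t Ht; simpl; destruct (Rle_lt_or_eq_dec 0 t (proj1 Ht)) as [L|L]; [nra | subst t; lra]. }
  apply (injective_of_Re_deriv_pos logf (fun v => Cexp v / clog1p (Cexp v))%C); [| |exact EF].
  - intros t Ht; apply cderiv_logf, Hseg, Ht.
  - intros t Ht; apply Re_div_clog1p; [apply inU_Cexp, Hseg, Ht | apply Cexp_neq_0].
Qed.

Lemma classS_extremal : classS extremal.
Proof.
  split; [intros z Hz; eexists; apply cderiv_extremal, Hz|].
  split; [exact univalent_extremal|].
  split; [exact extremal_0|].
  apply cderiv_eq with (extremal' 0).
  - apply cderiv_extremal; unfold inU; rewrite Cmod_0; lra.
  - unfold extremal'; rewrite clog1p_0, Ein_0; apply Cexp_0.
Qed.

Lemma starfun_extremal (z : CC) : inU z -> starfun extremal extremal' z = Psi z.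
Proof.
  intros Hz; unfold starfun, Psi; destruct (Defs.Ceq_dec z 0) as [E|N]; [reflexivity|].
  unfold extremal, extremal'; fold (clog1p z).
  field; split; [intros E; apply N, clog1p_eq_0; assumption | apply Cexp_neq_0].
Qed.

(** * Inverse of the extremal function *)


Lemma exp_le_of_opp (x c : R) : 0 < c -> / c <= exp (- x) -> exp x <= c.
Proof.
  intros Hc H; rewrite exp_Ropp in H; assert (P := exp_pos x).
  apply Rinv_le_contravar in H; [|apply Rinv_0_lt_compat, Hc].
  rewrite !Rinv_inv in H; exact H.
Qed.

Lemma exp_INR_mult (n : nat) (x : R) : exp (INR n * x) = exp x ^ n.
Proof.
  induction n as [|n IH]; [simpl; rewrite Rmult_0_l; apply exp_0|].
  rewrite S_INR, Rmult_plus_distr_r, exp_plus, IH, Rmult_1_l; simpl; ring.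
Qed.

(** The 16th power of [1 - d <= e^(-d)] is accurate enough at [16 d = 1/2] and [16 d = 2/3] for the
    rational bounds that the contraction needs. *)
Lemma exp_opp_ge_pow16 (d : R) : 0 <= d < 1 -> (1 - d) ^ 16 <= exp (- (16 * d)).
Proof.
  intros Hd; replace (- (16 * d)) with (INR 16 * - d) by (simpl; ring).
  rewrite exp_INR_mult; apply pow_incr; split; [lra|].
  generalize (exp_ineq1_le (- d)); lra.
Qed.

Lemma exp_half_le : exp (/ 2) <= 5 / 3.
Proof.
  apply exp_le_of_opp; [lra|].
  assert (H := exp_opp_ge_pow16 (/ 32) ltac:(lra)).
  replace (16 * / 32) with (/ 2) in H by field.
  eapply Rle_trans; [|exact H]; lra.
Qed.

Lemma exp_two_thirds_le : exp (2 / 3) <= 2.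
Proof.
  apply exp_le_of_opp; [lra|].
  assert (H := exp_opp_ge_pow16 (/ 24) ltac:(lra)).
  replace (16 * / 24) with (2 / 3) in H by field.
  eapply Rle_trans; [|exact H]; lra.
Qed.

(** Convexity: by [exp_half_le] the chord over [[0, 1/2]] has slope at most
    [(5/3 - 1) / (1/2) = 4/3]. A point above the line would give a larger derivative before it than
    after it. *)
Lemma exp_chord (x : R) : 0 <= x <= / 2 -> exp x - 1 <= 4 / 3 * x.
Proof.
  intros Hx; apply Rnot_lt_le; intros H.
  assert (H2 := exp_half_le).
  assert (N0 : 0 < x) by (destruct (Rle_lt_or_eq_dec 0 x (proj1 Hx)) as [L|L];
    [exact L | subst x; rewrite exp_0 in H; lra]).
  assert (N1 : x < / 2) by (destruct (Rle_lt_or_eq_dec x (/ 2) (proj2 Hx)) as [L|L];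
    [exact L | subst x; lra]).
  destruct (MVT_cor2 exp exp 0 x N0 (fun c _ => derivable_pt_lim_exp c)) as [c1 [E1 C1]].
  destruct (MVT_cor2 exp exp x (/ 2) N1 (fun c _ => derivable_pt_lim_exp c)) as [c2 [E2 C2]].
  rewrite exp_0 in E1.
  assert (I : exp c1 < exp c2) by (apply exp_increasing; lra).
  assert (L1 : 4 / 3 < exp c1) by (apply Rmult_lt_reg_r with x; lra).
  assert (L2 : exp c2 < 4 / 3) by (apply Rmult_lt_reg_r with (/ 2 - x); lra).
  lra.
Qed.

Lemma Cexp_sub_1_bound (u : CC) : Cmod u <= / 2 -> Cmod (Cexp u - 1)%C <= 4 / 3 * Cmod u.
Proof.
  intros Hu; eapply Rle_trans; [|apply exp_chord; split; [apply Cmod_ge_0 | exact Hu]].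
  assert (H := mean_value_majorant Cexp Cexp 0 u (fun t => exp (t * Cmod u)) (fun t => Cmod u * exp (t * Cmod u))).
  rewrite Cplus_0_l, Cexp_0, Rmult_1_l, Rmult_0_l, exp_0 in H; apply H.
  - intros t _; apply cderiv_Cexp.
  - intros t _; auto_derive; auto; ring.
  - intros t Ht; rewrite Cmod_mult, Rmult_comm, Cmod_Cexp, Cplus_0_l.
    apply Rmult_le_compat_l; [apply Cmod_ge_0|].
    assert (L : fst (t * u)%C <= t * Cmod u).
    { eapply Rle_trans; [apply Re_le_Cmod|]; rewrite Cmod_mult, Cmod_R, Rabs_pos_eq by lra; lra. }
    destruct (Rle_lt_or_eq_dec _ _ L) as [L'|L']; [left; apply exp_increasing, L' | rewrite L'; lra].
Qed.

Lemma Cexpq_bound (u : CC) : Cmod u <= / 2 -> Cmod (Cexpq u) <= 4 / 3.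
Proof.
  intros Hu; destruct (Ceq_dec u 0) as [E|N].
  - unfold Cexpq; destruct (Ceq_dec u 0); [rewrite Cmod_1; lra | contradiction].
  - assert (P : 0 < Cmod u) by (apply Cmod_gt_0, N).
    apply Rmult_le_reg_r with (Cmod u); [exact P|].
    rewrite <- Cmod_mult, Cexpq_mult; apply Cexp_sub_1_bound, Hu.
Qed.

Lemma Cmod_segment (a b : CC) (r t : R) : Cmod a <= r -> Cmod b <= r -> 0 <= t <= 1 ->
  Cmod (a + t * (b - a))%C <= r.
Proof.
  intros Ha Hb Ht.
  replace (a + t * (b - a))%C with (RtoC (1 - t) * a + t * b)%C by (rewrite RtoC_minus; ring).
  eapply Rle_trans; [apply Cmod_triangle|].
  rewrite !Cmod_mult, !Cmod_R, !Rabs_pos_eq by lra; nra.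
Qed.

(** From [|Ein'| <= 4/3] on the disc, [|Ein u| <= 2/3], and [e^(2/3) <= 2]. The bound 2 is what
    [|w| <= 1/4] needs to map the disc of radius [1/2] into itself. *)
Lemma Cexp_opp_Ein_bound (u : CC) : Cmod u <= / 2 -> Cmod (Cexp (- Ein u)) <= 2.
Proof.
  intros Hu.
  assert (B : Cmod (Ein u) <= 2 / 3).
  { replace (Ein u) with (Ein (0 + (u - 0)) - Ein 0)%C
      by (rewrite Ein_0; replace (0 + (u - 0))%C with u by ring; ring).
    eapply Rle_trans; [apply (mean_value_ineq Ein Cexpq 0 (u - 0) (4 / 3))|].
    - intros t _; apply cderiv_Ein.
    - intros t Ht; apply Cexpq_bound, Cmod_segment; [rewrite Cmod_0; lra | exact Hu | exact Ht].
    - replace (u - 0)%C with u by ring; lra. }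
  rewrite Cmod_Cexp; eapply Rle_trans; [|apply exp_two_thirds_le].
  assert (L : fst (- Ein u)%C <= 2 / 3)
    by (eapply Rle_trans; [apply Re_le_Cmod|]; rewrite Cmod_opp; exact B).
  destruct (Rle_lt_or_eq_dec _ _ L) as [L'|L']; [left; apply exp_increasing, L' | rewrite L'; lra].
Qed.

(** The equation [u exp (Ein u) = w] is solved as the fixed point of [u |-> w exp (- Ein u)], which
    for [|w| < 1/4] contracts the disc [|u| <= 1/2]. *)
Definition step (w u : CC) : CC := (w * Cexp (- Ein u))%C.

Lemma step_disc (w u : CC) : Cmod w <= / 4 -> Cmod u <= / 2 -> Cmod (step w u) <= / 2.
Proof.
  intros Hw Hu; unfold step; rewrite Cmod_mult.
  assert (B := Cexp_opp_Ein_bound u Hu); assert (P := Cmod_ge_0 w).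
  assert (Q := Cmod_ge_0 (Cexp (- Ein u))); nra.
Qed.

Lemma step_contracts (w u1 u2 : CC) : Cmod w <= / 4 -> Cmod u1 <= / 2 -> Cmod u2 <= / 2 ->
  Cmod (step w u1 - step w u2) <= 2 / 3 * Cmod (u1 - u2).
Proof.
  intros Hw H1 H2.
  replace (step w u1) with (step w (u2 + (u1 - u2))%C) by (f_equal; ring).
  apply (mean_value_ineq (step w) (fun u => w * (- Cexpq u * Cexp (- Ein u)))%C).
  - intros t Ht; set (u := (u2 + t * (u1 - u2))%C).
    assert (D : cderiv (fun u => Cexp (- Ein u)) u (- Cexpq u * Cexp (- Ein u))%C).
    { apply (cderiv_comp (fun u => - Ein u)%C Cexp); [apply cderiv_opp, cderiv_Ein | apply cderiv_Cexp]. }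
    eapply cderiv_eq; [exact (cderiv_mult _ _ _ _ _ (cderiv_const w u) D) | cbv beta; ring].
  - intros t Ht; set (u := (u2 + t * (u1 - u2))%C).
    assert (Hu : Cmod u <= / 2) by (apply Cmod_segment; assumption).
    rewrite !Cmod_mult, Cmod_opp.
    assert (B := Cexp_opp_Ein_bound u Hu); assert (C := Cexpq_bound u Hu).
    (* The factors bound [|w|], [|Cexpq u|] and [|Cexp (- Ein u)|] in turn. *)
    replace (2 / 3) with (/ 4 * (4 / 3 * 2)) by field.
    apply Rmult_le_compat; try apply Cmod_ge_0; [apply Rmult_le_pos; apply Cmod_ge_0 | exact Hw |].
    apply Rmult_le_compat; try apply Cmod_ge_0; assumption.
Qed.

(** The intervals of radius [3 C (2/3)^n] about [u n] are nested, because [3 C (2/3)^n - C (2/3)^n =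
    3 C (2/3)^(n+1)]. *)
Lemma geometric_limit (u : nat -> R) (C : R) : 0 <= C ->
  (forall n, Rabs (u (S n) - u n) <= C * (2 / 3) ^ n) ->
  exists l, forall n, Rabs (u n - l) <= 3 * C * (2 / 3) ^ n.
Proof.
  intros HC Hu.
  assert (Hq : forall n, 0 <= C * (2 / 3) ^ n)
    by (intros n; apply Rmult_le_pos; [exact HC | apply pow_le; lra]).
  destruct (nested_intervals (fun n => u n - 3 * (C * (2 / 3) ^ n)) (fun n => 6 * (C * (2 / 3) ^ n))) as [l Hl].
  - intros n; specialize (Hq n); lra.
  - intros n; specialize (Hu n); apply Rabs_le_between in Hu; specialize (Hq n); simpl pow; lra.
  - exists l; intros n; specialize (Hl n); apply Rabs_le; lra.
Qed.

Lemma geometric_limit_C (u : nat -> CC) (C : R) : 0 <= C ->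
  (forall n, Cmod (u (S n) - u n) <= C * (2 / 3) ^ n) ->
  exists l, forall n, Cmod (u n - l)%C <= 6 * C * (2 / 3) ^ n.
Proof.
  intros HC Hu.
  destruct (geometric_limit (fun n => fst (u n)) C HC) as [x Hx].
  { intros n; eapply Rle_trans; [|apply Hu].
    eapply Rle_trans; [apply Rmax_l | apply (Rmax_Cmod (u (S n) - u n)%C)]. }
  destruct (geometric_limit (fun n => snd (u n)) C HC) as [y Hy].
  { intros n; eapply Rle_trans; [|apply Hu].
    eapply Rle_trans; [apply Rmax_r | apply (Rmax_Cmod (u (S n) - u n)%C)]. }
  exists (x, y); intros n; specialize (Hx n); specialize (Hy n).
  replace (u n - (x, y))%C with (RtoC (fst (u n) - x) + RtoC (snd (u n) - y) * Ci)%C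
    by (apply injective_projections; simpl; ring).
  eapply Rle_trans; [apply Cmod_triangle|].
  rewrite Cmod_mult, !Cmod_R, Cmod_Ci; lra.
Qed.

Lemma geometric_small (K e : R) : 0 <= K -> 0 < e -> exists n, K * (2 / 3) ^ n < e.
Proof.
  intros HK He.
  destruct (pow_lt_1_zero (2 / 3)) with (y := e / (K + 1)) as [N HN].
  - rewrite Rabs_pos_eq; lra.
  - apply Rdiv_lt_0_compat; lra.
  - exists N; specialize (HN N (Nat.le_refl _)).
    assert (P : 0 <= (2 / 3) ^ N) by (apply pow_le; lra).
    rewrite Rabs_pos_eq in HN by exact P.
    apply Rlt_div_r in HN; [|lra]; nra.
Qed.

Lemma step_fixed_point (w : CC) : Cmod w <= / 4 -> exists u, Cmod u <= / 2 /\ step w u = u.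
Proof.
  intros Hw.
  pose (U := fix U n := match n with O => RtoC 0 | S m => step w (U m) end).
  assert (HU : forall n, Cmod (U n) <= / 2).
  { induction n as [|n IH]; simpl; [rewrite Cmod_0; lra | apply step_disc; assumption]. }
  assert (Hd : forall n, Cmod (U (S n) - U n) <= 1 * (2 / 3) ^ n).
  { induction n as [|n IH].
    - replace (U 1%nat - U 0%nat)%C with (U 1%nat) by (simpl; ring).
      specialize (HU 1%nat); simpl pow; lra.
    - change (U (S (S n))) with (step w (U (S n))); change (U (S n)) with (step w (U n)) at 2.
      eapply Rle_trans; [apply step_contracts; auto|]; simpl pow; lra. }
  destruct (geometric_limit_C U 1 ltac:(lra) Hd) as [u Hu].
  assert (Hu2 : Cmod u <= / 2).
  { apply le_epsilon; intros e He.
    destruct (geometric_small 6 e ltac:(lra) He) as [n Hn].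
    specialize (Hu n); specialize (HU n).
    replace u with (U n - (U n - u))%C by ring.
    eapply Rle_trans; [apply Cmod_triangle_sub|]; lra. }
  exists u; split; [exact Hu2|].
  apply Ceq_minus, Cmod_eq_0, Rle_antisym; [|apply Cmod_ge_0].
  apply le_epsilon; intros e He.
  destruct (geometric_small 12 e ltac:(lra) He) as [n Hn].
  replace (step w u - u)%C with ((step w u - step w (U n)) + (U (S n) - u))%C by (simpl; ring).
  eapply Rle_trans; [apply Cmod_triangle|].
  assert (T := step_contracts w u (U n) Hw Hu2 (HU n)).
  assert (H1 := Hu n); assert (H2 := Hu (S n)).
  rewrite Cmod_sub_sym in H1; simpl pow in H2.
  assert (P : 0 <= (2 / 3) ^ n) by (apply pow_le; lra). lra.
Qed.

Definition ufix (w : CC) : CC := epsilon (inhabits (RtoC 0)) (fun u => Cmod u <= / 2 /\ step w u = u).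
Definition extremal_inv (w : CC) : CC := (Cexp (ufix w) - 1)%C.

Lemma ufix_spec (w : CC) : Cmod w <= / 4 -> Cmod (ufix w) <= / 2 /\ step w (ufix w) = ufix w.
Proof.
  intros Hw; unfold ufix; apply epsilon_spec, step_fixed_point, Hw.
Qed.

(** The constant is [6 = 2 / (1 - 2/3)]. The continuity it gives is what [cderiv_inverse] requires
    of the inverse. *)
Lemma ufix_lipschitz (w1 w2 : CC) : Cmod w1 <= / 4 -> Cmod w2 <= / 4 ->
  Cmod (ufix w1 - ufix w2) <= 6 * Cmod (w1 - w2).
Proof.
  intros H1 H2; destruct (ufix_spec w1 H1) as [B1 E1]; destruct (ufix_spec w2 H2) as [B2 E2].
  assert (E : (ufix w1 - ufix w2 = (step w1 (ufix w1) - step w1 (ufix w2))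
     + (w1 - w2) * Cexp (- Ein (ufix w2)))%C).
  { rewrite E1; rewrite <- E2 at 1; unfold step; ring. }
  assert (T := Cmod_triangle (step w1 (ufix w1) - step w1 (ufix w2)) ((w1 - w2) * Cexp (- Ein (ufix w2)))).
  rewrite <- E, Cmod_mult in T.
  assert (C := step_contracts w1 _ _ H1 B1 B2).
  assert (D := Cexp_opp_Ein_bound _ B2); assert (P := Cmod_ge_0 (w1 - w2)). nra.
Qed.

Lemma extremal_inv_spec (w : CC) : Cmod w < / 4 -> inU (extremal_inv w) /\ extremal (extremal_inv w) = w.
Proof.
  intros Hw; destruct (ufix_spec w ltac:(lra)) as [B E]; split.
  (* [|e^u - 1| <= 4/3 |u| <= 2/3] for [|u| <= 1/2]. *)
  - unfold inU, extremal_inv; eapply Rle_lt_trans; [apply Cexp_sub_1_bound, B | lra].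
  - unfold extremal, clog1p, extremal_inv.
    replace (1 + (Cexp (ufix w) - 1))%C with (Cexp (ufix w)) by ring.
    (* The imaginary part stays within [(-pi, pi)], so the principal logarithm of [e^u] returns
       [u]. *)
    assert (Hi : Rabs (snd (ufix w)) <= / 2).
    { eapply Rle_trans; [|exact B]; eapply Rle_trans; [apply Rmax_r | apply Rmax_Cmod]. }
    apply Rabs_le_between in Hi.
    rewrite Cln_Cexp by (generalize PI2_1; lra).
    rewrite <- E at 1; unfold step; rewrite Cexp_opp; field; apply Cexp_neq_0.
Qed.

Lemma cderiv_extremal_inv (w : CC) : Cmod w < / 4 -> exists l, cderiv extremal_inv w l.
Proof.
  intros Hw; destruct (extremal_inv_spec w Hw) as [G1 G2].
  assert (Hl : locally w (fun y => Cmod y < / 4)).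
  { apply locally_C_iff; exists (/ 4 - Cmod w); split; [lra|]; intros y Hy.
    assert (T := Cmod_triangle_inv y w); lra. }
  exists (/ extremal' (extremal_inv w))%C; apply (cderiv_inverse extremal extremal_inv).
  - revert Hl; apply filter_imp; intros y Hy; apply extremal_inv_spec, Hy.
  - unfold extremal_inv; apply ccont_minus; [|apply ccont_const].
    apply (ccont_comp ufix Cexp); [|eapply cderiv_ccont, cderiv_Cexp].
    apply ccont_eps; intros e He.
    assert (Hs : locally w (fun y => Cmod (y - w) < e / 6))
      by (apply locally_C_iff; exists (e / 6); split; [lra | auto]).
    generalize (filter_and _ _ Hl Hs); apply filter_imp; intros y [H1 H2].
    eapply Rle_lt_trans; [apply ufix_lipschitz; lra | lra].
  - apply cderiv_extremal, G1.
  - apply Cexp_neq_0.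
Qed.

Lemma inverse_coeffs_extremal_inv : inverse_coeffs extremal extremal_inv (tcoef (/ 8) extremal_inv).
Proof.
  split; [exact extremal_inv_spec|].
  (* Half the radius [1/8] of the circle carrying the coefficients, which itself lies inside
     [|w| < 1/4]. *)
  exists (/ 16); split; [lra|]; intros w Hw.
  apply holo_is_pseries; [lra | | lra].
  intros z Hz; apply cderiv_extremal_inv; lra.
Qed.

Lemma subord_id (h : CC -> CC) : subord h h.
Proof.
  exists (fun z => z); split; [intros z _; eexists; apply cderiv_id|].
  split; [reflexivity|]; intros z Hz; split; [exact Hz | reflexivity].
Qed.

Lemma SGstar_extremal : SGstar extremal.
Proof.
  split; [exact classS_extremal|].
  exists extremal'; split; [exact cderiv_extremal|].
  destruct (subord_id Psi) as [w [Hw [H0 H]]].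
  exists w; split; [exact Hw|]; split; [exact H0|].
  intros z Hz; split; [apply H, Hz|]; rewrite starfun_extremal by exact Hz; apply H, Hz.
Qed.

Lemma extremal_inv_coefs : Cmod (tcoef (/ 8) extremal_inv 2) = 1 / 2 /\ Cmod (tcoef (/ 8) extremal_inv 3) = 5 / 12.
Proof.
  destruct (inverse_coef_relation extremal extremal' (fun z => z) extremal_inv (tcoef (/ 8) extremal_inv) 1 0 0) as [-> [-> _]].
  - exact classS_extremal.
  - exact cderiv_extremal.
  - intros z _; eexists; apply cderiv_id.
  - reflexivity.
  - intros z Hz; split; [exact Hz | apply starfun_extremal, Hz].
  - exact inverse_coeffs_extremal_inv.
  - exact jet_id.
  - split.
    + replace (- (1) / 2)%C with (RtoC (- (1 / 2))) by (rewrite RtoC_opp, RtoC_div by lra; Cfield).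
      rewrite Cmod_R, Rabs_Ropp, Rabs_pos_eq; lra.
    + replace (5 / 12 * 1 ^ 2 - 0 / 4)%C with (RtoC (5 / 12)) by (rewrite RtoC_div by lra; Cfield).
      rewrite Cmod_R, Rabs_pos_eq; lra.
Qed.

Theorem theorem4 :
  (forall (f g : CC -> CC) (A : nat -> CC),
      SGstar f -> inverse_coeffs f g A ->
      Cmod (A 2%nat) <= 1/2 /\ Cmod (A 3%nat) <= 5/12 /\ Cmod (A 4%nat) <= 31/72) /\
  (exists (f g : CC -> CC) (A : nat -> CC),
      SGstar f /\ inverse_coeffs f g A /\ Cmod (A 2%nat) = 1/2) /\
  (exists (f g : CC -> CC) (A : nat -> CC),
      SGstar f /\ inverse_coeffs f g A /\ Cmod (A 3%nat) = 5/12).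
Proof.
  split; [exact coefficient_bounds|].
  destruct extremal_inv_coefs as [E2 E3].
  split; exists extremal, extremal_inv, (tcoef (/ 8) extremal_inv); split; try exact SGstar_extremal;
    split; try exact inverse_coeffs_extremal_inv; assumption.
Qed.
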